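(* Let $n\ge 3$. (1) If $\mathcal{L}$ is a Lie algebra of type $M(n,{\bf a},{\bf c},{\bf d})$ and $V$ is an irreducible finite-dimensional $\mathcal{L}$-module, then $V$ is an irreducible $\mathrm{gim}(M_n)$-module, with $\mathrm{gim}(M_n)$ acting through a surjective Lie algebra homomorphism $\mathrm{gim}(M_n)\to\mathcal{L}$. (2) If $V$ is a finite-dimensional irreducible $\mathrm{gim}(M_n)$-module, then $V$ is an irreducible module of some Lie algebra of type $M(n,{\bf a},{\bf c},{\bf d})$ (for some ${\bf a}\in\mathbb{Z}_{\ge0}$, ${\bf c},{\bf d}\in\{0,1\}$).
   Context: All Lie algebras are over $\mathbb{C}$. For $n\geq 3$, $M_n=(m_{i,j})_{1\le i,j\le n}$ is the $n\times n$ integer matrix with $m_{i,i}=2$ for all $i$, $m_{i,i+1}=m_{i+1,i}=-1$ for $1\leq i\leq n-1$, $m_{1,n}=m_{n,1}=1$, and all other entries $0$. The Lie algebra $\mathrm{gim}(M_n)$ is the Lie algebra generated by $e_1,\dots,e_n,f_1,\dots,f_n,h_1,\dots,h_n$ subject to the relations: (R1) for all $1\le i,j\le n$: $[h_i,e_j]=m_{i,j}e_j$, $[h_i,f_j]=-m_{i,j}f_j$, $[e_i,f_i]=h_i$; (R2) for $i\neq j$ with $m_{i,j}\leq 0$: $[e_i,f_j]=0=[f_i,e_j]$ and $(\mathrm{ad}\,e_i)^{-m_{i,j}+1}e_j=0=(\mathrm{ad}\,f_i)^{-m_{i,j}+1}f_j$; (R3) for $i\neq j$ with $m_{i,j}>0$: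 $[e_i,e_j]=0=[f_i,f_j]$ and $(\mathrm{ad}\,e_i)^{m_{i,j}+1}f_j=0=(\mathrm{ad}\,f_i)^{m_{i,j}+1}e_j$. A Lie algebra $\mathcal{L}$ is said to be of type $M(n,{\bf a},{\bf c},{\bf d})$ (where $n\ge3$, ${\bf a}\in\mathbb{Z}_{\geq 0}$, ${\bf c},{\bf d}\in\{0,1\}$) if $\mathcal{L}$ is a non-trivial (nonzero) semisimple Lie algebra isomorphic to a direct sum of ${\bf a}$ copies of $sl_{2n}$, ${\bf c}$ copies of $sp_{2n}$ and ${\bf d}$ copies of $so_{2n}$. *)

(* Defs.v *)
From HB Require Import structures.
From mathcomp Require Import all_boot all_order all_algebra.
From mathcomp Require Import complex.
Set Implicit Arguments. Unset Strict Implicit. Unset Printing Implicit Defensive.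
Import Order.TTheory GRing.Theory Num.Theory.
Local Open Scope ring_scope.

(* The ground field is R[i] (complex numbers over a real closed field R);
   for R the real numbers this is C. *)

(** The matrix M_n, with 0-based indices: index i here is index i+1 of the
    paper.  m_{i,i} = 2, m_{i,i+1} = m_{i+1,i} = -1, m_{1,n} = m_{n,1} = 1,
    all other entries 0. *)
Definition Mn (n : nat) (i j : 'I_n) : int :=
  if i == j then Posz 2
  else if (i.+1 == j :> nat) || (j.+1 == i :> nat) then - Posz 1
  else if ((i == 0 :> nat) && (j == n.-1 :> nat)) ||
          ((j == 0 :> nat) && (i == n.-1 :> nat)) then Posz 1
  else Posz 0.

Definition adpow (T : Type) (br : T -> T -> T) (k : nat) (x y : T) : T :=
  iter k (br x) y.

Definition gim_rel (n : nat) (T : zmodType) (br : T -> T -> T)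
    (e f h : 'I_n -> T) : Prop :=
  (forall i j : 'I_n,
      br (h i) (e j) = e j *~ Mn i j /\
      br (h i) (f j) = - (f j *~ Mn i j)) /\
  (forall i : 'I_n, br (e i) (f i) = h i) /\
  (forall i j : 'I_n, i != j -> Mn i j <= 0 ->
      br (e i) (f j) = 0 /\ br (f i) (e j) = 0 /\
      adpow br (absz (1 - Mn i j)) (e i) (e j) = 0 /\
      adpow br (absz (1 - Mn i j)) (f i) (f j) = 0) /\
  (forall i j : 'I_n, i != j -> 0 < Mn i j ->
      br (e i) (e j) = 0 /\ br (f i) (f j) = 0 /\
      adpow br (absz (Mn i j + 1)) (e i) (f j) = 0 /\
      adpow br (absz (Mn i j + 1)) (f i) (e j) = 0).

Definition mxbr (K : comNzRingType) (d : nat) (A B : 'M[K]_d) : 'M[K]_d :=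
  A *m B - B *m A.

(** A set of operators on V = K^d (row vectors, acting by right
    multiplication) is irreducible: V is nonzero and has no invariant
    subspaces other than 0 and V. *)
Definition irreducible_ops (K : fieldType) (d : nat) (ops : 'M[K]_d -> Prop)
    : Prop :=
  (0 < d)%N /\
  forall U : 'M[K]_d, (forall A, ops A -> stablemx U A) ->
    \rank U = 0%N \/ \rank U = d.

(** A finite-dimensional gim(M_n)-module structure on K^d is given by the
    images E, F, H of the generators, satisfying the defining relations
    (gim(M_n) is defined by generators and relations). *)
Definition gim_module (K : fieldType) (n d : nat) (E F H : 'I_n -> 'M[K]_d)
    : Prop := gim_rel (@mxbr K d) E F H.

(** It is irreducible iff no nontrivial subspace is stable under the
    generators (equivalently, under all of gim(M_n)). *)
Definition gim_irreducible (K : fieldType) (n d : nat)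
    (E F H : 'I_n -> 'M[K]_d) : Prop :=
  irreducible_ops (fun A => exists i, A = E i \/ A = F i \/ A = H i).

(** The Lie algebra of type M(n,a,c,d):
    sl_{2n}^a (+) sp_{2n}^c (+) so_{2n}^d, realised as the set of tuples
    x = (x_j)_{j < a+c+d} of (2n x 2n)-matrices where block j lies in
    sl_{2n} for j < a, in sp_{2n} for a <= j < a+c, in so_{2n} otherwise,
    with componentwise commutator bracket. *)
Section TypeM.
Variable (R : rcfType) (n a : nat) (c d : bool).
Local Notation C := R[i].
Definition kM : nat := (a + c + d)%N.
Definition Melt := {ffun 'I_kM -> 'M[C]_(n + n)}.

Definition Jsp : 'M[C]_(n + n) := block_mx 0 1%:M (- 1%:M) 0.

Definition in_sl (X : 'M[C]_(n + n)) : Prop := \tr X = 0.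
Definition in_sp (X : 'M[C]_(n + n)) : Prop := X^T *m Jsp + Jsp *m X = 0.
Definition in_so (X : 'M[C]_(n + n)) : Prop := X^T = - X.

Definition inM (x : Melt) : Prop :=
  forall j : 'I_kM,
    if (j < a)%N then in_sl (x j)
    else if (j < a + c)%N then in_sp (x j)
    else in_so (x j).

Definition Mbr (x y : Melt) : Melt := [ffun j => x j *m y j - y j *m x j].

Definition generates_M (e f h : 'I_n -> Melt) : Prop :=
  forall S : Melt -> Prop,
    (forall i, S (e i) /\ S (f i) /\ S (h i)) ->
    (forall x y, S x -> S y -> S (x + y)) ->
    (forall (t : C) x, S x -> S (t *: x)) ->
    (forall x y, S x -> S y -> S (Mbr x y)) ->
    forall x, inM x -> S x.

(** A surjective Lie algebra homomorphism gim(M_n) -> M is the same as a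
    choice of images e_i, f_i, h_i in M satisfying the defining relations
    and generating M. *)
Definition gim_surj_hom (e f h : 'I_n -> Melt) : Prop :=
  (forall i, inM (e i) /\ inM (f i) /\ inM (h i)) /\
  gim_rel Mbr e f h /\ generates_M e f h.

Definition M_rep (dV : nat) (rho : Melt -> 'M[C]_dV) : Prop :=
  (forall x y, inM x -> inM y -> rho (x + y) = rho x + rho y) /\
  (forall (t : C) x, inM x -> rho (t *: x) = t *: rho x) /\
  (forall x y, inM x -> inM y -> rho (Mbr x y) = mxbr (rho x) (rho y)).

Definition M_rep_irreducible (dV : nat) (rho : Melt -> 'M[C]_dV) : Prop :=
  irreducible_ops (fun A => exists x, inM x /\ A = rho x).
End TypeM.

(* Main.v *)
(** Index the generators by [Z/N], [N = 2n], with [u_i = e_i] and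
    [u_(i+n) = - f_i]; with [nu = n] the relations of [gim(M_n)] become invariant
    under translation of the index.  Their basic model is the Lie algebra of
    twisted loops [z : C^* -> gl_N], [z(s)_(p,q) = - z(1/s)_(q+nu,p+nu)], where
    [u_p(s) = s E_(p,p+1) - s^-1 E_(p+1+nu,p+nu)].

    Evaluating twisted loops at finitely many points [s_j], whose powers [s_j^N]
    are distinct up to inversion, gives a map onto a direct sum in which a point
    with [s_j^N] different from [1] and [-1] contributes [sl_N], while [s^N = -1]
    contributes [sp_N] and [s = 1] contributes [so_N]: this is (1).

    For (2), let [U_p] be the operators of an irreducible module.  In the Lie
    algebra [P] generated by the pairs (twisted loop [u_p], [U_p]), an element
    whose loop vanishes has operator [0]: modulo shorter words, [P] is spanned by
    cyclic words, whose leading coefficients in the loop model are independent up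
    to central corrections killed by Schur's lemma.  As [gl(V)] is
    finite-dimensional, some nonzero polynomial [g] is such that all loops with
    entries divisible by [g(s^N)] act by [0].  The elements of [P] whose loop
    vanishes at the points above the roots of [g], [1] and [-1] then act by a
    solvable ideal of traceless operators, hence by [0], so the action factors
    through the evaluation at these points. *)

Require Import Defs.
From HB Require Import structures.
From mathcomp Require Import all_boot all_order all_algebra.
From mathcomp Require Import complex.
From mathcomp Require Import boolp functions.
From mathcomp Require Import ring zify.
Import Order.TTheory GRing.Theory Num.Theory.
Local Open Scope ring_scope.

Set Implicit Arguments. Unset Strict Implicit. Unset Printing Implicit Defensive.

(** No structure theorem for [gim(M_n)] is used. The pairs (loop, operator) form the graph of a
    would-be map from loops to operators, and the crux is that it is single-valued. Growth as [s]
    tends to infinity gives the control: a word of length [k] starting at [p] has leading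
    coefficient [E_(p,p+k)], and for a fixed length the only linear relation occurs when [N] divides
    [k], where the differences [E_(p,p) - E_(p-1,p-1)] add up to 0.

    The corner entry [m_(1,n) = 1] closes the chain: translation by [n] changes the sign of weights,
    so the last [e] and the first [- f] pair to [- 1] like any neighbours, and the [2n] generators
    form a cycle. The bound [n >= 3] enters as the facts that 1, 2, 3, 4 are nonzero in [Z/N] and
    that [nu] differs from 1, -1, 2, -2.

    Points matter through [s^N], because the entry [(p,q)] of a loop is [s^(q-p)] times a Laurent
    polynomial in [s^N], and up to inversion, because the value at [s] determines the value at
    [1/s]. Each generator is a multiple of a bracket, so all operators have trace 0; a scalar
    operator of trace 0 is 0, which is what removes central ambiguities. *)

Lemma eq_subr0 (V : zmodType) (x y : V) : x = y -> x - y = 0.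
Proof. by move=> ->; apply: subrr. Qed.

(* Abelian-group identities in [Z/N] that follow linearly from the equation [H]. *)
Ltac zlin H := repeat (match goal with x := _ |- _ => subst x end);
  apply/subr0_eq; match type of H with ?a = ?b =>
  first [ transitivity (a - b); [ ring | exact: eq_subr0 H ]
        | transitivity (b - a); [ ring | exact: eq_subr0 (esym H) ] ] end.
Ltac zneq H := repeat (match goal with x := _ |- _ => subst x end);
  let E := fresh in apply: (contra_neq _ H) => E; zlin E.

(** * Lie algebras with cyclic generators *)

Section Span.
Variables (K : fieldType) (T : lmodType K).

Record subspace (S : T -> Prop) : Prop := Subspace {
  subspace0 : S 0;
  subspaceD : forall x y, S x -> S y -> S (x + y);
  subspaceZ : forall (c : K) x, S x -> S (c *: x) }.

Definition span (G : T -> Prop) (w : T) : Prop :=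
  forall S, subspace S -> (forall g, G g -> S g) -> S w.

Lemma span_subspace (G : T -> Prop) : subspace (span G).
Proof.
split=> [S HS _|x y Hx Hy S HS HG|c x Hx S HS HG].
- exact: subspace0 HS.
- by apply: (subspaceD HS); [apply: Hx|apply: Hy].
- by apply: (subspaceZ HS); apply: Hx.
Qed.

Lemma span_gen (G : T -> Prop) g : G g -> span G g.
Proof. by move=> Gg S _; apply. Qed.

Variables (S : T -> Prop) (HS : subspace S).

Lemma subspaceN x : S x -> S (- x).
Proof. by move=> Sx; rewrite -scaleN1r; apply: subspaceZ. Qed.

Lemma subspaceB x y : S x -> S y -> S (x - y).
Proof. by move=> Sx Sy; apply: (subspaceD HS) => //; apply: subspaceN. Qed.

Lemma subspace_sum (J : Type) (r : seq J) (P : pred J) (F : J -> T) :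
  (forall j, P j -> S (F j)) -> S (\sum_(j <- r | P j) F j).
Proof.
by move=> HF; apply: big_ind => //; [apply: subspace0|apply: subspaceD].
Qed.

End Span.

Record lie_bracket (K : fieldType) (T : lmodType K) (br : T -> T -> T) : Prop :=
  LieBracket {
  brDl : forall x y z, br (x + y) z = br x z + br y z;
  brZl : forall c x z, br (c *: x) z = c *: br x z;
  brC : forall x y, br x y = - br y x;
  brJ : forall x y z, br (br x y) z = br (br x z) y + br x (br y z) }.

Section LieTheory.
Variables (K : fieldType) (T : lmodType K) (br : T -> T -> T).
Hypothesis L : lie_bracket br.

Lemma brDr x y z : br x (y + z) = br x y + br x z.
Proof. by rewrite (brC L) (brDl L) opprD -!(brC L). Qed.
Lemma brZr c x z : br x (c *: z) = c *: br x z.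
Proof. by rewrite (brC L) (brZl L) -scalerN -(brC L). Qed.
Lemma brNl x z : br (- x) z = - br x z.
Proof. by rewrite -scaleN1r (brZl L) scaleN1r. Qed.
Lemma brNr x z : br x (- z) = - br x z.
Proof. by rewrite -scaleN1r brZr scaleN1r. Qed.
Lemma br0l z : br 0 z = 0.
Proof. by rewrite -(scale0r (0 : T)) (brZl L) !scale0r. Qed.
Lemma br0r z : br z 0 = 0.
Proof. by rewrite (brC L) br0l oppr0. Qed.
Lemma brBl x y z : br (x - y) z = br x z - br y z.
Proof. by rewrite (brDl L) brNl. Qed.
Lemma br_suml J (r : seq J) (P : pred J) F z :
  br (\sum_(j <- r | P j) F j) z = \sum_(j <- r | P j) br (F j) z.
Proof.
exact: (big_morph (fun x => br x z) (fun x y => brDl L x y z) (br0l z)).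
Qed.

Lemma brJr x y z : br x (br y z) = br (br x y) z - br (br x z) y.
Proof. by rewrite (brJ L x y z) addrC addKr. Qed.

(** This is [ad y] applied to the Serre relation. It trades a word that continues [y] by [a], [b],
    [b] for words in which [b] comes right after [y]. *)
Lemma serre_right y a b : br (br a b) b = 0 ->
  br (br (br y a) b) b = br (br (br y b) a) b *+ 2 - br (br (br y b) b) a.
Proof.
move=> Sab; have: br y (br (br a b) b) = 0 by rewrite Sab br0r.
rewrite brJr [br y (br a b)]brJr [br (br y b) (br a b)]brJr brBl => H.
apply/eqP; rewrite -subr_eq0 -[X in _ == X]H; apply/eqP.
by rewrite mulr2n !opprD !opprK !addrA; congr (_ + _); rewrite addrAC.
Qed.

End LieTheory.

(** * Spanning by cyclic words *)

Section Cyclic.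
Variables (K : numFieldType) (T : lmodType K) (br : T -> T -> T).
Variables (I : comNzRingType) (nu : I) (a : I -> K) (u h : I -> T).

Record cyclic_rel : Prop := CyclicRel {
  cyc_comm : forall p q, q != p + 1 -> p != q + 1 -> q != p + nu ->
    br (u p) (u q) = 0;
  cyc_nu : forall p, br (u p) (u (p + nu)) = - h p;
  cyc_h : forall p q, br (h p) (u q) = a (q - p) *: u q;
  cyc_serre_r : forall p, br (br (u p) (u (p + 1))) (u (p + 1)) = 0;
  cyc_serre_l : forall p, br (br (u p) (u (p + 1))) (u p) = 0 }.

(** Counting [h p] as the word of length 0 puts the corrections [[u p, u (p + nu)] = - h p] among
    the shorter words. *)
Fixpoint word (k : nat) (p : I) : T :=
  match k with
  | 0 => h p
  | 1 => u p
  | (k'.+1 as k1).+1 => br (word k1 p) (u (p + k1%:R))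
  end.

Definition words_upto (k : nat) : T -> Prop :=
  span (fun w => exists j p, (j <= k)%N /\ w = word j p).

Hypotheses (L : lie_bracket br) (R : cyclic_rel).
Hypotheses (I1 : (1 : I) != 0) (I2 : (2%:R : I) != 0) (I3 : (3%:R : I) != 0)
  (I4 : (4%:R : I) != 0).

Local Notation V := words_upto.

Lemma wordS k p : (0 < k)%N -> word k.+1 p = br (word k p) (u (p + k%:R)).
Proof. by case: k. Qed.

Lemma V_subspace k : subspace (V k).
Proof. exact: span_subspace. Qed.
Local Notation VD := (subspaceD (V_subspace _)).
Local Notation VB := (subspaceB (V_subspace _)).
Local Notation VN := (subspaceN (V_subspace _)).
Local Notation VZ := (subspaceZ (V_subspace _)).
Local Notation V0 := (subspace0 (V_subspace _)).

Lemma V_word k p j : (j <= k)%N -> V k (word j p).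
Proof. by move=> jk; apply: span_gen; exists j, p. Qed.

Lemma V_mono k k' w : (k <= k')%N -> V k w -> V k' w.
Proof.
move=> kk' Vw; apply: Vw; first exact: V_subspace.
by move=> g [j [p [jk ->]]]; apply: V_word; apply: leq_trans jk kk'.
Qed.

Lemma word_h k p r : exists c, br (word k p) (h r) = c *: word k p.
Proof.
have u_h q : br (u q) (h r) = - a (q - r) *: u q.
  by rewrite (brC L) (cyc_h R) scaleNr.
elim: k => [|[|k] IH].
- exists (- a (p - r) - a (p + nu - r)).
  rewrite /= -[h p]opprK -(cyc_nu R) (brNl L) (brJ L) !u_h (brZl L) (brZr L).
  by rewrite -scalerDl scalerN.
- by exists (- a (p - r)); apply: u_h.
- have [c Hc] := IH; exists (c - a (p + k.+1%:R - r)).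
  by rewrite wordS // (brJ L) Hc u_h (brZl L) (brZr L) -scalerDl.
Qed.

(* The case [k = 0] in [Z/N] is the one of imaginary roots. *)
Definition rhs (k : nat) (p r : I) : T :=
  if (k%:R : I) == 0 then
    word k.+1 p *+ (r == p) - word k.+1 (p - 1) *+ (r == p - 1) *+ 2
    + word k.+1 (p - 1 - 1) *+ (r == p - 1 - 1)
  else word k.+1 p *+ (r == p + k%:R)
    - word k.+1 (p - 1) *+ ((r == p - 1) && ((k%:R : I) != - 1)).

(** Modulo shorter words, the words multiply as in [gl_N]: [word k p] behaves like [E_(p,p+k)], and
    like [E_(p,p) - E_(p-1,p-1)] when [k = 0] in [Z/N]. When [k = - 1], both terms of the commutator
    of matrix units belong to a single word, whence the extra condition in [rhs]. *)
Definition word_step k := forall p r, V k (br (word k p) (u r) - rhs k p r).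

Lemma VMn k w m : V k w -> V k (w *+ m).
Proof. by move=> Vw; rewrite -scaler_nat; apply: VZ. Qed.

Lemma V_rhs k p r : V k.+1 (rhs k p r).
Proof.
have W q : V k.+1 (word k.+1 q) by apply: V_word.
by rewrite /rhs; case: ifP => _; repeat
  first [exact: W | apply: VD | apply: VN | apply: VMn].
Qed.

Lemma V_step k : (0 < k)%N -> word_step k -> forall p r, V k.+1 (br (word k p) (u r)).
Proof.
move=> k0 Hk p r; rewrite -[br _ _](subrK (rhs k p r)).
by apply: VD; [apply: V_mono (Hk p r)|apply: V_rhs].
Qed.

Lemma V_br_h k w r : V k w -> V k (br w (h r)).
Proof.
move=> Vw; apply: (Vw (fun w => V k (br w (h r)))).
  split=> [|x y Hx Hy|c x Hx] /=; rewrite ?(br0l L) ?(brDl L) ?(brZl L).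
  - exact: V0.
  - exact: VD.
  - exact: VZ.
move=> g [j [p [jk ->]]]; have [c ->] := word_h j p r.
by apply: VZ; apply: V_word jk.
Qed.

Lemma V_br k w r : (forall j, (0 < j <= k)%N -> word_step j) ->
  V k w -> V k.+1 (br w (u r)).
Proof.
move=> Hk Vw; apply: (Vw (fun w => V k.+1 (br w (u r)))).
  split=> [|x y Hx Hy|c x Hx] /=; rewrite ?(br0l L) ?(brDl L) ?(brZl L).
  - exact: V0.
  - exact: VD.
  - exact: VZ.
move=> g [[|j] [p [jk ->]]].
  by rewrite /= (cyc_h R); apply: VZ; apply: (@V_word _ _ 1).
by apply: (@V_mono j.+2) => //; apply: V_step => //; apply: Hk.
Qed.

Lemma V_trans k x y z : V k (x - y) -> V k (y - z) -> V k (x - z).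
Proof. by move=> Vxy Vyz; rewrite -(subrKA y); apply: VD. Qed.

Lemma rhs_generic k p r : (k%:R : I) != 0 -> (k%:R : I) != - 1 ->
  rhs k p r = word k.+1 p *+ (r == p + k%:R) - word k.+1 (p - 1) *+ (r == p - 1).
Proof. by rewrite /rhs => /negPf -> ->; rewrite andbT. Qed.

Lemma rhs_m1 k p r : (k%:R : I) = - 1 ->
  rhs k p r = word k.+1 p *+ (r == p - 1).
Proof.
by rewrite /rhs => ->; rewrite oppr_eq0 (negPf I1) eqxx andbF mulr0n subr0.
Qed.

Lemma rhs_0 k p r : (k%:R : I) = 0 ->
  rhs k p r = word k.+1 p *+ (r == p) - word k.+1 (p - 1) *+ (r == p - 1) *+ 2
    + word k.+1 (p - 1 - 1) *+ (r == p - 1 - 1).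
Proof. by rewrite /rhs => ->; rewrite eqxx. Qed.

Lemma word_step1 : word_step 1.
Proof.
move=> p r; have n1 : (1 : I) != -1.
  by zneq I2.
rewrite rhs_generic //=.
have [->|r1] := eqVneq r (p + 1).
  have /negPf -> : p + 1 != p - 1 by zneq I2.
  by rewrite subr0 subrr; apply: V0.
rewrite sub0r; have [->|r2] := eqVneq r (p - 1).
  by rewrite (brC L) subrK opprK addNr; apply: V0.
rewrite oppr0 subr0; have [->|r3] := eqVneq r (p + nu).
  by rewrite (cyc_nu R); apply: VN; apply: (@V_word _ _ 0).
rewrite (cyc_comm R) //; first exact: V0.
by zneq r2.
Qed.

(** With [q = p + k], the longer word is [[word k p, u q]]. For [r = q + 1] its bracket with [u r]
    is a word by definition. If [u r] commutes with [u q], or brackets with it to an [h], Jacobi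
    moves [u r] past [u q] and induction applies ([far]). For [r = q] this is circular, and for
    [r = q - 1] the bracket of [u q] and [u r] is not small; there the Serre relations are used. *)
Lemma word_stepS k : (0 < k)%N -> (forall j, (0 < j <= k)%N -> word_step j) ->
  word_step k.+1.
Proof.
move=> k0 IH p r; set q := p + k%:R.
have Vbr j w s : (j <= k)%N -> V j w -> V j.+1 (br w (u s)).
  by move=> jk; apply: V_br => i /andP[i0 ij]; apply: IH; rewrite i0 (leq_trans ij).
have brV j x y s : (j <= k)%N -> V j (x - y) -> V j.+1 (br x (u s) - br y (u s)).
  by move=> jk Vxy; rewrite -(brBl L); apply: Vbr.
have stp j p' s : (0 < j <= k)%N -> V j (br (word j p') (u s) - rhs j p' s).
  by move/IH; apply.
have kp : (0 < k <= k)%N by rewrite k0 leqnn.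
have kq : k.+1%:R = k%:R + 1 :> I by rewrite -addn1 natrD.
have wS (p' : I) : br (word k.+1 p') (u (p' + k%:R + 1)) = word k.+2 p'.
  by rewrite [word k.+2 _]wordS // kq addrA.
have far (p' s : I) : s != p' + k%:R + 1 -> s != p' + k%:R - 1 ->
    V k.+1 (br (word k.+1 p') (u s) - br (rhs k p' s) (u (p' + k%:R))) .
  move=> s1 s2; apply: V_trans (brV k _ _ (p' + k%:R) (leqnn k) (stp k p' s kp)).
  rewrite wordS // (brJ L) addrC addKr.
  have [->|snu] := eqVneq s (p' + k%:R + nu).
    rewrite (cyc_nu R) (brNr L); apply: VN; apply: V_br_h.
    exact: V_mono (V_word p' (leqnn k)).
  rewrite (cyc_comm R) ?(br0r L) //; first exact: V0.
  by zneq s2.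
have [rq1|rq1] := eqVneq r (q + 1).
  rewrite rq1 wS /rhs kq; case: ifPn => [/eqP Hk|Hk].
    have -> : q + 1 = p by zlin Hk.
    have /negPf -> : p != p - 1 by zneq I1.
    have /negPf -> : p != p - 1 - 1 by zneq I2.
    by rewrite eqxx mul0rn !mulr0n subr0 addr0 subrr; apply: V0.
  have -> : q + 1 == p + (k%:R + 1) by apply/eqP; rewrite addrA.
  have -> : (q + 1 == p - 1) && (k%:R + 1 != - 1 :> I) = false.
    apply/negP => /andP[/eqP H /negP]; apply; apply/eqP; zlin H.
  by rewrite subr0 subrr; apply: V0.
have two0 : (2%:R : K) != 0 by rewrite pnatr_eq0.
have rhs_pred j (p' : I) : k = j.+1 -> (0 < j)%N ->
    rhs j p' (p' + k%:R) = - word k (p' - 1) *+ (k%:R == - 1 :> I).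
  move=> kj j0; have jk : j%:R = k%:R - 1 :> I by rewrite kj -addn1 natrD addrK.
  rewrite /rhs -kj jk; case: ifPn => [/eqP H|H].
    have -> : k%:R = 1 :> I by zlin H.
    have /negPf -> : p' + 1 != p' by zneq I1.
    have /negPf -> : p' + 1 != p' - 1 by zneq I2.
    have /negPf -> : p' + 1 != p' - 1 - 1 by zneq I3.
    have /negPf -> : 1 != - 1 :> I by zneq I2.
    by rewrite !mulr0n mul0rn subr0 addr0.
  have /negPf -> : p' + k%:R != p' + (k%:R - 1) by zneq I1.
  rewrite (inj_eq (addrI _)) sub0r mulNrn; case: eqP => // ->.
  have -> : - 1 - 1 != - 1 :> I by zneq I1.
  by [].
(* In [serre_right], take [b = u (p' + k)] and [a] its predecessor: on the right [b] meets
   [word j p'], and by [rhs_pred] that bracket has no top term unless [k = - 1]. *)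
have near_r (p' : I) :
    V k.+1 (br (word k.+1 p') (u (p' + k%:R)) - rhs k.+1 p' (p' + k%:R)).
  (* Length 1 is apart: removing one more letter would leave [h], which does not follow the
     recursion of words. *)
  have [k1|[j kj j0]] : k = 1%N \/ exists2 j, k = j.+1 & (0 < j)%N.
    by case: (k) k0 => [//|[|j]] _; [left|right; exists j.+1].
    rewrite k1 /= (cyc_serre_r R) rhs_generic; first last.
    - by zneq I3.
    - exact: I2.
    have /negPf -> : p' + 1 != p' + 2%:R by zneq I1.
    have /negPf -> : p' + 1 != p' - 1 by zneq I2.
    by rewrite !subr0; apply: V0.
  have jk : (j <= k)%N by rewrite kj.
  have pk : p' + k%:R = p' + j%:R + 1 by rewrite kj -addrA -natr1.
  have wk : word k p' = br (word j p') (u (p' + j%:R)) by rewrite kj wordS.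
  rewrite wordS // [X in br (br X _) _]wk serre_right //; last by rewrite pk (cyc_serre_r R).
  have := stp j p' (p' + k%:R); rewrite j0 jk => /(_ isT).
  rewrite (rhs_pred j) // => yb.
  have brVj x y s : V j (x - y) -> V k (br x (u s) - br y (u s)).
    by move/(brV j _ _ s jk); rewrite -kj.
  have ybab := brV k _ _ (p' + k%:R) (leqnn k) (brVj _ _ (p' + j%:R) yb).
  have ybba := brV k _ _ (p' + j%:R) (leqnn k) (brVj _ _ (p' + k%:R) yb).
  have := VB (VMn 2 ybab) ybba.
  set Z1 := br (br (br _ _) _) _; set Z2 := br (br (- _ *+ _) _) _.
  set Z3 := br (br (br _ _) _) _; set Z4 := br (br (- _ *+ _) _) _ => VZ12.
  have : V k.+1 (Z1 *+ 2 - Z3 - (Z2 *+ 2 - Z4)).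
    by move: VZ12; congr (V _ _); rewrite mulrnBl !opprD !opprK addrACA.
  move/V_trans; apply; rewrite /Z2 /Z4 {Z1 Z2 Z3 Z4 VZ12 ybab ybba}.
  have [k_m1|k_nm1] := eqVneq (k%:R : I) (- 1); last first.
    rewrite !mulr0n !(br0l L) mul0rn subr0 sub0r; apply: VN.
    rewrite /rhs kq addr_eq0 (negPf k_nm1).
    have /negPf -> : p' + k%:R != p' + (k%:R + 1) by zneq I1.
    by rewrite (inj_eq (addrI _)) (negPf k_nm1) subr0; apply: V0.
  have e1 : p' + j%:R = p' - 1 + k%:R by zlin pk.
  have e2 : p' + k%:R = p' - 1 + k%:R + 1 by ring.
  have w1 : br (word k (p' - 1)) (u (p' + j%:R)) = word k.+1 (p' - 1).
    by rewrite e1 wordS.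
  have w2 : br (word k.+1 (p' - 1)) (u (p' + k%:R)) = word k.+2 (p' - 1).
    by rewrite e2 wS.
  rewrite !mulr1n !(brNl L) w1 w2.
  rewrite rhs_0 ?kq ?k_m1 ?addNr // eqxx.
  have /negPf -> : p' - 1 != p' by zneq I1.
  have /negPf -> : p' - 1 != p' - 1 - 1 by zneq I1.
  rewrite !mulr0n mulr1n sub0r addr0 mulNrn !opprK addrAC addNr add0r.
  apply: Vbr => //.
  have := stp k (p' - 1) (p' - 1) kp; rewrite rhs_m1 //.
  have /negPf -> : p' - 1 != p' - 1 - 1 by zneq I1.
  by rewrite subr0.
have [->|rq] := eqVneq r q; first exact: near_r.
have [rqm|rqm] := eqVneq r (q - 1).
  have [k1|[j kj j0]] : k = 1%N \/ exists2 j, k = j.+1 & (0 < j)%N.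
    by case: (k) k0 => [//|[|j]] _; [left|right; exists j.+1].
    rewrite rqm /q k1 addrK /= (cyc_serre_l R) rhs_generic; first last.
    - by zneq I3.
    - exact: I2.
    have /negPf -> : p != p + 2%:R by zneq I2.
    have /negPf -> : p != p - 1 by zneq I1.
    by rewrite !subr0; apply: V0.
  have jk : (j <= k)%N by rewrite kj.
  have pk : q - 1 = p + j%:R by rewrite /q kj -natr1 addrA addrK.
  have wk : word k p = br (word j p) (u (q - 1)) by rewrite kj wordS // pk.
  have brVj x y s : V j (x - y) -> V k (br x (u s) - br y (u s)).
    by move/(brV j _ _ s jk); rewrite -kj.
  have yb := stp j p q; rewrite j0 jk (rhs_pred j) // in yb.
  have {yb} ybaa := brV k _ _ (q - 1) (leqnn k) (brVj _ _ (q - 1) (yb isT)).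
  have yaab := brV k _ _ q (leqnn k) (stp k p (q - 1) kp).
  (* The bracket to be computed is the middle term of the Serre identity and occurs twice, so its
     double is determined and then halved. *)
  have Zeq : br (br (br (word j p) (u (q - 1))) (u q)) (u (q - 1)) *+ 2 =
    br (br (word k p) (u (q - 1))) (u q) +
    br (br (br (word j p) (u q)) (u (q - 1))) (u (q - 1)).
    rewrite (@serre_right _ _ _ L (word j p) (u q) (u (q - 1))) //.
      by rewrite wk [RHS]addrC subrK.
    have := cyc_serre_l R (q - 1); rewrite subrK => S1.
    by rewrite (brC L (u q)) (brNl L) S1 oppr0.
  suff: V k.+1 (br (word k.+1 p) (u r) *+ 2 - rhs k.+1 p r *+ 2).
    rewrite -mulrnBl => /(VZ (2%:R^-1)).
    by rewrite -scaler_nat scalerA mulVf // scale1r.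
  rewrite wordS // [word k p]wk rqm -/q Zeq.
  have := VD yaab ybaa; rewrite addrACA -opprD; move/V_trans; apply.
  have [k_m1|k_nm1] := eqVneq (k%:R : I) (- 1).
    have qp : q = p - 1 by rewrite /q k_m1.
    rewrite rhs_m1 // rhs_0 ?kq ?k_m1 ?addNr // -qp eqxx.
    have /negPf -> : q - 1 != q by zneq I1.
    have /negPf -> : q - 1 != p by rewrite /q k_m1; zneq I2.
    have w1 : br (word k q) (u (q - 1)) = word k.+1 q by rewrite wordS // k_m1.
    rewrite !mulr0n mul0rn !mulr1n subr0 add0r (br0l L) add0r !(brNl L) w1.
    have := near_r q; rewrite k_m1 rhs_0 ?kq ?k_m1 ?addNr // eqxx.
    have /negPf -> : q - 1 != q by zneq I1.
    have /negPf -> : q - 1 != q - 1 - 1 by zneq I1.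
    rewrite !mulr0n addr0 sub0r mulr1n opprK => /VN.
    by rewrite opprD.
  rewrite mulr0n !(br0l L) addr0; have [k_0|k_n0] := eqVneq (k%:R : I) 0.
    have qp : q = p by rewrite /q k_0 addr0.
    rewrite rhs_0 // rhs_generic ?kq ?k_0 ?add0r //; last by zneq I2.
    rewrite qp eqxx.
    have /negPf -> : p - 1 != p by zneq I1.
    have /negPf -> : p - 1 != p - 1 - 1 by zneq I1.
    have /negPf -> : p - 1 != p + 1 by zneq I2.
    have := wS (p - 1); rewrite k_0 addr0 subrK => w1.
    rewrite !mulr0n addr0 !sub0r mulr1n (brNl L) mulr2n (brDl L) w1 mulNrn mulr2n.
    by rewrite subrr; apply: V0.
  have -> : rhs k p (q - 1) = 0.
    rewrite /rhs (negPf k_n0) -/q.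
    have /negPf -> : q - 1 != q by zneq I1.
    have /negPf -> : q - 1 != p - 1 by zneq k_n0.
    by rewrite subr0.
  rewrite (br0l L) sub0r; apply: VN.
  have -> : rhs k.+1 p (q - 1) = 0.
    rewrite /rhs kq addr_eq0 (negPf k_nm1).
    have /negPf -> : q - 1 != p + (k%:R + 1) by zneq I2.
    have /negPf -> : q - 1 != p - 1 by zneq k_n0.
    by rewrite subr0.
  by rewrite mul0rn; apply: V0.
apply: V_trans (far p r rq1 rqm) _.
have [k_0|k_n0] := eqVneq (k%:R : I) 0.
  have qp : q = p by rewrite /q k_0 addr0.
  rewrite rhs_0 // rhs_generic ?kq ?k_0 ?add0r ?addr0 //; last by zneq I2.
  rewrite -qp (negPf rq) (negPf rq1) (negPf rqm) mul0rn !mulr0n !sub0r oppr0 !add0r subr0.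
  have [_|_] := eqVneq r (q - 1 - 1); last by rewrite mulr0n (br0l L); apply: V0.
  (* The third term of the imaginary case survives; its bracket with [u q] falls under [far] again
     and has no top term because 2, 3 and 4 are nonzero. *)
  rewrite mulr1n; have := far (q - 1 - 1) q.
  rewrite rhs_0 // k_0 addr0.
  have /negPf -> : q != q - 1 - 1 by zneq I2.
  have /negPf -> : q != q - 1 - 1 - 1 by zneq I3.
  have /negPf -> : q != q - 1 - 1 - 1 - 1 by zneq I4.
  rewrite mul0rn !mulr0n subr0 addr0 (br0l L) subr0; apply.
    by zneq I1.
  by [].
have wSm : br (word k.+1 (p - 1)) (u q) = word k.+2 (p - 1).
  by rewrite -wS /q; congr (br _ (u _)); ring.
have lhsE : br (rhs k p r) (u q) = - (word k.+2 (p - 1) *+ ((r == p - 1) && (k%:R != - 1 :> I))).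
  rewrite /rhs (negPf k_n0) (negPf rq) sub0r (brNl L).
  by case: (_ && _); rewrite ?mulr1n ?wSm // mulr0n (br0l L).
rewrite lhsE {lhsE}; have [k_m1|k_nm1] := eqVneq (k%:R : I) (- 1).
  rewrite rhs_0; last by rewrite kq k_m1 addNr.
  have qp : p = q + 1 by rewrite /q k_m1 subrK.
  rewrite qp (negPf rq1) addrK (negPf rq) (negPf rqm) andbF !mulr0n mul0rn.
  by rewrite !subr0 addr0 subr0 oppr0; apply: V0.
rewrite andbT /rhs kq addr_eq0 (negPf k_nm1) addrA (negPf rq1) mulr0n sub0r opprK addrC.
have [rp|rp] := eqVneq r (p - 1); last by rewrite subrr; apply: V0.
have -> : k%:R + 1 != - 1 :> I.
  by apply: (contra_neq _ rq1) => Hk; rewrite rp; zlin Hk.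
by rewrite subrr; apply: V0.
Qed.

Lemma word_stepP k : (0 < k)%N -> word_step k.
Proof.
elim/ltn_ind: k => -[//|[|k]] IH _; first exact: word_step1.
by apply: word_stepS => // j /andP[j0 jk]; apply: IH.
Qed.

(** By [lie_gen_br] and [lie_gen_min], this linear span is the Lie subalgebra generated by the
    [u p]. *)
Definition lie_gen (w : T) := exists k, V k w.

Lemma lie_gen_subspace : subspace lie_gen.
Proof.
split=> [|x y [k Hx] [k' Hy]|c x [k Hx]].
- by exists 0; apply: V0.
- exists (maxn k k'); apply: VD.
    by apply: V_mono Hx; apply: leq_maxl.
  by apply: V_mono Hy; apply: leq_maxr.
- by exists k; apply: VZ.
Qed.

Lemma lie_gen_u p : lie_gen (u p).
Proof. by exists 1; apply: (@V_word _ _ 1). Qed.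

(** By Jacobi, bracketing with a word unfolds into iterated brackets with generators, and each of
    these lengthens words by at most one. *)
Lemma lie_gen_br x y : lie_gen x -> lie_gen y -> lie_gen (br x y).
Proof.
have bru w r : lie_gen w -> lie_gen (br w (u r)).
  move=> [k Vw]; exists k.+1; apply: V_br Vw => j /andP[j0 _].
  exact: word_stepP.
move=> Gx [k Vy]; apply: (Vy (fun y => lie_gen (br x y))).
  split=> [|z t Hz Ht|c z Hz] /=; rewrite ?(br0r L) ?(brDr L) ?(brZr L).
  - exact: subspace0 lie_gen_subspace.
  - exact: (subspaceD lie_gen_subspace).
  - exact: (subspaceZ lie_gen_subspace).
move=> g [j [p [_ ->]]]; elim: j x p Gx => [|[|j] IH] x p [k' Vx].
- by exists k'; apply: V_br_h.
- by apply: bru; exists k'.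
- rewrite wordS // (brJr L); apply: (subspaceB lie_gen_subspace).
    by apply: bru; apply: IH; exists k'.
  by apply: IH; apply: bru; exists k'.
Qed.

Lemma lie_gen_min (S : T -> Prop) : subspace S ->
  (forall x y, S x -> S y -> S (br x y)) -> (forall p, S (u p)) ->
  forall w, lie_gen w -> S w.
Proof.
move=> HS Sbr Su w [k Vw]; apply: Vw => // g [j [p [_ ->]]] {k g}.
elim: j p => [|[|j] IH] p //.
  by rewrite /= -[h p]opprK -(cyc_nu R); apply: (subspaceN HS); apply: Sbr.
by rewrite wordS //; apply: Sbr.
Qed.

End Cyclic.

(** * Ideals of irreducible Lie algebras of operators *)

Section TraceNilpotent.
Variable (K : numFieldType).

Lemma mxtrace_idempotent d (e : 'M[K]_d) : e *m e = e -> \tr e = (\rank e)%:R.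
Proof.
move=> ee; rewrite -{1}(mulmx_base e) mxtrace_mulC.
suff -> : row_base e *m col_base e = 1%:M by rewrite mxtrace1.
apply: (row_full_inj (col_base_full e)); apply: (row_free_inj (row_base_free e)).
rewrite mulmx1 mulmx_base /=.
have -> : col_base e *m (row_base e *m col_base e) *m row_base e =
  (col_base e *m row_base e) *m (col_base e *m row_base e) by rewrite !mulmxA.
by rewrite mulmx_base.
Qed.

Lemma mulmx_horner_eigen d (y : 'M[K]_d.+1) (v : 'rV_d.+1) mu (q : {poly K}) :
  v *m y = mu *: v -> v *m horner_mx y q = q.[mu] *: v.
Proof.
move=> vy; elim/poly_ind: q => [|q c IH].
  by rewrite rmorph0 mulmx0 horner0 scale0r.
rewrite rmorphD rmorphM /= horner_mx_X horner_mx_C mulmxDr [_ * y]/(_ *m y).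
rewrite mulmxA IH -scalemxAl vy mul_mx_scalar hornerD hornerM hornerX hornerC.
by rewrite scalerA scalerDl.
Qed.

(** Some polynomial [r] without constant term makes [r(y)] the projection onto the generalized
    eigenspaces of nonzero eigenvalues. Its trace is 0 by hypothesis and equals its rank, so it is
    0, whereas [r(mu) = 1] if [mu] is not 0. *)
Lemma mxtrace_pow0_eigen d (y : 'M[K]_d.+1) (v : 'rV_d.+1) mu :
  (forall k, \tr (y ^+ k.+1) = 0) -> v != 0 -> v *m y = mu *: v -> mu = 0.
Proof.
move=> try v0 vy; apply/eqP; apply: contraNT v0 => mu0.
have [//|v0] := eqVneq v 0.
have p0 : mxminpoly y != 0 by rewrite monic_neq0 // mxminpoly_monic.
have [m [g]] := multiplicity_XsubC (mxminpoly y) 0.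
rewrite p0 subr0 /= => g0 pE.
(* The exponent [m.+1] instead of [m] leaves [r] without constant term even when [y] is
   invertible. *)
have cop : coprimep g ('X ^+ m.+1).
  by rewrite coprimep_expr // -['X]subr0 coprimep_XsubC.
have [[u1 u2] /= bez] := Bezout_eq1_coprimepP _ _ cop.
have gmu : g.[mu] = 0.
  have : root (mxminpoly y) mu.
    by rewrite -eigenvalue_root_min; apply/eigenvalueP; exists v.
  rewrite pE rootM => /orP[/rootP //|].
  by rewrite /root hornerXn expf_eq0 (negPf mu0) andbF.
pose r := u2 * 'X^(m.+1); pose e := horner_mx y r.
have ee : e *m e = e.
  apply/eqP; rewrite -subr_eq0 -[_ *m _]/(e * e) /e -rmorphM -rmorphB.
  have -> : r * r - r = - (u1 * u2 * 'X) * mxminpoly y.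
    rewrite pE /r; move: bez; set X := 'X^(m.+1) => bez.
    have -> : u2 * X * (u2 * X) - u2 * X = - (u2 * X) * (1 - u2 * X) by ring.
    by rewrite -[X in X - _]bez /X exprS; ring.
  by rewrite rmorphM /= mx_root_minpoly mulr0.
have tr_e : \tr e = 0.
  rewrite /e /r; elim/poly_ind: (u2) (m) => [|q c IH] k.
    by rewrite mul0r rmorph0 mxtrace0.
  rewrite mulrDl -mulrA -exprS rmorphD linearD /= IH add0r rmorphM rmorphXn /=.
  by rewrite horner_mx_C horner_mx_X -[_ * _]/(_ *m _) mul_scalar_mx mxtraceZ try mulr0.
have e0 : e = 0.
  apply/eqP; rewrite -mxrank_eq0; move: (mxtrace_idempotent ee).
  by rewrite tr_e => /esym/eqP; rewrite pnatr_eq0.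
have := mulmx_horner_eigen r vy; rewrite -/e e0 mulmx0 /r.
have -> : (u2 * 'X^(m.+1)).[mu] = 1.
  have := congr1 (horner^~ mu) bez.
  by rewrite /= hornerD hornerM gmu mulr0 add0r hornerC.
by rewrite scale1r => /esym/eqP; rewrite (negPf v0).
Qed.

End TraceNilpotent.

(** * Schur's lemma and solvable ideals *)

Section Irreducible.
Variables (K : numClosedFieldType) (d : nat) (ops : 'M[K]_d -> Prop).
Hypothesis irr : irreducible_ops ops.

Lemma closed_eigenvector r (B : 'M[K]_r) : (0 < r)%N ->
  exists mu (w : 'rV_r), w != 0 /\ w *m B = mu *: w.
Proof.
move=> r0; have [|v v0] := @common_eigenvector K r [:: B] r0.
  by move=> A A'; rewrite !inE => /eqP -> /eqP ->.
by rewrite /= andbT => /sub_rVP[mu vB]; exists mu, v.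
Qed.

Lemma scalar_mx_eq0 (c : K) : \tr (c%:M : 'M_d) = 0 -> c%:M = 0 :> 'M_d.
Proof.
have [d0 _] := irr; rewrite mxtrace_scalar => /eqP.
rewrite mulrn_eq0 -[d == _]negbK -lt0n d0 /= => /eqP ->.
by rewrite -scalemx1 scale0r.
Qed.

Lemma irreducible_scalar (X : 'M[K]_d) :
  (forall A, ops A -> X *m A = A *m X) -> exists c, X = c%:M.
Proof.
have [d0 irr'] := irr => XA.
have [mu [w [w0 wX]]] := closed_eigenvector X d0; exists mu.
have [|r0|rd] := irr' (kermx (X - mu%:M)).
- move=> A /XA opA; rewrite sub_kermx.
  rewrite -mulmxA mulmxBr -opA mul_mx_scalar -mul_scalar_mx -mulmxBl mulmxA.
  by rewrite mulmx_ker mul0mx.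
- have : (w <= kermx (X - mu%:M))%MS.
    by rewrite sub_kermx mulmxBr wX mul_mx_scalar subrr.
  move/eqP: r0; rewrite mxrank_eq0 => /eqP ->.
  by rewrite submx0 (negPf w0).
- apply/eqP; rewrite -subr_eq0; apply/eqP.
  rewrite -[X - _]mul1mx; apply/eqP; rewrite -sub_kermx.
  by rewrite sub1mx /row_full rd.
Qed.

Definition scalar_on (D : 'M[K]_d -> Prop) (U : 'M[K]_d) :=
  U != 0 /\ forall x, D x -> exists mu, (U <= kermx (x - mu%:M))%MS.

(** A nonzero [D]-stable subspace of least dimension works: by commutation, an eigenspace of one
    operator inside it is again [D]-stable, hence is everything. [D] may be infinite. *)
Lemma common_eigenspace (D : 'M[K]_d -> Prop) :
  (forall x y, D x -> D y -> x *m y = y *m x) -> exists U, scalar_on D U.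
Proof.
have [d0 _] := irr => Dab.
pose P r := `[< exists2 U : 'M[K]_d, \rank U = r & U != 0 /\ forall x, D x -> stablemx U x >].
have exP : exists r, P r.
  exists d; apply/asboolP; exists 1%:M; first by rewrite mxrank1.
  split=> [|x _]; last exact: submx1.
  by rewrite -mxrank_eq0 mxrank1 -lt0n.
have [r /asboolP[U rU [U0 Ust]] rmin] := ex_minnP exP.
exists U; split=> // x Dx.
have := Ust _ Dx.
have rb := eq_row_base U.
rewrite -(eqmxMr x rb) -rb => /submxP[B xB].
have r0 : (0 < \rank U)%N by rewrite lt0n mxrank_eq0.
have [mu [w [w0 wB]]] := closed_eigenvector B r0; exists mu.
set Z := kermx _.
have wZ : (w *m row_base U <= U :&: Z)%MS.
  rewrite sub_capmx -{1}rb submxMl sub_kermx mulmxBr mul_mx_scalar -mulmxA xB.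
  by rewrite mulmxA wB -scalemxAl subrr eqxx.
have UZ0 : (U :&: Z)%MS != 0.
  apply: contraNneq w0 => UZ; move: wZ; rewrite UZ submx0 => /eqP.
  by rewrite -[RHS](mul0mx _ (row_base U)) => /(row_free_inj (row_base_free U)) ->.
have : P (\rank (U :&: Z)%MS).
  apply/asboolP; exists (U :&: Z)%MS => //; split=> // y Dy.
  rewrite sub_capmx (submx_trans _ (Ust y Dy)) ?submxMr ?capmxSl //=.
  have UZZ : ((U :&: Z)%MS *m (x - mu%:M) = 0).
    by apply/eqP; rewrite -sub_kermx capmxSr.
  rewrite sub_kermx -mulmxA mulmxBr (Dab y x) // mul_mx_scalar -mul_scalar_mx.
  by rewrite -mulmxBl mulmxA UZZ mul0mx.
move/rmin; rewrite -rU => rk.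
have := mxrank_leqif_sup (capmxSl U Z); case=> rk2; rewrite eqn_leq rk2 rk /=.
by move/esym => /submx_trans; apply; apply: capmxSr.
Qed.

(** Let [U] be a largest subspace on which [D] acts by scalars. For [x] in [D], the bracket [[x, A]]
    lies in [D] and commutes with [x], so all its powers have trace 0 and its scalar on [U] is 0.
    Hence [x] acts on [U A] by the same scalar as on [U]; thus [U] is invariant, and everything in
    [D] is a traceless scalar. *)
Lemma abelian_ideal_eq0 (D : 'M[K]_d -> Prop) :
  (forall x y, D x -> D y -> x *m y = y *m x) ->
  (forall x A, D x -> ops A -> D (mxbr x A)) ->
  (forall x, D x -> \tr x = 0) ->
  forall x, D x -> x = 0.
Proof.
move=> Dab Did Dtr; have [U1 U1s] := common_eigenspace Dab.
have [d0 irr'] := irr.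
pose P r := `[< exists2 U : 'M[K]_d, \rank U = r & scalar_on D U >].
have exP : exists r, P r by exists (\rank U1); apply/asboolP; exists U1.
have bd r : P r -> (r <= d)%N by move/asboolP=> [U <- _]; apply: rank_leq_row.
have [r /asboolP[U rU [U0 Us]] rmax] := ex_maxnP exP bd.
have nil0 x A v mu : D x -> ops A -> v != 0 :> 'rV_d ->
  v *m mxbr x A = mu *: v -> mu = 0.
  move=> Dx opA; have Dxa := Did _ _ Dx opA.
  clear - d0 Dab Dx Dxa.
  case: d d0 => // d' _ in D A x v Dab Dx Dxa *.
  move=> v0; apply: mxtrace_pow0_eigen v0 => k.
  have -> : mxbr x A ^+ k.+1 = (x *m A - A *m x) *m mxbr x A ^+ k.
    by rewrite exprS.
  rewrite mulmxBl linearB /=.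
  have comm : x *m mxbr x A ^+ k = mxbr x A ^+ k *m x.
    exact: (commrX k (Dab _ _ Dx Dxa)).
  by rewrite -(mulmxA A x) comm mulmxA [\tr (_ *m x)]mxtrace_mulC mulmxA subrr.
have [|rU0|rUd] := irr' U.
- move=> A opA.
  have : P (\rank (U + U *m A)%MS).
    apply/asboolP; exists (U + U *m A)%MS => //; split=> [|x Dx].
      by apply: contraNneq U0 => UA0; rewrite -submx0 -UA0 addsmxSl.
    have [mu Ux] := Us _ Dx; exists mu; rewrite addsmx_sub Ux /=.
    have [mu' Uxa] := Us _ (Did _ _ Dx opA).
    have mu'0 : mu' = 0.
      have /rowV0Pn[v vU v0] := U0.
      apply: (nil0 x A v) => //; apply/eqP; rewrite -subr_eq0 -mul_mx_scalar.
      by rewrite -mulmxBr -sub_kermx (submx_trans vU).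
    move: Ux Uxa; rewrite mu'0 !sub_kermx !mulmxBr /mxbr !mul_mx_scalar scale0r.
    rewrite !subr0 !subr_eq0 => /eqP Ux /eqP UxA; apply/eqP.
    by rewrite -mulmxA -UxA mulmxA Ux -scalemxAl.
  move/rmax; rewrite -rU => rk.
  have := mxrank_leqif_sup (addsmxSl U (U *m A)); case=> rk2.
  rewrite eqn_leq rk2 rk /= => /esym; apply: submx_trans; exact: addsmxSr.
- by move/eqP: rU0; rewrite mxrank_eq0 (negPf U0).
move=> x Dx; have [mu] := Us _ Dx.
have U1M : (1%:M <= U)%MS by rewrite sub1mx /row_full rUd.
move/(submx_trans U1M); rewrite sub_kermx mul1mx subr_eq0 => /eqP xE.
move: (Dtr _ Dx); rewrite xE; exact: scalar_mx_eq0.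
Qed.

(** [D] stands for a derived series. Going back from level [m], each level consists of commuting
    operators once the next one is zero. *)
Lemma solvable_ideal_eq0 (D : nat -> 'M[K]_d -> Prop) m :
  (forall k x y, D k x -> D k y -> D k.+1 (mxbr x y)) ->
  (forall k x A, D k x -> ops A -> D k (mxbr x A)) ->
  (forall k x, D k x -> \tr x = 0) ->
  (forall x, D m x -> x = 0) ->
  forall x, D 0 x -> x = 0.
Proof.
move=> DD Did Dtr Dm; suff: forall k x, (k <= m)%N -> D (m - k)%N x -> x = 0.
  by move=> /(_ m) H x; have := H x (leqnn m); rewrite subnn.
elim=> [|k IH] x; first by rewrite subn0 => _; apply: Dm.
move=> km; apply: (@abelian_ideal_eq0 (D (m - k.+1)%N)).
- move=> y z Dy Dz; apply/eqP; rewrite -subr_eq0; apply/eqP.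
  apply: IH; first exact: ltnW.
  by have := DD _ _ _ Dy Dz; rewrite subnSK.
- exact: Did.
- exact: Dtr.
Qed.

End Irreducible.

(* As [zlin] and [zneq], also using a hypothesis [nu + nu = 0] of the context. *)
Ltac znu H := first [ zlin H |
  repeat (match goal with x := _ |- _ => subst x end);
  match goal with P : ?n + ?n = 0 |- _ => apply/subr0_eq; match type of H with ?a = ?b =>
  first [ transitivity (a - b + (n + n)); [ ring | by rewrite P (eq_subr0 H) addr0 ]
        | transitivity (b - a + (n + n)); [ ring | by rewrite P (eq_subr0 (esym H)) addr0 ]
        | transitivity (a - b - (n + n)); [ ring | by rewrite P (eq_subr0 H) subr0 ]
        | transitivity (b - a - (n + n)); [ ring | by rewrite P (eq_subr0 (esym H)) subr0 ]
  ] end end ].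
Ltac znun H := let E := fresh in apply/negP => /eqP E; case/negP: H; apply/eqP; znu E.
Ltac zany := match goal with H : is_true (_ != _) |- _ => znun H end.
Ltac eqz := let E := fresh in apply/eqP/eqP; intro E; znu E.

(** * Twisted loops *)

Section MatrixBracket.
Variables (K : fieldType) (d : nat).

Lemma mxbr_lie : lie_bracket (@mxbr K d).
Proof.
split=> [x y z|c x z|x y|x y z]; rewrite /mxbr.
- by rewrite mulmxDl mulmxDr opprD addrACA.
- by rewrite -scalemxAl -scalemxAr scalerBr.
- by rewrite opprB.
- rewrite !mulmxBl !mulmxBr !mulmxA !opprB.
  apply/matrixP => i j; rewrite !mxE.
  set a := \sum_k _; set b := \sum_k _; set c := \sum_k _; set e := \sum_k _.
  set f := \sum_k _; set g := \sum_k _; ring.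
Qed.

Lemma mxtrace_mxbr (x y : 'M[K]_d) : \tr (mxbr x y) = 0.
Proof. by rewrite /mxbr linearB /= mxtrace_mulC subrr. Qed.

End MatrixBracket.

(** * The loop model at one point *)

Section Model.
Variables (K : numFieldType) (r : nat).
Local Notation I := 'I_r.+2.
Local Notation M := 'M[K]_r.+2.
Variable (nu : I).
Local Notation E p q := (delta_mx p q : M).
Hypotheses (nuD : nu + nu = 0) (nu0 : nu != 0) (nu1 : nu != 1) (num1 : nu != - 1).
Hypotheses (I1 : (1 : I) != 0) (I2 : (2%:R : I) != 0) (I3 : (3%:R : I) != 0).

(** The map [E_(p,q)] to [- E_(q+nu,p+nu)] is the involution that twists the loops; [a] and [b] are
    meant as the values of one coefficient at [s] and at [1/s]. *)
Definition twist (p q : I) (a b : K) : M := a *: E p q - b *: E (q + nu) (p + nu).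

Lemma addnuK : cancel (fun p => p + nu) (fun p => p + nu).
Proof. by move=> p; rewrite -addrA nuD addr0. Qed.

Lemma twist_flip p q a b : twist (q + nu) (p + nu) b a = - twist p q a b.
Proof. by rewrite /twist !addnuK opprB. Qed.

Lemma eq_addnu (p q : I) : (p + nu == q) = (p == q + nu).
Proof. by rewrite -(inj_eq (addIr nu)) addnuK. Qed.

Lemma twist_br p q t s a a' b b' :
  mxbr (twist p q a a') (twist t s b b') =
    (q == t)%:R *: twist p s (a * b) (a' * b')
    - (s == p)%:R *: twist t q (a * b) (a' * b')
    - (q == s + nu)%:R *: twist p (t + nu) (a * b') (a' * b)
    + (t + nu == p)%:R *: twist (s + nu) q (a * b') (a' * b).
Proof.
rewrite /mxbr /twist !mulmxBl !mulmxBr -!scalemxAl -!scalemxAr !mul_delta_mx_cond.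
rewrite !(inj_eq (addIr nu)) !addnuK (eq_sym t q) (eq_sym p s).
rewrite (eq_addnu p t) (eq_sym p (t + nu)) -(eq_addnu s q) (eq_sym (s + nu) q).
apply/matrixP => i j; rewrite !mxE !mulmxnE !mxE.
move: (q == t) (s == p) (q == s + nu) (t + nu == p) => b1 b2 b3 b4.
move: (_ && _)%:R (_ && _)%:R (_ && _)%:R (_ && _)%:R => x1 x2 x3 x4.
move: (_ && _)%:R (_ && _)%:R (_ && _)%:R (_ && _)%:R => x5 x6 x7 x8.
by case: b1; case: b2; case: b3; case: b4; rewrite ?mulr1n ?mulr0n; ring.
Qed.

(** The matrix [M_n] as a function of the difference of indices, extended to the indices of [- f] by
    a sign change under translation by [nu]; see [wcoef_Mn] and [wcoefD]. *)
Definition wcoef (x : I) : K :=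
  (x == 0)%:R *+ 2 - (x == 1)%:R - (x == - 1)%:R
  - (x == - nu)%:R *+ 2 + (x == 1 - nu)%:R + (x == - 1 - nu)%:R.

Lemma twist_scale p q x b b' : twist p q (x * b) (x * b') = x *: twist p q b b'.
Proof. by rewrite /twist scalerBr !scalerA. Qed.

Lemma twist_weight p q t x b b' : mxbr (twist p p x x) (twist q t b b') =
  (x * ((p == q)%:R - (t == p)%:R + (p == t + nu)%:R - (q + nu == p)%:R))
    *: twist q t b b'.
Proof.
have D (c : bool) X Y : (c -> X = Y) -> c%:R *: X = c%:R *: Y :> M.
  by case: c => [-> //|_]; rewrite !scale0r.
rewrite twist_br !twist_scale.
rewrite (D (p == q) _ (x *: twist q t b b')); last by move/eqP->.
rewrite (D (t == p) _ (x *: twist q t b b')); last by move/eqP->.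
rewrite (D (p == t + nu) _ (- (x *: twist q t b b'))); last first.
  by move/eqP->; rewrite twist_flip scalerN.
rewrite (D (q + nu == p) _ (- (x *: twist q t b b'))); last first.
  by move/eqP<-; rewrite twist_flip scalerN.
rewrite !scalerN opprK !scalerA -!scalerBl -scalerDl -scalerBl.
by congr (_ *: _); ring.
Qed.

Definition gen (s : K) (p : I) : M := twist p (p + 1) s s^-1.
(** The quotient [s / s] is 1 for [s != 0] and 0 at [s = 0], where [gen] vanishes as well; the
    relations thus hold at every [s]. *)
Definition gen_h (s : K) (p : I) : M :=
  twist p p (s / s) (s / s) - twist (p + 1) (p + 1) (s / s) (s / s).

Lemma gen_cyclic (s : K) : cyclic_rel (@mxbr K r.+2) nu wcoef (gen s) (gen_h s).
Proof.
have F (b : bool) x : b = false -> b%:R *: x = 0 :> M.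
  by move=> ->; rewrite scale0r.
split=> [p q pq qp pqnu|p|p q|p|p].
- rewrite twist_br !F ?subr0 ?addr0 //; apply/negbTE.
  + by znun pqnu.
  + by znun pqnu.
  + by znun qp.
  + by znun pq.
- rewrite twist_br /gen_h.
  rewrite (F (p + 1 == p + nu)); last by apply/negbTE; znun nu1.
  rewrite (F (p + nu + 1 == p)); last by apply/negbTE; znun num1.
  have -> : p + nu + nu = p by apply: addnuK.
  have -> : p + nu + 1 + nu = p + 1 by znu nuD.
  rewrite (mulrC s^-1) !eqxx /= !scale1r. by rewrite subrr sub0r [RHS]opprB [LHS]addrC.
- rewrite /gen_h (brBl (mxbr_lie _ _)) !twist_weight -scalerBl -mulrBr.
  have [->|s0] := eqVneq s 0.
    by rewrite /gen /twist invr0 !scale0r subr0 !scaler0.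
  rewrite divff // mul1r /wcoef; congr (_ *: _).
  have -> : (p == q) = (q - p == 0) by eqz.
  have -> : (q + 1 == p) = (q - p == - 1) by eqz.
  have -> : (p == q + 1 + nu) = (q - p == - 1 - nu) by eqz.
  have -> : (q + nu == p) = (q - p == - nu) by eqz.
  have -> : (p + 1 == q) = (q - p == 1) by eqz.
  have -> : (q + 1 == p + 1) = (q - p == 0) by eqz.
  have -> : (p + 1 == q + 1 + nu) = (q - p == - nu) by eqz.
  have -> : (q + nu == p + 1) = (q - p == 1 - nu) by eqz.
  ring.
- have -> : mxbr (gen s p) (gen s (p + 1)) = twist p (p + 2%:R) (s * s) (s^-1 * s^-1).
    rewrite twist_br eqxx scale1r.
    have -> : p + 1 + 1 = p + 2%:R by ring.
    rewrite !F ?subr0 ?addr0 //; apply/negbTE; zany.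
  rewrite twist_br !F ?subr0 ?addr0 //; apply/negbTE; zany.
- have -> : mxbr (gen s p) (gen s (p + 1)) = twist p (p + 2%:R) (s * s) (s^-1 * s^-1).
    rewrite twist_br eqxx scale1r.
    have -> : p + 1 + 1 = p + 2%:R by ring.
    rewrite !F ?subr0 ?addr0 //; apply/negbTE; zany.
  rewrite twist_br !F ?subr0 ?addr0 //; apply/negbTE; zany.
Qed.

End Model.

Section ProductBracket.
Variables (K : numFieldType) (T1 T2 : lmodType K).
Variables (br1 : T1 -> T1 -> T1) (br2 : T2 -> T2 -> T2).

Definition pair_br (x y : T1 * T2) : T1 * T2 := (br1 x.1 y.1, br2 x.2 y.2).

Lemma pair_br_lie : lie_bracket br1 -> lie_bracket br2 -> lie_bracket pair_br.
Proof.
move=> L1 L2; split=> [[x1 x2] [y1 y2] [z1 z2]|c [x1 x2] [z1 z2]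
  |[x1 x2] [y1 y2]|[x1 x2] [y1 y2] [z1 z2]]; rewrite /pair_br; congr (_, _) => /=.
- exact: (brDl L1).
- exact: (brDl L2).
- exact: (brZl L1).
- exact: (brZl L2).
- exact: (brC L1).
- exact: (brC L2).
- exact: (brJ L1).
- exact: (brJ L2).
Qed.

Lemma pair_cyclic (I : comNzRingType) (nu : I) (a : I -> K) u1 h1 u2 h2 :
  cyclic_rel br1 nu a u1 h1 -> cyclic_rel br2 nu a u2 h2 ->
  cyclic_rel pair_br nu a (fun p => (u1 p, u2 p)) (fun p => (h1 p, h2 p)).
Proof.
move=> R1 R2; split=> [p q pq qp pn|p|p q|p|p]; rewrite /pair_br; congr (_, _) => /=.
- exact: (cyc_comm R1).
- exact: (cyc_comm R2).
- exact: (cyc_nu R1).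
- exact: (cyc_nu R2).
- exact: (cyc_h R1).
- exact: (cyc_h R2).
- exact: (cyc_serre_r R1).
- exact: (cyc_serre_r R2).
- exact: (cyc_serre_l R1).
- exact: (cyc_serre_l R2).
Qed.

End ProductBracket.

Section FunctionBracket.
Variables (K : numFieldType) (X : Type) (T : lmodType K) (br : T -> T -> T).

Definition fun_br (x y : X -> T) : X -> T := fun s => br (x s) (y s).

Lemma fun_br_lie : lie_bracket br -> lie_bracket fun_br.
Proof.
move=> L; split=> [x y z|c x z|x y|x y z]; apply/funext => s; rewrite /fun_br /=.
- exact: (brDl L).
- exact: (brZl L).
- exact: (brC L).
- exact: (brJ L).
Qed.

Lemma fun_cyclic (I : comNzRingType) (nu : I) (a : I -> K) (u h : X -> I -> T) :
  (forall s, cyclic_rel br nu a (u s) (h s)) ->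
  cyclic_rel fun_br nu a (fun p s => u s p) (fun p s => h s p).
Proof.
move=> R; split=> [p q pq qp pn|p|p q|p|p]; apply/funext => s; rewrite /fun_br /=.
- exact: (cyc_comm (R s)).
- exact: (cyc_nu (R s)).
- exact: (cyc_h (R s)).
- exact: (cyc_serre_r (R s)).
- exact: (cyc_serre_l (R s)).
Qed.

End FunctionBracket.

(** * Growth of loops at infinity *)

Section Lead.
Variables (K : numFieldType) (m : nat).
Local Notation M := 'M[K]_m.
Local Notation W := (K -> M).
Local Notation wbr := (fun_br (@mxbr K m)).
Local Notation evalp s := (map_mx (horner_eval s)).

(* [z s] grows at most like [s ^ k] at infinity, with leading coefficient [A]. *)
Definition lead (k : nat) (z : W) (A : M) : Prop :=
  exists F : 'M[{poly K}]_m,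
    (forall s, s != 0 -> evalp s F = s ^+ k *: z s^-1) /\ evalp 0 F = A.

Lemma lead0 k : lead k 0 0.
Proof. by exists 0; split=> [s _|]; rewrite map_mx0 ?scaler0. Qed.

Lemma leadD k z w A B : lead k z A -> lead k w B -> lead k (z + w) (A + B).
Proof.
move=> [F [FE <-]] [G [GE <-]]; exists (F + G); split=> [s s0|]; rewrite map_mxD //.
by rewrite FE // GE // -scalerDr.
Qed.

Lemma leadZ k c z A : lead k z A -> lead k (c *: z) (c *: A).
Proof.
move=> [F [FE <-]]; exists (c%:P *: F); split=> [s s0|].
  by rewrite map_mxZ /= /horner_eval hornerC FE // !scalerA mulrC.
by rewrite map_mxZ /= /horner_eval hornerC.
Qed.

Lemma lead_br k l z w A B :
  lead k z A -> lead l w B -> lead (k + l) (wbr z w) (mxbr A B).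
Proof.
move=> [F [FE <-]] [G [GE <-]]; exists (mxbr F G).
split=> [s s0|]; rewrite /mxbr map_mxB !map_mxM //.
rewrite FE // GE // -!scalemxAl -!scalemxAr !scalerA /fun_br /mxbr.
by rewrite (mulrC (s ^+ l)) -scalerBr exprD.
Qed.

Lemma leadS k z A : lead k z A -> lead k.+1 z 0.
Proof.
move=> [F [FE _]]; exists ('X *: F); split=> [s s0|].
  by rewrite map_mxZ /= /horner_eval hornerX FE // scalerA exprS.
by rewrite map_mxZ /= /horner_eval hornerX scale0r.
Qed.

Lemma poly_eq0_of_roots (p : {poly K}) : (forall s, s != 0 -> p.[s] = 0) -> p = 0.
Proof.
move=> p0; apply/eqP; apply: contraT => pn0.
pose rs := [seq (i.+1%:R : K) | i <- iota 0 (size p)].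
have := @max_poly_roots _ p rs pn0.
rewrite size_map size_iota ltnn; apply.
  apply/allP => x /mapP[i _ ->]; apply/rootP/p0.
  by rewrite pnatr_eq0.
by rewrite map_inj_uniq ?iota_uniq // => i j /eqP; rewrite eqr_nat => /eqP[].
Qed.

Lemma lead_inj k z A : lead k z A -> (forall s, s != 0 -> z s = 0) -> A = 0.
Proof.
move=> [F [FE <-]] z0; suff -> : F = 0 by rewrite map_mx0.
apply/matrixP => i j; rewrite mxE; apply: poly_eq0_of_roots => s s0.
have := FE s s0; rewrite z0 ?invr_eq0 // scaler0 => /matrixP/(_ i j).
by rewrite !mxE.
Qed.

Lemma lead_sum k (J : finType) (z : J -> W) (A : J -> M) :
  (forall j, lead k (z j) (A j)) -> lead k (\sum_j z j) (\sum_j A j).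
Proof.
move=> H; elim/big_rec2: _ => [|j B w _ IH]; first exact: lead0.
exact: leadD.
Qed.

End Lead.

(** * Laurent polynomials graded by exponents modulo N *)

Section Laurent.
Variables (K : numFieldType) (r : nat).
Local Notation I := 'I_r.+2.
Local Notation N := r.+2.

Lemma Zp_natN : N%:R = 0 :> I.
Proof. by rewrite Zp_nat; apply/val_inj; rewrite /= modnn. Qed.

(* On nonzero [s], [a s] is [s ^ e] times a Laurent polynomial in [s ^ N]
   divisible by [G]. *)
Definition lau (e : I) (G : {poly K}) (a : K -> K) : Prop :=
  exists m (f : {poly K}), forall s, s != 0 ->
    a s * s ^+ (N * m) = s ^+ val e * (G * f).[s ^+ N].

Lemma lauP (j : nat) (e : I) G a m (f : {poly K}) : j%:R = e ->
  (forall s, s != 0 -> a s * s ^+ (N * m) = s ^+ j * (G * f).[s ^+ N]) ->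
  lau e G a.
Proof.
move=> je aE; exists m, (f * 'X^(j %/ N)) => s s0; rewrite aE // {1}(divn_eq j N).
have -> : val e = (j %% N)%N by rewrite -je Zp_nat.
by rewrite !hornerM hornerXn exprD mulnC exprM; ring.
Qed.

Lemma lau_ext e G a b : (forall s, s != 0 -> a s = b s) -> lau e G a -> lau e G b.
Proof. by move=> ab [m [f H]]; exists m, f => s s0; rewrite -ab // H. Qed.

Lemma lauM e e' G G' a b : lau e G a -> lau e' G' b ->
  lau (e + e') (G * G') (fun s => a s * b s).
Proof.
move=> [m [f H]] [m' [f' H']].
apply: (@lauP (val e + val e') _ _ _ (m + m') (f * f')).
  by rewrite natrD !natr_Zp.
move=> s s0; rewrite mulnDr (exprD s (N * m)) (exprD s (val e)) mulrACA H // H' // !hornerM; ring.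
Qed.

Lemma lau0 e G : lau e G (fun=> 0).
Proof. by exists 0, 0 => s _; rewrite mulr0 horner0 mulr0 mul0r. Qed.

Lemma lauD e G a b : lau e G a -> lau e G b -> lau e G (fun s => a s + b s).
Proof.
move=> [m [f H]] [m' [f' H']]; exists (m + m')%N, (f * 'X^m' + f' * 'X^m) => s s0.
rewrite mulnDr (exprD s (N * m)) mulrDl {1}mulrA H // (mulrC (s ^+ (N * m))) mulrA H' //.
by rewrite !(hornerM, hornerD, hornerXn) -!exprM; ring.
Qed.

Lemma lauZ e G c a : lau e G a -> lau e G (fun s => c * a s).
Proof.
move=> [m [f H]]; exists m, (c *: f) => s s0.
by rewrite -mulrA H // !hornerM hornerZ; ring.
Qed.

Lemma lauN e G a : lau e G a -> lau e G (fun s => - a s).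
Proof. by move/(lauZ (-1)); apply: lau_ext => s _; rewrite mulN1r. Qed.

Lemma lau_sum e G (J : finType) (a : J -> K -> K) :
  (forall j, lau e G (a j)) -> lau e G (fun s => \sum_j a j s).
Proof.
move=> H; elim: (index_enum J) => [|j js IH].
  by apply: lau_ext (lau0 e G) => s _; rewrite big_nil.
by apply: lau_ext (lauD (H j) IH) => s _; rewrite big_cons.
Qed.

Lemma lau_exp j : lau (j%:R) 1 (fun s => s ^+ j).
Proof.
apply: (@lauP j _ _ _ 0 1) => // s _.
by rewrite muln0 expr0 !mul1r hornerC.
Qed.

Lemma lau_invs : lau (- 1) 1 (fun s => s^-1).
Proof.
apply: (@lauP r.+1 _ _ _ 1 1).
  apply/eqP; rewrite -subr_eq0 opprK natr1; apply/eqP.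
  exact: Zp_natN.
by move=> s s0; rewrite muln1 mul1r hornerC mulr1 exprS mulKf.
Qed.

Lemma lau_div (e : I) g a j : lau e g a -> exists2 b, lau (e - j%:R) 1 b &
  forall s, s != 0 -> a s = s ^+ j * g.[s ^+ N] * b s.
Proof.
move=> [m [f aE]].
exists (fun s => s ^+ val e * s^-1 ^+ (N * m + j) * f.[s ^+ N]).
  (* Up to a power of [s^N], [s^-j] is [s^(j (N - 1))]; this keeps exponents in [nat]. *)
  have Ej : (j * r.+1)%:R = - j%:R :> I.
    apply/eqP; rewrite -subr_eq0 opprK -natrD addnC -mulnS natrM Zp_natN mulr0.
    by rewrite eqxx.
  apply: (@lauP (val e + j * r.+1) _ _ _ (m + j) f).
    by rewrite natrD natr_Zp Ej.
  move=> s s0; rewrite mul1r.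
  have -> : (N * (m + j) = (N * m + j) + j * r.+1)%N by lia.
  rewrite (exprD s (N * m + j)) (exprD s (val e)) -!mulrA; congr (_ * _).
  have X0 : s ^+ (N * m + j) != 0 by rewrite expf_neq0.
  rewrite exprVn; move: (s ^+ (N * m + j)) (s ^+ (j * r.+1)) X0 => X Z X0.
  transitivity (X / X * (Z * f.[s ^+ N])); first by ring.
  by rewrite divff // mul1r.
move=> s s0; apply: (mulIf (expf_neq0 (N * m) s0)); rewrite aE // hornerM.
rewrite exprVn (exprD s (N * m)) invfM.
have X0 : s ^+ (N * m) != 0 by rewrite expf_neq0.
have Y0 : s ^+ j != 0 by rewrite expf_neq0.
move: (s ^+ (N * m)) (s ^+ j) X0 Y0 => X Y X0 Y0.
transitivity (s ^+ val e * (g.[s ^+ N] * f.[s ^+ N]) * (Y / Y) * (X / X)).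
  by rewrite !divff // !mulr1.
ring.
Qed.

End Laurent.

(** * Loops produced by the generators *)

Section TwistedLoops.
Variables (K : numFieldType) (r : nat).
Local Notation I := 'I_r.+2.
Local Notation M := 'M[K]_r.+2.
Local Notation W := (K -> M).
Local Notation N := r.+2.
Variable (nu : I).
Hypotheses (nuD : nu + nu = 0) (nu0 : nu != 0) (nu1 : nu != 1) (num1 : nu != - 1)
  (nu2 : nu != 2%:R) (num2 : nu != - 2%:R).
Hypotheses (I1 : (1 : I) != 0) (I2 : (2%:R : I) != 0) (I3 : (3%:R : I) != 0).
Local Notation wbr := (fun_br (@mxbr K N)).

Definition xf (p q : I) (a : K -> K) : W := fun s => twist nu p q (a s) (a s^-1).

(* Functions are only considered on [s != 0], hence [lc_ext]. *)
Record loop_closed (S : W -> Prop) : Prop := LoopClosed {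
  lc_subspace : subspace S;
  lc_br : forall z w, S z -> S w -> S (wbr z w);
  lc_ext : forall z w, S z -> (forall s, s != 0 -> z s = w s) -> S w;
  lc_gen : forall p, S (fun s => gen nu s p) }.

Variables (S : W -> Prop) (HS : loop_closed S).
Let SS := lc_subspace HS.

Lemma xf_ext p q a b : (forall s, s != 0 -> a s = b s) -> S (xf p q a) -> S (xf p q b).
Proof.
move=> ab /(lc_ext HS); apply=> s s0.
by rewrite /xf !ab // invr_eq0.
Qed.

Lemma xf_br (p q t : I) a b : p != t -> q != t + nu -> q + nu != p ->
  wbr (xf p q a) (xf q t b) = xf p t (fun s => a s * b s).
Proof.
move=> pt qt qp; apply/funext => s; rewrite /fun_br /xf twist_br // eqxx.
rewrite eq_sym (negPf pt) (negPf qt) (negPf qp) !scale0r scale1r !subr0 addr0.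
by [].
Qed.

Lemma xf_closed_step (p q t : I) a b : p != t -> q != t + nu -> q + nu != p ->
  S (xf p q a) -> S (xf q t b) -> S (xf p t (fun s => a s * b s)).
Proof. by move=> pt qt qp Sa Sb; rewrite -(@xf_br p q t a b) //; apply: (lc_br HS). Qed.

(** Excluded are the diagonal positions and the positions [(p,p+nu)], which the involution maps to
    themselves. *)
Definition short (x : I) := (x != 0) && (x != nu).

(** The position is lengthened by one generator at a time; where this would pass through length [0]
    or [nu], the two-step loops [S2] jump over it. *)
Lemma xf_pow k p : (0 < k)%N -> short k%:R -> S (xf p (p + k%:R) (fun s => s ^+ k)).
Proof.
have S1 q : S (xf q (q + 1) (fun s => s)) by apply: (lc_gen HS).
have S2 q : S (xf q (q + 1 + 1) (fun s => s * s)).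
  by apply: (@xf_closed_step _ (q + 1)) => //; zany.
elim/ltn_ind: k p => -[//|[_ p _ _|k IH p _ /andP[kn0 kn1]]].
  by apply: xf_ext (S1 p) => s _; rewrite expr1.
have [sk|sk] := boolP (short (k.+1%:R : I)).
  case/andP: (sk) => sk0 sk1.
  have e : (k.+2%:R : I) = k.+1%:R + 1 by rewrite natr1.
  have qE : p + k.+2%:R = p + k.+1%:R + 1 by rewrite e addrA.
  apply: (@xf_ext _ _ (fun s => s ^+ k.+1 * s)) => [s _|]; first by rewrite -exprSr.
  apply: (@xf_closed_step p (p + k.+1%:R)).
  - by zneq kn0.
  - by rewrite e; znun num1.
  - by znun sk1.
  - exact: IH.
  - by rewrite qE.
have k0 : (0 < k)%N.
  by case: (k) sk => //; rewrite /short I1 eq_sym nu1.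
have kE : (k%:R : I) = - 1 \/ (k%:R : I) = nu - 1.
  move: sk; rewrite /short negb_and !negbK -natr1 => /orP[/eqP H|/eqP H]; [left|right]; zlin H.
have sk' : short (k%:R : I).
  by rewrite /short; apply/andP; case: kE => ->; split; zany.
case/andP: (sk') => sk0 sk1.
have e : (k.+2%:R : I) = k%:R + 1 + 1 by rewrite !natr1.
have qE : p + k.+2%:R = p + k%:R + 1 + 1 by rewrite e !addrA.
apply: (@xf_ext _ _ (fun s => s ^+ k * (s * s))) => [s _|]; first by rewrite mulrA -!exprSr.
apply: (@xf_closed_step p (p + k%:R)).
- by zneq kn0.
- by rewrite e; znun num2.
- by znun sk1.
- exact: IH.
- by rewrite qE.
Qed.

Lemma xf_sum (J : finType) p q (a : J -> K -> K) :
  xf p q (fun s => \sum_j a j s) = \sum_j xf p q (a j).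
Proof.
apply/funext => s; rewrite fct_sumE /xf /twist sumrB.
by rewrite !scaler_suml.
Qed.

Lemma xfZ p q c a : xf p q (fun s => c * a s) = c *: xf p q a.
Proof. by apply/funext => s; rewrite /xf twist_scale. Qed.

(** The involution turns [s^k] at [(q+nu,p+nu)] into [s^-k] at [(p,q)], up to sign. *)
Lemma xf_pow_inv k (p q : I) : (0 < k)%N -> short k%:R -> p = q + k%:R ->
  S (xf p q (fun s => s^-1 ^+ k)).
Proof.
move=> k0 sk ->; have := subspaceN SS (xf_pow (q + nu) k0 sk).
congr (S _); apply/funext => s; rewrite /xf -[LHS]/(- twist _ _ _ _ _) /= invrK.
by rewrite addrAC twist_flip // opprK.
Qed.

Lemma xf_lau (p q : I) a : short (q - p) -> lau (q - p) 1 a -> S (xf p q a).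
Proof.
move=> spq [m [f aE]]; set e := q - p in spq aE.
pose mono i (s : K) := s ^+ (val e + N * i) * s^-1 ^+ (N * m).
apply: (@xf_ext _ _ (fun s => \sum_(i < size f) f`_i * mono i s)) => [s s0|].
  apply: (mulIf (expf_neq0 (N * m) s0)); rewrite aE // mul1r horner_coef.
  rewrite mulr_sumr mulr_suml; apply: eq_bigr => i _.
  by rewrite /mono -!mulrA exprVn mulVf ?expf_neq0 // mulr1 exprD exprM mulrCA.
rewrite xf_sum; apply: (subspace_sum SS) => i _.
rewrite xfZ; apply: (subspaceZ SS).
have NE j : (N * j)%:R = 0 :> I.
  by rewrite natrM Zp_natN mul0r.
have eE : (val e)%:R = e by apply: natr_Zp.
have qE : q = p + e by rewrite /e addrC subrK.
have [lt|le] := ltnP (N * m) (val e + N * i).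
  have kE : (val e + N * i - N * m)%:R = e.
    by rewrite natrB ?(ltnW lt) // natrD !NE eE addr0 subr0.
  apply: (@xf_ext _ _ (fun s => s ^+ (val e + N * i - N * m))) => [s s0|].
    rewrite /mono exprVn; apply: (mulIf (expf_neq0 (N * m) s0)).
    by rewrite divfK ?expf_neq0 // -exprD subnK // ltnW.
  by rewrite qE -[X in p + X]kE; apply: xf_pow; rewrite ?subn_gt0 // kE.
have kE : (N * m - (val e + N * i))%:R = - e.
  by rewrite natrB // natrD !NE eE addr0 sub0r.
have ltNm : (val e + N * i < N * m)%N.
  rewrite ltn_neqAle le andbT; apply/eqP => /(congr1 (fun k => k%:R : I)).
  by rewrite natrD !NE eE addr0 => e0; case/andP: spq; rewrite e0 eqxx.
apply: (@xf_ext _ _ (fun s => s^-1 ^+ (N * m - (val e + N * i)))) => [s s0|].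
  apply: (mulfI (expf_neq0 (N * m - (val e + N * i)) s0)).
  rewrite /mono mulrA -exprD subnK // !exprVn.
  by rewrite !divff ?expf_neq0.
apply: xf_pow_inv; rewrite ?subn_gt0 // kE; last by rewrite qE addrK.
by case/andP: spq => e0 e1; apply/andP; split; [zneq e0 | znun e1].
Qed.

Lemma short1 : short 1.
Proof. by rewrite /short I1 eq_sym nu1. Qed.

(** A bracket of a generator at [(p,p+1)] with a loop at the short position [(p+1,p+nu)]. *)
Lemma xf_long (p : I) a : lau nu 1 a -> S (xf p (p + nu) a).
Proof.
move=> la; pose b s : K := a s * s^-1.
apply: (@xf_ext _ _ (fun s => s * b s)) => [s s0|].
  by rewrite /b mulrCA divff // mulr1.
have lb : lau (nu - 1) 1 b.
  by have := lauM la (lau_invs K r); rewrite mulr1.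
apply: (@xf_closed_step p (p + 1)).
- by zneq nu0.
- by znun I1.
- by znun num1.
- exact: (lc_gen HS).
- apply: xf_lau.
    have -> : p + nu - (p + 1) = nu - 1 by ring.
    by apply/andP; split; zany.
  by have -> : p + nu - (p + 1) = nu - 1 by ring.
Qed.

(** Diagonal loops arise by bracketing opposite positions, hence as differences of neighbours, which
    are then added up from [p] to [q]. *)
Lemma xf_diag (p q : I) a : lau (0 : I) 1 a -> S (xf p p a - xf q q a).
Proof.
move=> la.
have step p' : S (xf p' p' a - xf (p' + 1) (p' + 1) a).
  pose b s : K := a s * s^-1.
  have lb : lau (- 1 : I) 1 b.
    by have := lauM la (lau_invs K r); rewrite mulr1 add0r.
  have Sb : S (xf (p' + 1) p' b).
    apply: xf_lau; have -> : p' - (p' + 1) = - 1 by ring.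
      by apply/andP; split; zany.
    by [].
  have := lc_br HS (lc_gen HS p') Sb; move/(lc_ext HS); apply=> s s0.
  rewrite /fun_br /gen /xf twist_br // !eqxx.
  have /negPf -> : p' + 1 != p' + nu by zneq nu1.
  have /negPf -> : p' + 1 + nu != p' by znun num1.
  rewrite !scale0r !scale1r subr0 addr0 /b invrK.
  have -> : s * (a s / s) = a s by rewrite mulrCA divff // mulr1.
  by have -> : s^-1 * (a s^-1 * s) = a s^-1 by rewrite mulrCA mulVf // mulr1.
have -> : q = p + (val (q - p))%:R by rewrite natr_Zp addrC subrK.
elim: (val _) => [|k IH]; first by rewrite addr0 subrr; apply: (subspace0 SS).
have := subspaceD SS IH (step (p + k%:R)).
by rewrite addrA subrK -(addrA p) natr1.
Qed.

Lemma short_opp x : short x -> short (- x).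
Proof. by case/andP=> x0 x1; apply/andP; split; [zneq x0 | znun x1]. Qed.

Lemma short_sym (p q : I) : short (q - p) -> short (p - q).
Proof. by move/short_opp; rewrite opprB. Qed.

Lemma short_step (p q t : I) : short (q - p) -> short (t - p) -> short (t - q) ->
  [/\ p != t, q != t + nu & q + nu != p].
Proof.
move=> /andP[_ x1] /andP[y0 _] /andP[_ z1].
by split; [zneq y0 | znun z1 | znun x1].
Qed.

Lemma third_short (p q : I) : exists t, short (t - p) /\ short (t - q).
Proof.
have [s1|] := boolP (short (p + 1 - q)).
  by exists (p + 1); rewrite addrAC subrr add0r short1.
rewrite /short negb_and !negbK => /orP[/eqP H|/eqP H]; exists (p + 2%:R).
  have -> : p + 2%:R - p = 2%:R by ring.
  have -> : p + 2%:R - q = 1 by zlin H.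
  by rewrite I1 I2 !(eq_sym _ nu) nu1 nu2.
have -> : p + 2%:R - p = 2%:R by ring.
have -> : p + 2%:R - q = nu + 1 by zlin H.
rewrite I2 !(eq_sym _ nu) nu2 /=; split=> //.
by apply/andP; split; [znun num1 | znun I1].
Qed.

Section Ideal.
(* [S0] is an ideal of the Lie algebra [S]. *)
Variable S0 : W -> Prop.
Hypotheses (S0S : subspace S0)
  (S0br : forall z w, S0 z -> S w -> S0 (wbr z w))
  (S0ext : forall z w, S0 z -> (forall s, s != 0 -> z s = w s) -> S0 w).
Variable g : {poly K}.

(** [A] asks for all multiples of [g(s^N)] at the position [(p,q)], [B] for just one of the form
    [s^j g(s^N)]. As [s^j] is invertible, one bracket with a loop of [S] leads from [B] at a
    position to [A] at a neighbouring one. *)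
Let A (p q : I) := forall a, lau (q - p) g a -> S0 (xf p q a).
Let B (p q : I) := exists2 j : nat, j%:R = q - p &
  S0 (xf p q (fun s => s ^+ j * g.[s ^+ N])).

Lemma xf_ideal_ext p q a b :
  (forall s, s != 0 -> a s = b s) -> S0 (xf p q a) -> S0 (xf p q b).
Proof.
move=> ab /S0ext; apply=> s s0.
by rewrite /xf !ab // invr_eq0.
Qed.

Lemma ideal_A_B p q : A p q -> B p q.
Proof.
move=> Apq; exists (val (q - p)); first exact: natr_Zp.
apply: Apq; exists 0, 1 => s s0.
by rewrite muln0 mulr1 mulr1.
Qed.

Lemma ideal_right p q t : B p q -> short (q - p) -> short (t - p) ->
  short (t - q) -> A p t.
Proof.
move=> [j je Spq] pq pt qt a /(lau_div j)[b lb ab].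
apply: (xf_ideal_ext (a := fun s => s ^+ j * g.[s ^+ N] * b s)) => [s s0|].
  by rewrite ab.
have [H1 H2 H3] := short_step pq pt qt.
rewrite -(@xf_br p q t) //; apply: S0br => //; apply: xf_lau => //.
by move: lb; rewrite je; congr (lau _ _ _); ring.
Qed.

Lemma ideal_left p q t : B q t -> short (t - q) -> short (t - p) ->
  short (q - p) -> A p t.
Proof.
move=> [j je Sqt] qt pt pq a /(lau_div j)[b lb ab].
apply: (xf_ideal_ext (a := fun s => b s * (s ^+ j * g.[s ^+ N]))) => [s s0|].
  by rewrite ab // mulrC.
have [H1 H2 H3] := short_step pq pt qt.
rewrite -(@xf_br p q t) // (brC (fun_br_lie _ (mxbr_lie _ _))).
apply: (subspaceN S0S); apply: S0br => //; apply: xf_lau => //.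
by move: lb; rewrite je; congr (lau _ _ _); ring.
Qed.

(** If [(q,t)] is not short, the passage from column [q] to column [t] makes a detour through a
    third column. *)
Lemma ideal_row p q t : B p q -> short (q - p) -> short (t - p) -> A p t.
Proof.
move=> Bpq pq pt; have [st|] := boolP (short (t - q)); first exact: ideal_right Bpq pq pt st.
move=> nst; have [t' [t'p t't]] := third_short p t.
have t'q : short (t' - q).
  move: nst; rewrite /short negb_and !negbK => /orP[/eqP H|/eqP H].
    by have -> : t' - q = t' - t by zlin H.
  have -> : t' - q = t' - t + nu by zlin H.
  by case/andP: t't => x0 x1; apply/andP; split; [znun x1 | zneq x0].
have Apt' := ideal_right Bpq pq t'p t'q.
exact: ideal_right (ideal_A_B Apt') t'p pt (short_sym t't).
Qed.

Lemma ideal_col p q t : B q t -> short (t - q) -> short (t - p) -> A p t.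
Proof.
move=> Bqt qt pt; have [st|] := boolP (short (q - p)); first exact: ideal_left Bqt qt pt st.
move=> nst; have [t' [t'p t't]] := third_short p t.
have t'q : short (q - t').
  move: nst; rewrite /short negb_and !negbK => /orP[/eqP H|/eqP H].
    have -> : q - t' = - (t' - p) by zlin H.
    exact: short_opp.
  have -> : q - t' = - (t' - p) + nu by zlin H.
  by case/andP: t'p => x0 x1; apply/andP; split; [znun x1 | zneq x0].
have At't := ideal_left Bqt qt (short_sym t't) t'q.
exact: ideal_left (ideal_A_B At't) (short_sym t't) pt t'p.
Qed.

Lemma ideal_spread p0 q0 p q a : B p0 q0 -> short (q0 - p0) -> short (q - p) ->
  lau (q - p) g a -> S0 (xf p q a).
Proof.
move=> B0 s0 spq; have [t [tp0 tp]] := third_short p0 p.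
have A1 := ideal_row B0 s0 tp0.
have A2 := ideal_col (ideal_A_B A1) tp0 tp.
exact: (ideal_row (ideal_A_B A2) tp spq).
Qed.

End Ideal.

End TwistedLoops.

(** * Uniqueness of the operator attached to a loop *)

Section TopWords.
Variables (K : numFieldType) (T : lmodType K) (br : T -> T -> T).
Variables (I : finComNzRingType) (u h : I -> T).

Lemma words_upto_top k w : words_upto br u h k.+1 w ->
  exists c : I -> K,
    words_upto br u h k (w - \sum_p c p *: word br u h k.+1 p).
Proof.
have S k' := V_subspace br u h k'.
move=> Vw; apply: (Vw (fun w => exists c : I -> K,
  words_upto br u h k (w - \sum_p c p *: word br u h k.+1 p))).
  split=> [|x y [c Hx] [c' Hy]|a x [c Hx]].
  - exists (fun=> 0); rewrite big1 ?subr0 => [|p _]; last by rewrite scale0r.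
    exact: subspace0 (S k).
  - exists (fun p => c p + c' p); under eq_bigr do rewrite scalerDl.
    by rewrite big_split opprD addrACA; apply: (subspaceD (S k)).
  - exists (fun p => a * c p); under eq_bigr do rewrite -scalerA.
    by rewrite -scaler_sumr -scalerBr; apply: (subspaceZ (S k)).
move=> g [j [p [jk ->]]]; have [jE|jk'] := eqVneq j k.+1.
  exists (fun q => (q == p)%:R); rewrite (bigD1 p) //= eqxx scale1r big1 => [|q /negPf->].
    by rewrite addr0 jE subrr; apply: subspace0 (S k).
  by rewrite scale0r.
exists (fun=> 0); rewrite big1 ?subr0 => [|q _]; last by rewrite scale0r.
by apply: V_word; rewrite -ltnS ltn_neqAle jk' jk.
Qed.

End TopWords.

Section Graph.
Variables (K : numClosedFieldType) (r : nat).
Local Notation I := 'I_r.+2.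
Local Notation M := 'M[K]_r.+2.
Variable (nu : I).
Hypotheses (nuD : nu + nu = 0) (nu0 : nu != 0) (nu1 : nu != 1) (num1 : nu != - 1).
Hypotheses (I1 : (1 : I) != 0) (I2 : (2%:R : I) != 0) (I3 : (3%:R : I) != 0)
  (I4 : (4%:R : I) != 0).
Variables (d : nat) (U Ud : I -> 'M[K]_d).
Hypothesis RU : cyclic_rel (@mxbr K d) nu (wcoef K nu) U Ud.
Hypothesis irr : irreducible_ops (fun A => exists p, A = U p).

Local Notation W := (K -> M).
Local Notation T := (W * 'M[K]_d)%type.

Definition brT : T -> T -> T := pair_br (fun_br (@mxbr K r.+2)) (@mxbr K d).
Definition uT (p : I) : T := (fun s => gen nu s p, U p).
Definition hT (p : I) : T := (fun s => gen_h nu s p, Ud p).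
Local Notation V := (words_upto brT uT hT).
Local Notation wd := (word brT uT hT).

Lemma brT_lie : lie_bracket brT.
Proof. by apply: pair_br_lie; [apply: fun_br_lie|]; apply: mxbr_lie. Qed.

Lemma uT_cyclic : cyclic_rel brT nu (wcoef K nu) uT hT.
Proof.
apply: pair_cyclic => //; apply: fun_cyclic => s.
exact: gen_cyclic.
Qed.

Lemma lead_gen p : lead 1 (uT p).1 (delta_mx p (p + 1)).
Proof.
exists (delta_mx p (p + 1) - 'X^2 *: delta_mx (p + 1 + nu) (p + nu)).
split=> [s s0|]; last first.
  by rewrite map_mxB map_mxZ !map_delta_mx /= /horner_eval hornerXn expr0n scale0r subr0.
rewrite map_mxB map_mxZ !map_delta_mx /= /horner_eval hornerXn.
by rewrite /gen /twist scalerBr !scalerA invrK expr1 divff // scale1r expr2.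
Qed.

(** At a multiple of [N] the path closes up and the commutator keeps both diagonal units. The next
    bracket drops the second, since [E_(p-1,p-1)] and [E_(p,p+1)] have product 0 both ways. *)
Lemma lead_word k p : (0 < k)%N -> lead k (wd k p).1
  (delta_mx p (p + k%:R) - ((k%:R : I) == 0)%:R *: delta_mx (p - 1) (p - 1)).
Proof.
elim: k => // -[_ _|k IH _].
  by rewrite (negPf I1) scale0r subr0; apply: lead_gen.
have := lead_br (IH isT) (lead_gen (p + k.+1%:R)).
rewrite addn1; congr (lead _ _ _).
rewrite /mxbr mulmxBl mulmxBr -!scalemxAl -!scalemxAr !mul_delta_mx_cond eqxx mulr1n.
have [k0|k0] := eqVneq (k.+1%:R : I) 0.
  have -> : (k.+2%:R : I) = k.+1%:R + 1 by rewrite natr1.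
  rewrite k0 add0r (negPf I1) !scale0r !addr0 !scale1r.
  have /negPf -> : p - 1 != p by zneq I1.
  have /negPf -> : p + 1 != p - 1 by zneq I2.
  have /negPf -> : p + 1 != p by zneq I1.
  by rewrite !mulr0n !subr0.
rewrite !scale0r !subr0 -addrA -(natrD _ _ 1) addn1.
have -> : (p + k.+2%:R == p) = ((k.+2%:R : I) == 0) by eqz.
case: eqP => [k2|_]; last by rewrite mulr0n scale0r subr0.
have -> : p + k.+1%:R = p - 1 by rewrite -natr1 in k2; zlin k2.
by rewrite mulr1n scale1r.
Qed.

Definition vanishes (w : T) := forall s, s != 0 -> w.1 s = 0.

Lemma lead_leq j k (z : W) A : (j <= k)%N -> lead j z A -> lead k.+1 z 0.
Proof.
elim: k => [|k IH]; first by rewrite leqn0 => /eqP ->; apply: leadS.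
rewrite leq_eqVlt => /orP[/eqP ->|]; first exact: leadS.
by rewrite ltnS => /IH H /H /leadS.
Qed.

Lemma lead_V k w : V k w -> lead k.+1 w.1 0.
Proof.
move=> Vw; apply: (Vw (fun w : T => lead k.+1 w.1 0)).
  split=> [|x y Hx Hy|c x Hx] /=.
  - exact: lead0.
  - by rewrite -[0]addr0; apply: leadD.
  - by rewrite -[0](scaler0 _ c); apply: leadZ.
move=> g [[|j] [p [jk ->]]]; last by apply: lead_leq jk _; apply: lead_word.
pose C : M := twist nu p p 1 1 - twist nu (p + 1) (p + 1) 1 1.
have CE s : map_mx (horner_eval s) (map_mx polyC C) = C.
  by apply/matrixP => i j; rewrite !mxE /horner_eval hornerC.
apply: (@lead_leq 0 _ _ C) => //; exists (map_mx polyC C); split=> [s s0|] //.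
by rewrite CE expr0 scale1r /= /gen_h divff // invr_eq0.
Qed.

Lemma lead_top k (c : I -> K) v : V k v ->
  lead k.+1 (\sum_p c p *: wd k.+1 p + v).1 (\sum_p c p *:
    (delta_mx p (p + k.+1%:R) - ((k.+1%:R : I) == 0)%:R *: delta_mx (p - 1) (p - 1))).
Proof.
move=> Vv; rewrite -[X in lead _ _ X]addr0; apply: leadD; last exact: lead_V.
rewrite (big_morph (fun x : T => x.1) (id1 := 0) (op1 := +%R)) //.
by apply: lead_sum => p; apply: leadZ; apply: lead_word.
Qed.

(** A vanishing loop has leading coefficient 0. Distinct matrix units force [c = 0]; for the
    differences [E_(p,p) - E_(p-1,p-1)] they only force [c] to be constant. *)
Lemma top_coef k w : V k.+1 w -> vanishes w -> exists c : I -> K,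
  V k (w - \sum_p c p *: wd k.+1 p) /\
  forall p, c p = ((k.+1%:R : I) == 0)%:R * c (p + 1).
Proof.
move=> /words_upto_top[c Vw] w0; exists c; split=> // p.
have := lead_top c Vw; rewrite addrC subrK => /lead_inj/(_ w0)/matrixP.
move=> /(_ p (p + k.+1%:R)); rewrite summxE !mxE.
under eq_bigr => q _ do rewrite !mxE (inj_eq (addIr _)) andbb.
have [k0|k0] := eqVneq (k.+1%:R : I) 0.
  rewrite (bigD1 p) //= (bigD1 (p + 1)) ?big1 /=; first last.
  - by zneq I1.
  - move=> q /andP[/negPf qp /negPf qp1].
    rewrite (eq_sym p) qp k0 addr0.
    have -> : (p == q - 1) = (q == p + 1) by eqz.
    by rewrite qp1 mulr0 subrr mulr0.
  rewrite k0 addr0 addrK !eqxx (eq_sym p).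
  have /negPf -> : p - 1 != p by zneq I1.
  have /negPf -> : p != p + 1 by zneq I1.
  by rewrite /= ?mulr1n ?mulr0n => H; apply/subr0_eq; rewrite -[RHS]H; ring.
rewrite (bigD1 p) //= big1 => [|q /negPf qp]; last first.
  by rewrite eq_sym qp mul0r subr0 mulr0.
by rewrite eqxx mul0r subr0 mulr1 addr0 mul0r.
Qed.

Lemma wcoef0 : wcoef K nu 0 = 2%:R.
Proof.
rewrite /wcoef eqxx.
have /negPf -> : (0 : I) != 1 by zany.
have /negPf -> : (0 : I) != - 1 by zany.
have /negPf -> : (0 : I) != - nu by zany.
have /negPf -> : (0 : I) != 1 - nu by zany.
have /negPf -> : (0 : I) != - 1 - nu by zany.
by rewrite mulr0n mul0rn !subr0 !addr0.
Qed.

Lemma two_neq0 : (2%:R : K) != 0.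
Proof. by rewrite pnatr_eq0. Qed.

Lemma U_bracket p : U p = 2%:R^-1 *: mxbr (Ud p) (U p).
Proof. by rewrite (cyc_h RU) subrr wcoef0 scalerA mulVf ?two_neq0 // scale1r. Qed.

Lemma lie_gen_trace w : lie_gen brT uT hT w -> \tr w.2 = 0.
Proof.
move=> [k Vw]; apply: (Vw (fun w : T => \tr w.2 = 0)).
  split=> [|x y Hx Hy|c x Hx] /=.
  - exact: mxtrace0.
  - by rewrite mxtraceD Hx Hy addr0.
  - by rewrite mxtraceZ Hx mulr0.
move=> g [[|[|j]] [p [_ ->]]] /=.
- by rewrite -[Ud p]opprK -(cyc_nu RU) linearN /= mxtrace_mxbr oppr0.
- by rewrite U_bracket mxtraceZ mxtrace_mxbr mulr0.
- exact: mxtrace_mxbr.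
Qed.

Lemma central_eq0 (X : 'M[K]_d) : (forall p, mxbr X (U p) = 0) -> \tr X = 0 -> X = 0.
Proof.
move=> XU trX; have [|c Xc] := irreducible_scalar irr (X := X).
  by move=> A [p ->]; apply/eqP; rewrite -subr_eq0; apply/eqP/XU.
by move: trX; rewrite Xc; apply: (scalar_mx_eq0 irr).
Qed.

(** The scalars [c p] commute, so [X] commutes with every bracket of generators, in particular with
    each [Ud q]; as [U p] is half the bracket of [Ud p] and [U p], [X] commutes with it too. *)
Lemma eigen_eq0 (X : 'M[K]_d) :
  (forall p, exists c, mxbr X (U p) = c *: X) -> \tr X = 0 -> X = 0.
Proof.
have L := mxbr_lie K d; move=> /choice[c XU]; apply: central_eq0 => p.
have XUd q : mxbr X (Ud q) = 0.
  rewrite -[Ud q]opprK -(cyc_nu RU) (brNr L) (brJr L) !XU !(brZl L) !XU !scalerA.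
  by rewrite mulrC subrr oppr0.
by rewrite U_bracket (brZr L) (brJr L) XUd (br0l L) XU (brZl L) XUd scaler0 subr0 scaler0.
Qed.

Lemma vanishesB w w' : vanishes w -> vanishes w' -> vanishes (w - w').
Proof.
move=> w0 w'0 s s0; rewrite -[LHS]/(w.1 s - w'.1 s).
by rewrite w0 // w'0 // subr0.
Qed.

Lemma vanishesZ c w : vanishes w -> vanishes (c *: w).
Proof. by move=> w0 s s0; rewrite -[LHS]/(c *: w.1 s) w0 // scaler0. Qed.

Lemma vanishes_br w w' : vanishes w -> vanishes (brT w w').
Proof.
move=> w0 s s0; rewrite -[LHS]/(mxbr (w.1 s) (w'.1 s)) w0 //.
exact: br0l (mxbr_lie _ _) _.
Qed.

Lemma const_coef (c : I -> K) : (forall p, c p = c (p + 1)) -> forall p, c p = c 0.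
Proof.
move=> cS p; rewrite -[p]natr_Zp; elim: (val p) => [|k IH] //.
by rewrite -natr1 -cS.
Qed.

Lemma V_br_uT k w p : V k w -> V k.+1 (brT w (uT p)).
Proof.
apply: (V_br brT_lie uT_cyclic) => j /andP[j0 _].
exact: (word_stepP brT_lie uT_cyclic).
Qed.

(** Induction on length. A top part can remain only in a length divisible by [N], where it is a
    multiple of the sum [S] of all words. Bracketing [w] with a generator then gives a vanishing
    element of the same shape, and subtracting a multiple of [w] makes it shorter. So [w.2] is an
    eigenvector of every [ad (U p)], and [eigen_eq0] applies. *)
Lemma graph_inj_V k w : V k w -> vanishes w -> w.2 = 0.
Proof.
elim: k w => [|k IH] w Vw w0.
  apply: central_eq0 => [p|]; last by apply: lie_gen_trace; exists 0.
  have [c wc] : exists c, brT w (uT p) = c *: uT p.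
    apply: (Vw (fun w => exists c, brT w (uT p) = c *: uT p)).
      split=> [|x y [c Hx] [c' Hy]|a x [c Hx]].
      - by exists 0; rewrite (br0l brT_lie) scale0r.
      - by exists (c + c'); rewrite (brDl brT_lie) Hx Hy scalerDl.
      - by exists (a * c); rewrite (brZl brT_lie) Hx scalerA.
    move=> g [j [q [+ ->]]]; rewrite leqn0 => /eqP -> /=.
    by exists (wcoef K nu (p - q)); apply: (cyc_h uT_cyclic).
  suff c0 : c = 0 by have /(congr1 (fun x : T => x.2)) := wc; rewrite c0 scale0r.
  have := vanishes_br (uT p) w0 (oner_neq0 K); rewrite wc.
  rewrite -[LHS]/(c *: gen nu 1 p) /gen /twist invr1 !scale1r => /matrixP/(_ p (p + 1)).
  rewrite !mxE !eqxx /=.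
  have /negPf -> : p != p + 1 + nu by zany.
  by rewrite /= subr0 mulr1.
have [c [Vw' cE]] := top_coef Vw w0.
have [k0|k0] := eqVneq (k.+1%:R : I) 0; last first.
  move: Vw'; rewrite big1 ?subr0 => [|p _]; first by move/IH; apply.
  by rewrite cE (negPf k0) mul0r scale0r.
rewrite k0 eqxx in cE.
have cc : forall p, c p = c 0 by apply: const_coef => p; rewrite {1}cE mul1r.
move: Vw'; set S := \sum_p wd k.+1 p.
have sumS (c' : I -> K) : (forall p, c' p = c' 0) -> \sum_p c' p *: wd k.+1 p = c' 0 *: S.
  by move=> c'c; rewrite scaler_sumr; apply: eq_bigr => p _; rewrite c'c.
rewrite sumS // => Vw'.
have [c0|c0] := eqVneq (c 0) 0; first by move: Vw'; rewrite c0 scale0r subr0 => /IH; apply.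
apply: eigen_eq0 => [p|]; last by apply: lie_gen_trace; exists k.+1.
set w1 := brT w (uT p); have w10 : vanishes w1 := vanishes_br (uT p) w0.
(* The bracket has length at most [k.+2], which is [1] in [Z/N]; there a vanishing element has no
   top part. *)
have Vw1 : V k.+1 w1.
  have [c1 [Vw1 c1E]] := top_coef (V_br_uT p Vw) w10.
  move: Vw1; rewrite big1 ?subr0 // => q _.
  by rewrite c1E -natr1 k0 add0r (negPf I1) mul0r scale0r.
have [c2 [Vw2 c2E]] := top_coef Vw1 w10.
rewrite k0 eqxx in c2E; exists (c2 0 / c 0).
have Vw3 : V k (w1 - (c2 0 / c 0) *: w).
  rewrite sumS in Vw2; last by apply: const_coef => q; rewrite {1}c2E mul1r.
  have := subspaceB (V_subspace _ _ _ k) Vw2 (subspaceZ (V_subspace _ _ _ k) (c2 0 / c 0) Vw').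
  by rewrite scalerBr scalerA divfK // opprB addrA subrK.
have := IH _ Vw3 (vanishesB w10 (vanishesZ _ w0)).
by move=> /eqP; rewrite -[X in X == 0]/(mxbr w.2 (U p) - _ *: w.2) subr_eq0 => /eqP.
Qed.

Lemma graph_inj w : lie_gen brT uT hT w -> vanishes w -> w.2 = 0.
Proof. by move=> [k Vw]; apply: graph_inj_V Vw. Qed.

End Graph.

(** * Loops acting by zero *)

Section Twisted.
Variables (K : numFieldType) (r : nat).
Local Notation I := 'I_r.+2.
Local Notation M := 'M[K]_r.+2.
Local Notation W := (K -> M).
Local Notation N := r.+2.
Variable (nu : I).
Hypothesis nuD : nu + nu = 0.
Local Notation wbr := (fun_br (@mxbr K N)).

Definition entries_lau (G : {poly K}) (z : W) :=
  forall p q, lau (q - p) G (fun s => z s p q).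

Definition twisted (z : W) :=
  forall s, s != 0 -> forall p q, z s p q = - z s^-1 (q + nu) (p + nu).

Lemma entries_lau_subspace G : subspace (entries_lau G).
Proof.
split=> [p q|x y Hx Hy p q|c x Hx p q].
- by apply: lau_ext (lau0 _ G) => s _; rewrite [RHS]mxE.
- by apply: lau_ext (lauD (Hx p q) (Hy p q)) => s _; rewrite [RHS]mxE.
- by apply: lau_ext (lauZ c (Hx p q)) => s _; rewrite [RHS]mxE.
Qed.

Lemma entries_lau_br G G' z w : entries_lau G z -> entries_lau G' w ->
  entries_lau (G * G') (wbr z w).
Proof.
move=> Gz Gw p q.
have P (x y : W) H H' : entries_lau H x -> entries_lau H' y ->
    lau (q - p) (H * H') (fun s => \sum_k x s p k * y s k q).
  move=> Hx Hy; apply: lau_sum => k.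
  have := lauM (Hx p k) (Hy k q); congr (lau _ _ _); ring.
have Pwz := P _ _ _ _ Gw Gz; rewrite mulrC in Pwz.
by apply: lau_ext (lauD (P _ _ _ _ Gz Gw) (lauN Pwz)) => s _; rewrite !mxE.
Qed.

Lemma twisted_subspace : subspace twisted.
Proof.
split=> [s s0 p q|x y Hx Hy s s0 p q|c x Hx s s0 p q].
- by rewrite -[LHS]/((0 : M) p q) -[X in - X]/((0 : M) _ _) !mxE oppr0.
- rewrite -[LHS]/((x s + y s) p q) -[X in - X]/((x s^-1 + y s^-1) _ _).
  by rewrite !mxE opprD Hx // Hy.
- rewrite -[LHS]/((c *: x s) p q) -[X in - X]/((c *: x s^-1) _ _).
  by rewrite !mxE Hx // mulrN.
Qed.

Lemma twisted_br z w : twisted z -> twisted w -> twisted (wbr z w).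
Proof.
move=> Tz Tw s s0 p q; rewrite !mxE opprB.
have P (x y : W) : twisted x -> twisted y ->
    \sum_k x s p k * y s k q = \sum_k y s^-1 (q + nu) k * x s^-1 k (p + nu).
  move=> Tx Ty; rewrite [RHS](reindex_inj (addIr nu)) /=.
  by apply: eq_bigr => k _; rewrite Tx // Ty // mulrNN mulrC.
by rewrite (P _ _ Tz Tw) (P _ _ Tw Tz).
Qed.

Lemma twisted_ext z w : twisted z -> (forall s, s != 0 -> z s = w s) -> twisted w.
Proof. by move=> Tz zw s s0 p q; rewrite -!zw ?invr_eq0 // Tz. Qed.

Lemma twisted_gen p : twisted (fun s => gen nu s p).
Proof.
move=> s s0 i j; rewrite /gen /twist !mxE invrK opprB.
rewrite !(inj_eq (addIr nu)) !(eq_addnu nuD) (andbC (j == p + 1)) (andbC (j == p + nu)).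
by [].
Qed.

Lemma entries_lau_gen p : entries_lau 1 (fun s => gen nu s p).
Proof.
move=> i j; pose b1 := (i == p) && (j == p + 1).
pose b2 := (i == p + 1 + nu) && (j == p + nu).
have l1 : lau (j - i) 1 (fun s : K => b1%:R * s).
  rewrite /b1; case: andP => [[/eqP-> /eqP->]|_].
    have -> : p + 1 - p = 1 by ring.
    by apply: lauZ; apply: lau_ext (lau_exp K r 1) => s _; rewrite expr1.
  by apply: lau_ext (lau0 _ _) => s _; rewrite mul0r.
have l2 : lau (j - i) 1 (fun s : K => b2%:R * s^-1).
  rewrite /b2; case: andP => [[/eqP-> /eqP->]|_].
    have -> : p + nu - (p + 1 + nu) = - 1 by ring.
    by apply: lauZ; apply: lau_invs.
  by apply: lau_ext (lau0 _ _) => s _; rewrite mul0r.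
apply: lau_ext (lauD l1 (lauN l2)) => s _.
by rewrite /gen /twist !mxE ![_ * s]mulrC ![_ * s^-1]mulrC.
Qed.

(** An upper bound for the loops that the generators produce. *)
Lemma twisted_closed : loop_closed nu (fun z => entries_lau 1 z /\ twisted z).
Proof.
split.
- split=> [|x y [x1 x2] [y1 y2]|c x [x1 x2]]; split.
  + exact: subspace0 (entries_lau_subspace 1).
  + exact: subspace0 twisted_subspace.
  + exact: (subspaceD (entries_lau_subspace 1)).
  + exact: (subspaceD twisted_subspace).
  + exact: (subspaceZ (entries_lau_subspace 1)).
  + exact: (subspaceZ twisted_subspace).
- move=> z w [z1 z2] [w1 w2]; split; last exact: twisted_br.
  by have := entries_lau_br z1 w1; rewrite mulr1.
- move=> z w [z1 z2] zw; split; last exact: twisted_ext z2 zw.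
  by move=> p q; apply: lau_ext (z1 p q) => s s0; rewrite zw.
- by move=> p; split; [apply: entries_lau_gen|apply: twisted_gen].
Qed.

(** Each entry is counted at its own position and at the image under the involution. *)
Lemma twisted_expand z s : twisted z -> s != 0 ->
  \sum_p \sum_q xf nu p q (fun s => z s p q) s = 2%:R *: z s.
Proof.
move=> Tz s0; apply/matrixP => i j; rewrite summxE.
under eq_bigr => p _ do rewrite summxE.
have E p q : xf nu p q (fun s => z s p q) s i j =
  z s p q * ((i == p) && (j == q))%:R
  - z s^-1 p q * ((p == j + nu) && (q == i + nu))%:R.
  rewrite /xf /twist !mxE -(eq_addnu nuD p j) -(eq_addnu nuD q i).
  by rewrite (eq_sym (p + nu)) (eq_sym (q + nu)) (andbC (j == _)).
under eq_bigr => p _ do under eq_bigr => q _ do rewrite E.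
under eq_bigr => p _ do rewrite sumrB.
rewrite sumrB (bigD1 i) //= [X in _ + X - _]big1 => [|p /negPf pi]; last first.
  by apply: big1 => q _; rewrite eq_sym pi mulr0.
rewrite (bigD1 j) //= big1 => [|q /negPf qj]; last first.
  by rewrite eq_sym qj andbF mulr0.
rewrite (bigD1 (j + nu)) //= [X in _ - (_ + X)]big1 => [|p /negPf pj]; last first.
  by apply: big1 => q _; rewrite pj mulr0.
rewrite (bigD1 (i + nu)) //= big1 => [|q /negPf qi]; last first.
  by rewrite qi andbF mulr0.
by rewrite !eqxx !mulr1 !addr0 mxE mulr_natl mulr2n [in X in _ = _ + X]Tz.
Qed.

End Twisted.

(** * The annihilator of an irreducible module *)

Section Annihilator.
Variables (K : numClosedFieldType) (r : nat).
Local Notation I := 'I_r.+2.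
Local Notation M := 'M[K]_r.+2.
Local Notation N := r.+2.
Local Notation W := (K -> M).
Variable (nu : I).
Hypotheses (nuD : nu + nu = 0) (nu0 : nu != 0) (nu1 : nu != 1) (num1 : nu != - 1)
  (nu2 : nu != 2%:R) (num2 : nu != - 2%:R).
Hypotheses (I1 : (1 : I) != 0) (I2 : (2%:R : I) != 0) (I3 : (3%:R : I) != 0)
  (I4 : (4%:R : I) != 0).
Variables (d : nat) (U Ud : I -> 'M[K]_d).
Hypothesis RU : cyclic_rel (@mxbr K d) nu (wcoef K nu) U Ud.
Hypothesis irr : irreducible_ops (fun A => exists p, A = U p).

Local Notation brT := (@brT K r d).
Local Notation uT := (uT nu U).
Local Notation hT := (hT nu Ud).
Local Notation P := (lie_gen brT uT hT).
Local Notation wbr := (fun_br (@mxbr K N)).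

Let LT : lie_bracket brT := brT_lie K r d.
Let RT : cyclic_rel brT nu (wcoef K nu) uT hT.
Proof. exact: uT_cyclic. Qed.
Let PS : subspace P. Proof. exact: lie_gen_subspace. Qed.
Let Pbr x y : P x -> P y -> P (brT x y). Proof. exact: (lie_gen_br LT RT). Qed.
Let Pu p : P (uT p). Proof. exact: lie_gen_u. Qed.

Definition lifts (z : W) := exists w, P w /\ forall s, s != 0 -> w.1 s = z s.
(** An ideal of [lifts]. A loop is asked to have one lift with operator 0; by [killed_eq0], all its
    lifts then have operator 0. *)
Definition killed (z : W) :=
  exists w, P w /\ (forall s, s != 0 -> w.1 s = z s) /\ w.2 = 0.

Lemma lifts_closed : loop_closed nu lifts.
Proof.
split.
- split=> [|x y [w [Pw wx]] [w' [Pw' wy]]|c x [w [Pw wx]]].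
  + by exists 0; split=> //; apply: (subspace0 PS).
  + exists (w + w'); split=> [|s s0]; first exact: (subspaceD PS).
    by rewrite -[LHS]/(w.1 s + w'.1 s) wx // wy.
  + exists (c *: w); split=> [|s s0]; first exact: (subspaceZ PS).
    by rewrite -[LHS]/(c *: w.1 s) wx.
- move=> x y [w [Pw wx]] [w' [Pw' wy]]; exists (brT w w'); split; first exact: Pbr.
  by move=> s s0; rewrite -[LHS]/(mxbr (w.1 s) (w'.1 s)) wx // wy.
- move=> x y [w [Pw wx]] xy; exists w; split=> // s s0.
  by rewrite wx // xy.
- by move=> p; exists (uT p).
Qed.

Lemma killed_subspace : subspace killed.
Proof.
split=> [|x y [w [Pw [wx w0]]] [w' [Pw' [wy w'0]]]|c x [w [Pw [wx w0]]]].
- by exists 0; split=> //; apply: (subspace0 PS).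
- exists (w + w'); split; [exact: (subspaceD PS)|split=> [s s0|]].
    by rewrite -[LHS]/(w.1 s + w'.1 s) wx // wy.
  by rewrite -[LHS]/(w.2 + w'.2) w0 w'0 addr0.
- exists (c *: w); split; [exact: (subspaceZ PS)|split=> [s s0|]].
    by rewrite -[LHS]/(c *: w.1 s) wx.
  by rewrite -[LHS]/(c *: w.2) w0 scaler0.
Qed.

Lemma killed_br z w : killed z -> lifts w -> killed (wbr z w).
Proof.
move=> [x [Px [xz x0]]] [y [Py yw]]; exists (brT x y); split; first exact: Pbr.
split=> [s s0|]; first by rewrite -[LHS]/(mxbr (x.1 s) (y.1 s)) xz // yw.
by rewrite -[LHS]/(mxbr x.2 y.2) x0 (br0l (mxbr_lie _ _)).
Qed.

Lemma killed_ext z w : killed z -> (forall s, s != 0 -> z s = w s) -> killed w.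
Proof. by move=> [x [Px [xz x0]]] zw; exists x; do 2!split=> //; move=> s s0; rewrite xz // zw. Qed.

Lemma killed_eq0 w : P w -> killed w.1 -> w.2 = 0.
Proof.
move=> Pw [x [Px [xw x0]]].
have := graph_inj nuD nu0 nu1 num1 I1 I2 I3 I4 RU irr (w := w - x).
rewrite -[(w - x).2]/(w.2 - x.2) x0 subr0; apply; first exact: (subspaceB PS).
by move=> s s0; rewrite -[LHS]/(w.1 s - x.1 s) xw // subrr.
Qed.

(** The loops with coefficients [s^(1 + N m)], for [m] from 0 to [d * d], have lifts whose operators
    live in dimension [d * d]. The coefficients of a linear relation between these operators are
    those of [g]. *)
Lemma killed_exists : exists2 g : {poly K}, g != 0 &
  killed (xf nu 0 1 (fun s => s ^+ 1 * g.[s ^+ N])).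
Proof.
have lift m : lifts (xf nu 0 1 (fun s => s ^+ (1 + N * m))).
  have := xf_pow nuD nu1 num1 num2 I1 I2 lifts_closed (k := 1 + N * m) 0 isT.
  rewrite natrD natrM Zp_natN mul0r addr0 add0r; apply.
  by rewrite /short I1 eq_sym nu1.
have [w wP] := choice lift.
pose D := (d * d)%N.
pose Y : 'M[K]_(D.+1, D) := \matrix_(i < D.+1) mxvec (w i).2.
have /rowV0Pn[v vK v0] : kermx Y != 0.
  rewrite -mxrank_eq0 mxrank_ker subn_eq0 -ltnNge ltnS; exact: rank_leq_col.
have vY : \sum_(i < D.+1) v 0 i *: (w i).2 = 0.
  move/sub_kermxP: vK => vY; apply: (can_inj mxvecK); rewrite linear0 -[RHS]vY.
  rewrite linear_sum /= mulmx_sum_row; apply: eq_bigr => i _.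
  by rewrite rowK linearZ.
exists (rVpoly v).
  apply: contraNneq v0 => /(congr1 (poly_rV (d := D.+1))).
  by rewrite rVpolyK linear0 => ->.
exists (\sum_(i < D.+1) v 0 i *: w i); split.
  by apply: (subspace_sum PS) => i _; apply: (subspaceZ PS); case: (wP i).
split=> [s s0|]; last first.
  by rewrite (big_morph (fun x : W * 'M[K]_d => x.2) (id1 := 0) (op1 := +%R)).
rewrite (big_morph (fun x : W * 'M[K]_d => x.1 s) (id1 := 0) (op1 := +%R)) //.
transitivity (\sum_(i < D.+1) v 0 i *: xf nu 0 1 (fun s => s ^+ (1 + N * i)) s).
  by apply: eq_bigr => i _; rewrite -[LHS]/(v 0 i *: (w i).1 s); case: (wP i) => _ ->.
have E t : t ^+ 1 * (rVpoly v).[t ^+ N] = \sum_(i < D.+1) v 0 i * t ^+ (1 + N * i).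
  rewrite horner_poly mulr_sumr; apply: eq_bigr => i _.
  by rewrite insubT // => lti; rewrite exprD exprM mulrCA; congr (v 0 _ * _); apply: val_inj.
transitivity (xf nu 0 1 (fun t => \sum_(i < D.+1) v 0 i * t ^+ (1 + N * i)) s).
  rewrite xf_sum fct_sumE; apply: eq_bigr => i _.
  by rewrite xfZ.
by rewrite /xf !E.
Qed.

Lemma lie_gen_twisted w : P w -> entries_lau 1 w.1 /\ twisted nu w.1.
Proof.
have [TS Tbr _ Tg] := twisted_closed K nuD.
apply: (lie_gen_min RT (S := fun w => entries_lau 1 w.1 /\ twisted nu w.1)) => //.
- split=> [|x y Hx Hy|c x Hx].
  + exact: (subspace0 TS).
  + exact: (subspaceD TS Hx Hy).
  + exact: (subspaceZ TS c Hx).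
- by move=> x y Hx Hy; apply: Tbr.
Qed.

(** By spreading, the loops at short positions are killed. The others move to short positions under
    a bracket with any generator. Hence [w.2] commutes with all [U t], and having trace 0 it is
    0. *)
Lemma killed_of_divisible (g : {poly K}) :
  killed (xf nu 0 1 (fun s => s ^+ 1 * g.[s ^+ N])) ->
  forall w, P w -> entries_lau g w.1 -> w.2 = 0.
Proof.
move=> Kg w Pw Gw.
have spread p q a : short nu (q - p) -> lau (q - p) g a -> killed (xf nu p q a).
  apply: (ideal_spread nuD nu1 num1 nu2 num2 I1 I2 lifts_closed killed_subspace
    killed_br killed_ext (g := g) (p0 := 0) (q0 := 1)).
    by exists 1%N; rewrite ?subr0.
  by rewrite subr0 short1.
have KS := killed_subspace.
have term p q t a : lau (q - p) g a ->
    killed (wbr (xf nu p q a) (fun s => gen nu s t)).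
  move=> la; have [spq|nspq] := boolP (short nu (q - p)).
    apply: killed_br (spread _ _ _ spq la) _.
    exact: (lc_gen lifts_closed).
  have lp : lau (q - p + 1) g (fun s => a s * s).
    have := lauM la (lau_exp K r 1); rewrite mulr1; apply: lau_ext => s _.
    by rewrite expr1.
  have lm : lau (q - p - 1) g (fun s => a s * s^-1).
    by have := lauM la (lau_invs K r); rewrite mulr1.
  have sp : short nu (q - p + 1).
    move: nspq; rewrite /short negb_and !negbK => /orP[] /eqP ->.
      by rewrite add0r I1 eq_sym nu1.
    by apply/andP; split; zany.
  have sm : short nu (q - p - 1).
    move: nspq; rewrite /short negb_and !negbK => /orP[] /eqP ->.
      by apply/andP; split; zany.
    by apply/andP; split; zany.
  have cond (b : bool) p' q' (e : I) c : lau e g c -> short nu e ->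
      (b -> q' - p' = e) -> killed (b%:R *: xf nu p' q' c).
    move=> lc se; case: b => [H|_]; last by rewrite scale0r; apply: (subspace0 KS).
    by rewrite scale1r; apply: spread; rewrite H.
  have B1 : killed ((q == t)%:R *: xf nu p (t + 1) (fun s => a s * s)).
    by apply: cond lp sp _ => /eqP ->; ring.
  have B2 : killed ((t + 1 == p)%:R *: xf nu t q (fun s => a s * s)).
    by apply: cond lp sp _ => /eqP <-; ring.
  have B3 : killed ((q == t + 1 + nu)%:R *: xf nu p (t + nu) (fun s => a s * s^-1)).
    by apply: cond lm sm _ => /eqP ->; ring.
  have B4 : killed ((t + nu == p)%:R *: xf nu (t + 1 + nu) q (fun s => a s * s^-1)).
    by apply: cond lm sm _ => /eqP <-; ring.
  apply: killed_ext (subspaceD KS (subspaceB KS (subspaceB KS B1 B2) B3) B4) _.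
  move=> s s0; rewrite /fun_br /gen /xf twist_br //.
  rewrite -[LHS]/((q == t)%:R *: twist nu p (t + 1) (a s * s) (a s^-1 * s^-1)
    - (t + 1 == p)%:R *: twist nu t q (a s * s) (a s^-1 * s^-1)
    - (q == t + 1 + nu)%:R *: twist nu p (t + nu) (a s / s) (a s^-1 / s^-1)
    + (t + nu == p)%:R *: twist nu (t + 1 + nu) q (a s / s) (a s^-1 / s^-1)).
  by rewrite invrK.
have tr_w : \tr w.2 = 0 by apply: (lie_gen_trace nuD nu0 num1 I1 RU Pw).
apply: (central_eq0 irr) => // t.
have := killed_eq0 (Pbr Pw (Pu t)); apply.
have [_ Tw] := lie_gen_twisted Pw.
have Ksum : killed (\sum_p \sum_q wbr (xf nu p q (fun s => w.1 s p q)) (fun s => gen nu s t)).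
  by apply: (subspace_sum KS) => p _; apply: (subspace_sum KS) => q _; apply: term.
have := subspaceZ KS (2%:R^-1) Ksum; move/killed_ext; apply=> s s0.
have L := fun_br_lie K (mxbr_lie K N).
rewrite -[LHS]/(2%:R^-1 *: (\sum_p \sum_q _) s).
under eq_bigr => p _ do rewrite -(br_suml L).
rewrite -(br_suml L) /fun_br fct_sumE.
under eq_bigr => p _ do rewrite fct_sumE.
rewrite (twisted_expand nuD) // -(brZl (mxbr_lie K N)) scalerA mulVf ?scale1r //.
by rewrite pnatr_eq0.
Qed.

Lemma dvdp_radical (F : closedFieldType) (g R : {poly F}) :
  g != 0 -> (forall t, root g t -> root R t) -> exists k, g %| R ^+ k.
Proof.
move=> g0 gR; have [rs gE] := closed_field_poly_normal g.
have rsR : all (root R) rs.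
  apply/allP => z zrs; apply: gR; rewrite gE rootZ ?lead_coef_eq0 //.
  by rewrite root_prod_XsubC.
exists (size rs); rewrite gE dvdpZl ?lead_coef_eq0 //.
elim: rs rsR {gE} => [_|z rs IH /= /andP[Rz /IH]]; first by rewrite big_nil dvd1p.
by rewrite big_cons exprS; apply: dvdp_mul; rewrite dvdp_XsubCl.
Qed.

(** The factor ['X] is harmless because [s^N] is invertible among Laurent polynomials. *)
Lemma lau_dvdp (e : I) (g R : {poly K}) k a : g %| (R * 'X) ^+ k ->
  lau e (R ^+ k) a -> lau e g a.
Proof.
move=> /dvdpP[h hE] [m [f aE]]; exists (m + k)%N, (h * f) => s s0.
have -> : g * (h * f) = (R * 'X) ^+ k * f by rewrite hE; ring.
rewrite mulnDr (exprD s (N * m)) mulrA aE // exprMn !hornerM hornerXn.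
by rewrite -exprM; ring.
Qed.

(** Loops vanishing at the given points are divisible by the product [R] over the distinct nonzero
    roots of [g]. A bracket adds exponents of [R], so the levels [R^(2^j)] form a solvable chain,
    which ends once [g] divides up to a power of ['X]. *)
Lemma vanishing_kernel : exists2 g : {poly K}, g != 0 &
  forall ss : seq K,
    (forall t, t != 0 -> root g t -> exists s, [/\ s \in ss, s != 0 &
       t = s ^+ N \/ t = s^-1 ^+ N]) ->
  forall w, P w -> (forall s, s \in ss -> w.1 s = 0) -> w.2 = 0.
Proof.
have [g g0 Kg] := killed_exists; exists g => // ss Hss w Pw w0.
have [rs gE] := closed_field_poly_normal g.
pose rts := undup [seq t <- rs | t != 0].
have rootE t : root g t = (t \in rs).
  by rewrite gE rootZ ?lead_coef_eq0 // root_prod_XsubC.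
pose R : {poly K} := \prod_(t <- rts) ('X - t%:P).
have [k gk] : exists k, g %| (R * 'X) ^+ k.
  apply: dvdp_radical => // t gt; rewrite rootM.
  have [->|t0] := eqVneq t 0; first by rewrite rootX eqxx orbT.
  by rewrite root_prod_XsubC mem_undup mem_filter t0 -rootE gt.
(* The exponent is raised to a power of 2 to match the doubling along brackets. *)
have {}gk : g %| (R * 'X) ^+ (2 ^ k).
  by apply: dvdp_trans gk _; apply: dvdp_exp2l; apply/ltnW/ltn_expl.
pose D j (x : 'M[K]_d) := exists w, [/\ P w, w.2 = x & entries_lau (R ^+ (2 ^ j)) w.1].
apply: (@solvable_ideal_eq0 _ _ _ irr D k); last 1 first.
- exists w; split=> // p q; have [/(_ p q)[m [f aE]] Tw] := lie_gen_twisted Pw.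
  have Rf : R %| f.
    apply: uniq_roots_dvdp; last first.
      by rewrite uniq_rootsE undup_uniq.
    apply/allP => t; rewrite mem_undup mem_filter -rootE => /andP[t0 gt].
    have [s [sss s0 st]] := Hss t t0 gt.
    (* If only [1/s] lies over the root [t], the twist carries the vanishing from [s] to [1/s]. *)
    have {st} [s' s'0 [z0 ->]] : exists2 s', s' != 0 & w.1 s' = 0 /\ t = s' ^+ N.
      case: st => ->; first by exists s => //; rewrite w0.
      exists s^-1; rewrite ?invr_eq0 //; split=> //; apply/matrixP => i j.
      by rewrite Tw ?invr_eq0 // invrK w0 // !mxE oppr0.
    have := aE s' s'0; rewrite z0 mxE mul0r mul1r => /esym/eqP.
    by rewrite mulf_eq0 expf_eq0 (negPf s'0) andbF.
  have /dvdpP[f' fE] := Rf; exists m, f' => s s0.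
  by rewrite aE // mul1r fE (mulrC f') expn0 expr1.
- move=> j x y [v [Pv <- Dv]] [v' [Pv' <- Dv']]; exists (brT v v'); split=> //.
    exact: Pbr.
  by have := entries_lau_br Dv Dv'; rewrite -exprD addnn -mul2n -expnS.
- move=> j x A [v [Pv <- Dv]] [p ->]; exists (brT v (uT p)); split=> //.
    exact: Pbr.
  by have := entries_lau_br Dv (entries_lau_gen K nu p); rewrite mulr1.
- move=> j x [v [Pv <- _]]; exact: (lie_gen_trace nuD nu0 num1 I1 RU Pv).
- move=> x [v [Pv <- Dv]]; apply: (killed_of_divisible Kg) => // p q.
  exact: lau_dvdp gk (Dv p q).
Qed.

End Annihilator.

(** * Cyclic form of the relations *)

Section Index.
Variable m : nat.
Local Notation n := m.+3.
(* [rk.+2] is convertible to [n + n] and has the shape required by the ring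
   structure on ['I_rk.+2]. *)
Definition rk := (m + m.+3).+1.
Local Notation I := 'I_rk.+2.
Definition nun : I := n%:R.

Lemma I_natE (a b : nat) : (a < n + n)%N -> (b < n + n)%N ->
  (a%:R == b%:R :> I) = (a == b).
Proof.
move=> aN bN; rewrite !Zp_nat -val_eqE /= !modn_small //.
Qed.

Lemma I_nat_neq0 a : (0 < a < n + n)%N -> (a%:R : I) != 0.
Proof.
by move=> /andP[a0 aN]; rewrite -[0]/(0%:R : I) I_natE // -lt0n.
Qed.

Lemma nunD : nun + nun = 0.
Proof. by rewrite -natrD; apply: (Zp_natN rk). Qed.
Lemma nun_neq0 : nun != 0. Proof. by apply: I_nat_neq0; lia. Qed.
Lemma nun_neq1 : nun != 1.
Proof. by rewrite -[1]/(1%:R : I) I_natE //; lia. Qed.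
Lemma nun_neq2 : nun != 2%:R.
Proof. by rewrite I_natE //; lia. Qed.
Lemma nun_neqm1 : nun != - 1.
Proof.
rewrite -subr_eq0 opprK -[1]/(1%:R : I) -natrD; apply: I_nat_neq0; lia.
Qed.
Lemma nun_neqm2 : nun != - 2%:R.
Proof. by rewrite -subr_eq0 opprK -natrD; apply: I_nat_neq0; lia. Qed.
Lemma I_1 : (1 : I) != 0. Proof. by []. Qed.
Lemma I_2 : (2%:R : I) != 0. Proof. by apply: I_nat_neq0; lia. Qed.
Lemma I_3 : (3%:R : I) != 0. Proof. by apply: I_nat_neq0; lia. Qed.
Lemma I_4 : (4%:R : I) != 0. Proof. by apply: I_nat_neq0; lia. Qed.

Definition idx (i : 'I_n) : I := (val i)%:R.

(** Stated with informative sums, so that [glue] can be defined by matching on it. *)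
Lemma idx_cases (p : I) : {i | p = idx i} + {i | p = idx i + nun}.
Proof.
have [pn|np] := ltnP p n.
  by left; exists (Ordinal pn); rewrite /idx /= natr_Zp.
have pn : (p - n < n)%N by have := ltn_ord p; rewrite /rk; lia.
by right; exists (Ordinal pn); rewrite /idx /= -natrD subnK // natr_Zp.
Qed.

Lemma idx_eq i j : (idx i == idx j) = (i == j).
Proof. by rewrite I_natE // (leq_trans (ltn_ord _)) // leq_addr. Qed.

Lemma idx_neq_nun i j : (idx i == idx j + nun) = false.
Proof.
case: i j => i li [j lj]; rewrite /idx /= -natrD I_natE; lia.
Qed.

Variable K : numFieldType.
Local Notation wc := (wcoef K nun).

Lemma wcoefD x : wc (x + nun) = - wc x.
Proof.
have D := nunD; rewrite /wcoef.
have -> : (x + nun == 0) = (x == - nun) by eqz.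
have -> : (x + nun == 1) = (x == 1 - nun) by eqz.
have -> : (x + nun == - 1) = (x == - 1 - nun) by eqz.
have -> : (x + nun == - nun) = (x == 0) by eqz.
have -> : (x + nun == 1 - nun) = (x == 1) by eqz.
have -> : (x + nun == - 1 - nun) = (x == - 1) by eqz.
ring.
Qed.

(** The two corner entries 1 of [M_n] are at differences [n - 1] and [1 - n]: a single step up to
    the half turn [nu], which reverses the sign of the weight. *)
Lemma wcoef_Mn i j : wc (idx j - idx i) = (Mn i j)%:~R.
Proof.
have D := nunD; rewrite /wcoef /idx; case: i j => i li [j lj] /=.
have E1 : (j%:R - i%:R == 0 :> I) = (i == j).
  by rewrite subr_eq0 I_natE ?(eq_sym j) //; lia.
have E2 : (j%:R - i%:R == 1 :> I) = (i.+1 == j :> nat).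
  by rewrite subr_eq addrC natr1 I_natE ?(eq_sym j) //; lia.
have E3 : (j%:R - i%:R == - 1 :> I) = (j.+1 == i :> nat).
  have -> : (j%:R - i%:R == - 1 :> I) = (j%:R + 1 == i%:R :> I) by eqz.
  by rewrite natr1 I_natE //; lia.
have E4 : (j%:R - i%:R == - nun :> I) = false.
  have -> : (j%:R - i%:R == - nun :> I) = (j%:R + nun == i%:R :> I) by eqz.
  by rewrite -natrD I_natE; lia.
have E5 : (j%:R - i%:R == 1 - nun :> I) = ((j == 0 :> nat) && (i == n.-1 :> nat)).
  have -> : (j%:R - i%:R == 1 - nun :> I) = (j%:R + nun == i%:R + 1 :> I) by eqz.
  by rewrite natr1 -natrD I_natE /=; lia.
have E6 : (j%:R - i%:R == - 1 - nun :> I) = ((i == 0 :> nat) && (j == n.-1 :> nat)).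
  have -> : (j%:R - i%:R == - 1 - nun :> I) = (j%:R + 1 == i%:R + nun :> I) by eqz.
  by rewrite natr1 -natrD I_natE /=; lia.
rewrite E1 E2 E3 E4 E5 E6 /Mn /= -val_eqE /=.
have [ij|ij] := eqVneq i j.
  have -> : (i.+1 == j :> nat) = false by rewrite ij; lia.
  have -> : (j.+1 == i :> nat) = false by rewrite ij; lia.
  have -> : (j == 0 :> nat) && (i == n.-1 :> nat) = false by rewrite ij; lia.
  have -> : (i == 0 :> nat) && (j == n.-1 :> nat) = false by rewrite ij; lia.
  by rewrite /= mulr0n mul0rn !subr0 !addr0.
have [e2|e2] := eqVneq (i.+1) j.
  have -> : (j.+1 == i :> nat) = false by lia.
  have -> : (j == 0 :> nat) && (i == n.-1 :> nat) = false by lia.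
  have -> : (i == 0 :> nat) && (j == n.-1 :> nat) = false by lia.
  by rewrite /= !mulr0n !mul0rn !subr0 !addr0 sub0r mulrNz.
have [e3|e3] := eqVneq (j.+1) i.
  have -> : (j == 0 :> nat) && (i == n.-1 :> nat) = false by lia.
  have -> : (i == 0 :> nat) && (j == n.-1 :> nat) = false by lia.
  by rewrite /= !mulr0n !mul0rn !subr0 !addr0 sub0r mulrNz.
rewrite /= !mulr0n !mul0rn !subr0 add0r.
have [e5|e5] := boolP ((j == 0) && (i == m.+2)).
  have -> : (i == 0) && (j == m.+2) = false by lia.
  by rewrite /= addr0.
by rewrite orbF /= add0r; case: (_ && _).
Qed.

Lemma Mn_cases (i j : 'I_n) : i != j -> [\/ Mn i j = 0, Mn i j = 1 | Mn i j = -1].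
Proof.
rewrite /Mn => /negPf ->; case: (_ || _); first by constructor 3.
by case: (_ || _); [constructor 2|constructor 1].
Qed.

Lemma wcoef_eqm1 (x : I) : x != 0 -> x != nun -> wc x = - 1 -> x = 1 \/ x = - 1.
Proof.
move=> x0 xn; have [->|x1] := eqVneq x 1; first by left.
have [->|xm1] := eqVneq x (- 1); first by right.
have D := nunD.
have xn' : x != - nun by znun xn.
rewrite /wcoef (negPf x0) (negPf x1) (negPf xm1) (negPf xn') /= !mulr0n !mul0rn.
rewrite !subr0 add0r => H; exfalso; move/eqP: H.
by rewrite -subr_eq0 opprK -natrD natr1 pnatr_eq0.
Qed.

Lemma wcoef_1 : wc 1 = - 1.
Proof.
have D := nunD; have H0 := nun_neq0; have H1 := nun_neqm1; have H2 := nun_neqm2.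
have H3 := I_1; have H4 := I_2.
rewrite /wcoef eqxx.
have /negPf -> : (1 : I) != 0 by [].
have /negPf -> : (1 : I) != - 1 by zany.
have /negPf -> : (1 : I) != - nun by zany.
have /negPf -> : (1 : I) != 1 - nun by zany.
have /negPf -> : (1 : I) != - 1 - nun by zany.
by rewrite /= mul0rn !subr0 !addr0 sub0r.
Qed.

Lemma wcoef_m1 : wc (- 1) = - 1.
Proof.
have D := nunD; have H0 := nun_neq0; have H1 := nun_neq1; have H2 := nun_neq2.
have H3 := I_1; have H4 := I_2.
rewrite /wcoef eqxx.
have /negPf -> : (- 1 : I) != 0 by zany.
have /negPf -> : (- 1 : I) != 1 by zany.
have /negPf -> : (- 1 : I) != - nun by zany.
have /negPf -> : (- 1 : I) != 1 - nun by zany.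
have /negPf -> : (- 1 : I) != - 1 - nun by zany.
by rewrite /= mul0rn !subr0 !addr0 sub0r.
Qed.

End Index.

(** * Translation between Chevalley and cyclic relations *)

Section GimCyclic.
Variables (m : nat) (K : numFieldType) (T : lmodType K) (br : T -> T -> T).
Hypothesis L : lie_bracket br.
Local Notation n := m.+3.
Local Notation I := 'I_(rk m).+2.
Local Notation nu := (nun m).
Local Notation wc := (wcoef K nu).

Lemma br_self x : br x x = 0.
Proof.
have := brC L x x => /eqP; rewrite -subr_eq0 opprK -mulr2n -scaler_nat scaler_eq0.
by rewrite pnatr_eq0 /= => /eqP.
Qed.

(** The two families of Serre relations in one form: a pair [e_i], [f_j] with [m_(i,j) = 1] has
    weight [- 1] and thus looks like a pair [e_i], [e_j] with [m_(i,j) = - 1]. *)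
Definition cyclic_pairs (u : I -> T) := forall p q, q != p -> q != p + nu ->
  (wc (q - p) = - 1 -> br (u p) (br (u p) (u q)) = 0) /\
  (wc (q - p) != - 1 -> br (u p) (u q) = 0).

Lemma cyclic_relP (u h : I -> T) :
  cyclic_pairs u ->
  (forall p, br (u p) (u (p + nu)) = - h p) ->
  (forall p q, br (h p) (u q) = wc (q - p) *: u q) ->
  cyclic_rel br nu wc u h.
Proof.
move=> H Hn Hh.
have D := nunD m; have H0 := nun_neq0 m; have H1 := nun_neq1 m; have H2 := nun_neqm1 m.
have H3 := I_1 m.
split=> // [p q pq qp pn|p|p].
- have [->|qp0] := eqVneq q p; first exact: br_self.
  have [_] := H p q qp0 pn; apply; apply/eqP => /wcoef_eqm1[||E|E].
  + by zneq qp0.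
  + by znun pn.
  + by case/eqP: pq; zlin E.
  + by case/eqP: qp; zlin E.
- have q1 : p != p + 1 by zneq H3.
  have q2 : p != p + 1 + nu by znun H2.
  have [+ _] := H (p + 1) p q1 q2.
  have -> : p - (p + 1) = - 1 by ring.
  rewrite (brC L (u (p + 1)) (u p)) (brNr L) (brC L) opprK; apply.
  exact: wcoef_m1.
- have q1 : p + 1 != p by zneq H3.
  have q2 : p + 1 != p + nu by zneq H1.
  have [+ _] := H p (p + 1) q1 q2.
  have -> : p + 1 - p = 1 by ring.
  rewrite (brC L (u p) (br _ _)) => /(_ (wcoef_1 m K)) /eqP.
  by rewrite oppr_eq0 => /eqP.
Qed.

Lemma cyclic_rel_pairs (u h : I -> T) : cyclic_rel br nu wc u h -> cyclic_pairs u.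
Proof.
have D := nunD m.
move=> R p q qp qn; split=> [H|H]; last first.
  apply: (cyc_comm R) => //; apply: contraNneq H => ->.
    have -> : p + 1 - p = 1 by ring.
    by rewrite wcoef_1.
  have -> : q - (q + 1) = - 1 by ring.
  by rewrite wcoef_m1.
case: (wcoef_eqm1 _ _ H) => [||E|E].
- by zneq qp.
- by znun qn.
- have -> : q = p + 1 by zlin E.
  by rewrite (brC L) (cyc_serre_l R) oppr0.
- have -> : p = q + 1 by zlin E.
  by rewrite (brC L (u (q + 1)) (u q)) (brNr L) (brC L) opprK (cyc_serre_r R).
Qed.

Section FromGim.
Variables (e f h : 'I_n -> T).
Hypothesis G : gim_rel br e f h.

Definition glue (x y : 'I_n -> T) (p : I) : T :=
  match idx_cases p with
  | inl (exist i _) => x i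
  | inr (exist i _) => y i
  end.

Lemma glue_l x y i : glue x y (idx i) = x i.
Proof.
rewrite /glue; case: (idx_cases (idx i)) => -[j /eqP].
  by rewrite idx_eq => /eqP->.
by rewrite idx_neq_nun.
Qed.

Lemma glue_r x y i : glue x y (idx i + nu) = y i.
Proof.
rewrite /glue; case: (idx_cases (idx i + nu)) => -[j /eqP].
  by rewrite eq_sym idx_neq_nun.
by rewrite (inj_eq (addIr nu)) idx_eq => /eqP->.
Qed.

Definition gim_u := glue e (fun i => - f i).
Definition gim_h := glue h (fun i => - h i).

Lemma gim_cyclic_pairs : cyclic_pairs gim_u.
Proof.
have D := nunD m; have [_ [_ [R2 R3]]] := G.
have red (i j : 'I_n) : i != j ->
  [/\ (wc (idx j - idx i) = - 1 -> br (e i) (br (e i) (e j)) = 0 /\ br (f i) (br (f i) (f j)) = 0),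
      (wc (idx j - idx i) != - 1 -> br (e i) (e j) = 0 /\ br (f i) (f j) = 0),
      (wc (idx j - idx i) = 1 -> br (e i) (br (e i) (f j)) = 0 /\ br (f i) (br (f i) (e j)) = 0) &
      (wc (idx j - idx i) != 1 -> br (e i) (f j) = 0 /\ br (f i) (e j) = 0)].
  move=> ij; rewrite wcoef_Mn; have := R2 i j ij; have := R3 i j ij.
  have n1 : (1 : K) != - 1 by rewrite -subr_eq0 opprK -mulr2n pnatr_eq0.
  case: (Mn_cases ij) => -> /=.
  - move=> _ /(_ isT)[-> [-> [-> ->]]]; split=> //=.
      by move/eqP; rewrite eq_sym oppr_eq0 oner_eq0.
    by move/eqP; rewrite eq_sym oner_eq0.
  - move=> /(_ isT)[-> [-> [-> ->]]] _; split=> //=.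
      by move/eqP; rewrite (negPf n1).
    by rewrite eqxx.
  - move=> _ /(_ isT)[-> [-> [-> ->]]]; split=> //=.
      by rewrite mulrNz eqxx.
    by rewrite mulrNz => /eqP; rewrite eq_sym (negPf n1).
have N11 (x : K) : (- x == - 1) = (x == 1) by rewrite eqr_opp.
move=> p q; case: (idx_cases p) => -[i ->]; case: (idx_cases q) => -[j ->];
  rewrite /gim_u ?glue_l ?glue_r.
- rewrite idx_eq => ji _; have [|A B _ _] := red i j; first by rewrite eq_sym.
  by split=> [/A[]|/B[]].
- rewrite (inj_eq (addIr nu)) idx_eq => _ ji; have [|_ _ A B] := red i j; first by rewrite eq_sym.
  have -> : idx j + nu - idx i = idx j - idx i + nu by ring.
  rewrite wcoefD N11; split=> [/eqP|/B[H _]]; last by rewrite (brNr L) H oppr0.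
  by rewrite N11 => /eqP/A[H _]; rewrite !(brNr L) H oppr0.
- rewrite -[idx i + nu + nu]addrA D addr0 idx_eq => _ ji.
  have [|_ _ A B] := red i j; first by rewrite eq_sym.
  have -> : idx j - (idx i + nu) = idx j - idx i + nu by znu D.
  rewrite wcoefD N11; split=> [/eqP|/B[_ H]]; last by rewrite (brNl L) H oppr0.
  by rewrite N11 => /eqP/A[_ H]; rewrite !(brNl L) (brNr L) H !oppr0.
- rewrite (inj_eq (addIr nu)) idx_eq => ji _.
  have [|A B _ _] := red i j; first by rewrite eq_sym.
  have -> : idx j + nu - (idx i + nu) = idx j - idx i by ring.
  split=> [/A[_ H]|/B[_ H]]; rewrite !(brNl L) !(brNr L).
    by rewrite H !oppr0.
  by rewrite H !oppr0.
Qed.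

Lemma gim_cyclic : cyclic_rel br nu wc gim_u gim_h.
Proof.
have D := nunD m; have [R1 [R1' _]] := G.
apply: cyclic_relP => [|p|p q].
- exact: gim_cyclic_pairs.
- rewrite /gim_u /gim_h; case: (idx_cases p) => -[i ->].
    by rewrite !glue_l glue_r (brNr L) R1'.
  rewrite -(addrA (idx i)) D addr0 !glue_r glue_l (brNl L) (brC L) R1'.
  by rewrite opprK.
- have R1e i j : br (h i) (e j) = wc (idx j - idx i) *: e j.
    by rewrite wcoef_Mn scaler_int; case: (R1 i j).
  have R1f i j : br (h i) (f j) = - (wc (idx j - idx i) *: f j).
    by rewrite wcoef_Mn scaler_int; case: (R1 i j).
  rewrite /gim_u /gim_h; case: (idx_cases p) => -[i ->]; case: (idx_cases q) => -[j ->];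
  rewrite ?glue_l ?glue_r.
  + exact: R1e.
  + have -> : idx j + nu - idx i = idx j - idx i + nu by ring.
    by rewrite wcoefD (brNr L) R1f scaleNr scalerN !opprK.
  + have -> : idx j - (idx i + nu) = idx j - idx i + nu by znu D.
    by rewrite wcoefD (brNl L) R1e scaleNr.
  + have -> : idx j + nu - (idx i + nu) = idx j - idx i by ring.
    by rewrite (brNl L) (brNr L) R1f scalerN !opprK.
Qed.

End FromGim.

Lemma cyclic_gim (u h : I -> T) : cyclic_rel br nu wc u h ->
  gim_rel br (fun i : 'I_n => u (idx i)) (fun i => - u (idx i + nu)) (fun i => h (idx i)).
Proof.
move=> R; have D := nunD m; have H := cyclic_rel_pairs R.
have n1 : (1 : K) != - 1 by rewrite -subr_eq0 opprK -mulr2n pnatr_eq0.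
have Hij i j : i != j -> idx j != idx i /\ idx j != idx i + nu.
  by move=> ij; rewrite idx_eq idx_neq_nun eq_sym.
have N11 (x : K) : (- x == - 1) = (x == 1) by rewrite eqr_opp.
have key (i j : 'I_n) : i != j ->
  [/\ ((Mn i j)%:~R = - 1 :> K -> br (u (idx i)) (br (u (idx i)) (u (idx j))) = 0 /\
         br (u (idx i + nu)) (br (u (idx i + nu)) (u (idx j + nu))) = 0),
      ((Mn i j)%:~R != - 1 :> K -> br (u (idx i)) (u (idx j)) = 0 /\
         br (u (idx i + nu)) (u (idx j + nu)) = 0),
      ((Mn i j)%:~R = 1 :> K -> br (u (idx i)) (br (u (idx i)) (u (idx j + nu))) = 0 /\
         br (u (idx i + nu)) (br (u (idx i + nu)) (u (idx j))) = 0) &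
      ((Mn i j)%:~R != 1 :> K -> br (u (idx i)) (u (idx j + nu)) = 0 /\
         br (u (idx i + nu)) (u (idx j)) = 0)].
  move=> ij; have ji : idx j != idx i by rewrite idx_eq eq_sym.
  have jin : idx j != idx i + nu by rewrite idx_neq_nun.
  have [ee1 ee2] := H _ _ ji jin.
  have jn : idx j + nu != idx i by rewrite eq_sym idx_neq_nun.
  have jnn : idx j + nu != idx i + nu by rewrite (inj_eq (addIr nu)).
  have [ef1 ef2] := H _ _ jn jnn.
  have jn2 : idx j + nu != idx i + nu + nu by rewrite (inj_eq (addIr nu)).
  have [ff1 ff2] := H _ _ jnn jn2.
  have jn3 : idx j != idx i + nu + nu by rewrite -addrA D addr0.
  have [fe1 fe2] := H _ _ jin jn3.
  have e1 : idx j + nu - idx i = idx j - idx i + nu by ring.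
  have e2 : idx j - (idx i + nu) = idx j - idx i + nu by znu D.
  have e3 : idx j + nu - (idx i + nu) = idx j - idx i by ring.
  rewrite e1 wcoefD wcoef_Mn in ef1 ef2; rewrite e2 wcoefD wcoef_Mn in fe1 fe2.
  rewrite e3 wcoef_Mn in ff1 ff2; rewrite wcoef_Mn in ee1 ee2.
  split=> M.
  - by rewrite ee1 ?ff1.
  - by rewrite ee2 ?ff2.
  - by rewrite ef1 ?fe1 // M.
  - by rewrite ef2 ?fe2 // N11.
split; [|split; [|split]] => [i j|i|i j ij|i j ij].
- rewrite -scaler_int -wcoef_Mn (cyc_h R) (brNr L) (cyc_h R).
  have -> : idx j + nu - idx i = idx j - idx i + nu by ring.
  by rewrite wcoefD scaleNr opprK -!scaler_int -wcoef_Mn scalerN opprK.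
- by rewrite (brNr L) (cyc_nu R) opprK.
- have [ee1 ee2 ef1 ef2] := key i j ij; move: ee1 ee2 ef1 ef2.
  case: (Mn_cases ij) => -> //= ee1 ee2 ef1 ef2 _; rewrite /adpow /= !(brNl L) !(brNr L).
    have [|-> ->] := ee2; first by rewrite eq_sym oppr_eq0 oner_eq0.
    have [|-> ->] := ef2; first by rewrite eq_sym oner_eq0.
    by rewrite !oppr0.
  have [|-> H1] := ee1; first by rewrite mulrNz.
  have [|-> ->] := ef2; first by rewrite mulrNz eq_sym.
  by rewrite ?(brNl L) ?(brNr L) H1 !oppr0.
- have [ee1 ee2 ef1 ef2] := key i j ij; move: ee1 ee2 ef1 ef2.
  case: (Mn_cases ij) => -> //= ee1 ee2 ef1 ef2 _; rewrite /adpow /= !(brNl L) !(brNr L).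
  have [|-> ->] := ee2; first exact: n1.
  have [//|H1 H2] := ef1.
  by rewrite ?(brNl L) ?(brNr L) H1 H2 !oppr0.
Qed.

End GimCyclic.

(** * Evaluation onto sl, sp and so *)

Section Interpolation.
Variable K : fieldType.

Lemma interpolation_point (t0 : K) (ts : seq K) : t0 \notin ts ->
  exists2 f : {poly K}, f.[t0] = 1 & forall t, t \in ts -> f.[t] = 0.
Proof.
move=> t0ts; pose g : {poly K} := \prod_(t <- ts) ('X - t%:P).
have g0 : g.[t0] != 0 by rewrite -[_ == 0]/(root g t0) root_prod_XsubC.
exists (g.[t0]^-1 *: g) => [|t tts]; first by rewrite hornerZ mulVf.
have /rootP gt : root g t by rewrite root_prod_XsubC.
by rewrite hornerZ gt mulr0.
Qed.

End Interpolation.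

(** * The symplectic and orthogonal forms behind the twist *)

Section Forms.
Variables (K : numClosedFieldType) (m : nat).
Local Notation n := m.+3.
Local Notation I := 'I_(rk m).+2.
Local Notation N := (rk m).+2.
Local Notation M := 'M[K]_N.
Local Notation nu := (nun m).
Local Notation E p q := (delta_mx p q : M).

(** The nonzero entries of [Jsp] are the [eps p], at [(p,p+nu)]. *)
Definition eps (p : I) : K := if (p < n)%N then 1 else - 1.

Lemma val_nun : val nu = n.
Proof. by rewrite /nun Zp_nat /= modn_small // /rk; lia. Qed.

Lemma val_addnu (p : I) : val (p + nu) = if (p < n)%N then (p + n)%N else (p - n)%N.
Proof.
have -> : val (p + nu) = ((p + n) %% N)%N by rewrite -[in RHS]val_nun.
have key x : (x < N)%N -> ((x + n) %% N)%N = if (x < n)%N then (x + n)%N else (x - n)%N.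
  rewrite /rk; case: (ltnP x n) => xn xN; first by rewrite modn_small //; lia.
  have -> : (x + n = (x - n) + (m + m.+3).+3)%N by lia.
  by rewrite modnDr modn_small //; lia.
exact: key (ltn_ord p).
Qed.

Lemma eps_addnu p : eps (p + nu) = - eps p.
Proof.
rewrite /eps val_addnu; move: (ltn_ord p); move: (nat_of_ord p) => x.
rewrite /rk => xN; case: (ltnP x n) => xn; first by rewrite ltnNge leq_addl.
have -> : (x - n < n)%N by lia.
by rewrite opprK.
Qed.

Lemma eps_sqr p : eps p * eps p = 1.
Proof. by rewrite /eps; case: ifP; rewrite ?mulrNN mulr1. Qed.

Lemma eps_neq0 p : eps p != 0.
Proof. by rewrite /eps; case: ifP; rewrite ?oppr_eq0 oner_eq0. Qed.

Lemma block_antidiag (x y : K) (p q : I) :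
  (block_mx 0 x%:M y%:M 0 : 'M[K]_(n + n)) p q =
  (if (p < n)%N then x else y) * (q == p + nu)%:R.
Proof.
rewrite -val_eqE val_addnu; have lp := ltn_ord p; have lq := ltn_ord q.
rewrite /block_mx !mxE.
case: splitP => i pi; rewrite !mxE; case: splitP => j qj; rewrite !mxE.
- have -> : (p < n)%N by rewrite [nat_of_ord p]pi.
  have -> : (val q == p + n)%N = false.
    by rewrite [val q]qj [nat_of_ord p]pi; have := ltn_ord j; lia.
  by rewrite mulr0.
- have -> : (p < n)%N by rewrite [nat_of_ord p]pi.
  have -> : (val q == p + n)%N = (i == j) by rewrite [val q]qj [nat_of_ord p]pi -val_eqE /=; lia.
  by rewrite mulr_natr.
- have -> : (p < n)%N = false by rewrite [nat_of_ord p]pi; lia.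
  have -> : (val q == p - n)%N = (i == j) by rewrite [val q]qj [nat_of_ord p]pi -val_eqE /=; lia.
  by rewrite mulr_natr.
- have -> : (p < n)%N = false by rewrite [nat_of_ord p]pi; lia.
  have -> : (val q == p - n)%N = false.
    by rewrite [val q]qj [nat_of_ord p]pi; have := ltn_ord i; lia.
  by rewrite mulr0.
Qed.

Definition diagp (z : K) : M := diag_mx (\row_(p < N) z ^+ val p).

Lemma diagpV (z : K) : z != 0 -> diagp z *m diagp z^-1 = 1%:M.
Proof.
move=> z0; rewrite mulmx_diag; apply/matrixP => i j; rewrite !mxE.
by rewrite exprVn divff ?expf_neq0.
Qed.

Lemma diagp_delta z p q : diagp z *m E p q *m diagp z^-1 = (z ^+ val p * z^-1 ^+ val q) *: E p q.
Proof.
apply/matrixP => i j; rewrite mul_mx_diag mul_diag_mx !mxE.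
by have [->|_] := eqVneq i p; have [->|_] := eqVneq j q; rewrite /= ?mulr0 ?mul0r //; ring.
Qed.

(** Adding [nu] to an index in [Z/N] adds [n] to its value or subtracts it; the sides differ by a
    factor [z^N = - 1] exactly when [p] and [q] lie in different halves. *)
Lemma eps_shift (z : K) (p q : I) : z ^+ N = - 1 ->
  z ^+ (val (q + nu) + val p) = eps p * eps q * z ^+ (val (p + nu) + val q).
Proof.
rewrite /eps !val_addnu; move: (ltn_ord p) (ltn_ord q).
rewrite -[nat_of_ord p]/(val p) -[nat_of_ord q]/(val q).
move: (val p) (val q) => x y; rewrite {1 2}/rk => xN yN zN.
case: (ltnP x n) => xn; case: (ltnP y n) => yn.
- by rewrite !mul1r; congr (_ ^+ _); lia.
- rewrite mul1r; have -> : (x + n + y = (y - n + x) + N)%N by rewrite /rk; lia.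
  by rewrite (exprD z (y - n + x)) zN mulN1r mulrN1 opprK.
- rewrite mulr1; have -> : (y + n + x = (x - n + y) + N)%N by rewrite /rk; lia.
  by rewrite (exprD z (x - n + y)) zN mulN1r mulrN1.
- by rewrite mulrNN !mul1r; congr (_ ^+ _); lia.
Qed.

(** Conjugation multiplies [E_(p,q)] by [z^(p-q)], which cancels the powers of [z] and leaves the
    symplectic signs. The summand [N] in the exponent avoids truncated subtraction; as [z^N = - 1],
    it is paid for by the minus signs. *)
Lemma diagp_twist (z : K) (p q : I) : z ^+ N = - 1 ->
  diagp z *m twist nu p q (- z ^+ (N + val q - val p)) (- z^-1 ^+ (N + val q - val p))
    *m diagp z^-1 = twist nu p q 1 (eps p * eps q).
Proof.
move=> zN; have z0 : z != 0.
  by apply: contraTneq isT => z0; move/eqP: zN; rewrite z0 expr0n eq_sym oppr_eq0 oner_eq0.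
rewrite /twist mulmxBr mulmxBl -!scalemxAr -!scalemxAl !diagp_delta !scalerA.
have le : (val p <= N + val q)%N by rewrite (leq_trans (ltnW (ltn_ord p))) ?leq_addr.
set e := (N + val q - val p)%N.
have pe : z ^+ e * z ^+ val p = - z ^+ val q.
  by rewrite -exprD subnK // (exprD z N) zN mulN1r.
congr (_ *: _ - _ *: _).
  apply: (mulIf (expf_neq0 (val q) z0)); rewrite exprVn mulrA divfK ?expf_neq0 //.
  by rewrite mulNr pe opprK mul1r.
have H := eps_shift p q zN.
apply: (mulIf (expf_neq0 (val (p + nu)) z0)); rewrite !exprVn mulrA divfK ?expf_neq0 //.
apply: (mulfI (expf_neq0 e z0)).
rewrite [LHS]mulrA [z ^+ e * _]mulrN divff ?expf_neq0 // mulN1r.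
apply: (mulIf (expf_neq0 (val p) z0)).
rewrite mulNr -exprD H [RHS]mulrAC pe exprD; ring.
Qed.

Lemma twist_sum (kap : I -> I -> K) (X : M) :
  (forall p q, kap (p + nu) (q + nu) = kap p q) ->
  (forall p q, kap p q = kap q p) ->
  (forall p q, X p q = - kap p q * X (q + nu) (p + nu)) ->
  \sum_p \sum_q X p q *: twist nu p q 1 (kap p q) = 2%:R *: X.
Proof.
have D := nunD m.
move=> kN kS XA; apply/matrixP => i j; rewrite summxE.
under eq_bigr => p _ do rewrite summxE.
have EE p q : (X p q *: twist nu p q 1 (kap p q)) i j =
  X p q * ((i == p) && (j == q))%:R
  - X p q * kap p q * ((p == j + nu) && (q == i + nu))%:R.
  rewrite /twist !mxE mul1r -(eq_addnu D p j) -(eq_addnu D q i).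
  rewrite (eq_sym (p + nu)) (eq_sym (q + nu)) (andbC (j == _)); ring.
under eq_bigr => p _ do under eq_bigr => q _ do rewrite EE.
under eq_bigr => p _ do rewrite sumrB.
rewrite sumrB (bigD1 i) //= [X in _ + X - _]big1 => [|p /negPf pi]; last first.
  by apply: big1 => q _; rewrite eq_sym pi mulr0.
rewrite (bigD1 j) //= big1 => [|q /negPf qj]; last first.
  by rewrite eq_sym qj andbF mulr0.
rewrite (bigD1 (j + nu)) //= [X in _ - (_ + X)]big1 => [|p /negPf pj]; last first.
  by apply: big1 => q _; rewrite pj mulr0.
rewrite (bigD1 (i + nu)) //= big1 => [|q /negPf qi]; last first.
  by rewrite qi andbF mulr0.
rewrite !eqxx !mulr1 !addr0 mxE kN kS mulr_natl mulr2n [in X in _ = _ + X]XA.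
by rewrite mulrC mulNr.
Qed.

End Forms.

Section Components.
Variables (R : rcfType) (m : nat).
Local Notation K := R[i].
Local Notation n := m.+3.
Local Notation I := 'I_(rk m).+2.
Local Notation N := (rk m).+2.
Local Notation M := 'M[K]_N.
Local Notation nu := (nun m).
Local Notation eps := (eps K).

Lemma in_spP (X : M) : in_sp (n := n) X <->
  forall p q, X p q = - (eps p * eps q) * X (q + nu) (p + nu).
Proof.
have D := nunD m.
have Jent (p q : I) : (Jsp R n : M) p q = eps p * (q == p + nu)%:R.
  by have := @block_antidiag K m 1 (-1) p q; rewrite raddfN.
have ent (p q : I) : (X^T *m Jsp R n + Jsp R n *m X : M) p q =
    eps p * X (p + nu) q - eps q * X (q + nu) p.
  rewrite mxE mxE (bigD1 (q + nu)) //= big1 ?addr0 => [|k /negPf kq]; last first.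
    by rewrite Jent eq_sym (eq_addnu D) kq !mulr0.
  rewrite [(Jsp R n *m X) p q]mxE (bigD1 (p + nu)) //= big1 ?addr0 => [|k /negPf kq]; last first.
    by rewrite Jent kq mulr0 mul0r.
  rewrite !Jent eqxx mxE -addrA D addr0 eqxx eps_addnu !mulr1 addrC.
  by rewrite mulrN (mulrC (X _ _)).
split=> [H p q|H].
  have /matrixP/(_ (p + nu) q) := H; rewrite ent mxE eps_addnu -addrA D addr0.
  move/eqP; rewrite subr_eq0 => /eqP E1; apply: (mulfI (eps_neq0 K p)).
  apply: oppr_inj; rewrite -mulNr E1 mulNr mulrN opprK !mulrA.
  by rewrite eps_sqr mul1r.
apply/matrixP => p q; rewrite ent [RHS]mxE (H (p + nu) q) eps_addnu -addrA D addr0.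
by rewrite (mulNr (eps p)) opprK !mulrA eps_sqr mul1r subrr.
Qed.

Definition swap : M := \matrix_(p, q) (q == p + nu)%:R.
Definition soQ : M := block_mx 1%:M 1%:M ('i%:M) ((- 'i)%:M) : 'M[K]_(n + n).
Definition soQV : M := 2%:R^-1 *: (swap *m soQ^T).

Lemma mul_swap (Z : M) p q : (Z *m swap) p q = Z p (q + nu).
Proof.
have D := nunD m.
rewrite mxE (bigD1 (q + nu)) //= big1 ?addr0 => [|k /negPf kq].
  by rewrite mxE -addrA D addr0 eqxx mulr1.
by rewrite mxE eq_sym (eq_addnu D) kq mulr0.
Qed.

Lemma swap_swap : swap *m swap = 1%:M.
Proof.
by apply/matrixP => p q; rewrite mul_swap !mxE (inj_eq (addIr nu)) eq_sym.
Qed.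

(* Hence conjugation by [soQ] turns the twist condition at [s = 1] into
   antisymmetry. *)
Lemma soQ_form : soQ^T *m soQ = 2%:R *: swap.
Proof.
have H : (soQ : 'M[K]_(n + n))^T *m (soQ : 'M[K]_(n + n)) =
    block_mx 0 2%:R%:M 2%:R%:M 0.
  rewrite /soQ (tr_block_mx (m1 := n) (m2 := n)) !tr_scalar_mx.
  rewrite (mulmx_block (m1 := n)) -!scalar_mxM -!raddfD /= !mulr1 !mulrN !mulNr opprK.
  by rewrite -expr2 sqrCi subrr opprK -[1 + 1]/(2%:R) raddf0.
rewrite [LHS]H; apply/matrixP => p q; rewrite (@block_antidiag K m) !mxE; by case: ifP.
Qed.

Lemma soQVQ : soQV *m soQ = 1%:M.
Proof.
rewrite /soQV -scalemxAl -mulmxA soQ_form -scalemxAr scalerA mulVf ?pnatr_eq0 //.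
by rewrite scale1r swap_swap.
Qed.

Lemma soQQV : soQ *m soQV = 1%:M.
Proof. exact: (mulmx1C soQVQ). Qed.

Lemma in_soP (Z : M) : in_so (n := n) (soQ *m Z *m soQV) <->
  forall p q, Z p q = - Z (q + nu) (p + nu).
Proof.
have D := nunD m.
have XE : soQ *m Z *m soQV = 2%:R^-1 *: (soQ *m (Z *m swap) *m soQ^T).
  by rewrite /soQV -scalemxAr !mulmxA.
have S1 : in_so (n := n) (soQ *m Z *m soQV) <-> (Z *m swap)^T = - (Z *m swap).
  rewrite /in_so XE; move: (Z *m swap) => A.
  rewrite linearZ /= -scalerN !trmx_mul trmxK mulmxA; split=> [/(scalerI _) H|AN].
    have {}H : soQ *m A^T *m soQ^T = - (soQ *m A *m soQ^T).
      by apply: H; rewrite invr_eq0 pnatr_eq0.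
    have QT : soQ^T *m soQV^T = 1%:M by rewrite -trmx_mul soQVQ trmx1.
    have := congr1 (fun Y => soQV *m Y *m soQV^T) H.
    by rewrite mulmxN mulNmx !mulmxA soQVQ !mul1mx -!mulmxA QT !mulmx1.
  by rewrite AN mulmxN mulNmx.
rewrite {}S1; split=> [/matrixP H p q|H].
  have := H (p) (q + nu); rewrite mxE [in RHS]mxE !mul_swap -addrA D addr0.
  by move=> ->; rewrite opprK.
apply/matrixP => p q; rewrite mxE [in RHS]mxE !mul_swap H.
by rewrite -addrA D addr0.
Qed.

End Components.

(** * Loops with prescribed values *)

Section Loops.
Variables (K : numFieldType) (m : nat).
Local Notation I := 'I_(rk m).+2.
Local Notation N := (rk m).+2.
Local Notation M := 'M[K]_N.
Local Notation nu := (nun m).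

(** Diagonal loops are available as differences only. By the condition on [c], all diagonal entries
    carry the same function, so subtracting the loop at [(0,0)] from each of them costs [\tr Y]
    times that loop, which is 0. *)
Lemma loop_through (Y : M) (c : I -> I -> K) (f : {poly K}) :
  \tr Y = 0 -> (forall p, c p p = c 0 0) ->
  exists z : K -> M, (forall S, loop_closed nu S -> S z) /\
    forall s, z s = \sum_p \sum_q Y p q *:
      twist nu p q (c p q * s ^+ (N + val q - val p) * f.[s ^+ N])
                   (c p q * s^-1 ^+ (N + val q - val p) * f.[s^-1 ^+ N]).
Proof.
move=> trY cD; have D := nunD m.
pose a (p q : I) (s : K) := c p q * s ^+ (N + val q - val p) * f.[s ^+ N].
have la p q : lau (q - p) 1 (a p q).
  apply: (@lauP _ _ (N + val q - val p) _ _ _ 0 (c p q *: f)) => [|s s0].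
    rewrite natrB; last by rewrite (leq_trans (ltnW (ltn_ord p))) ?leq_addr.
    by rewrite natrD Zp_natN add0r !natr_Zp.
  by rewrite muln0 mulr1 mul1r hornerZ /a; ring.
have aD p : xf nu p p (a p p) = xf nu p p (a 0 0).
  by apply/funext => s; rewrite /xf /a cD !addnK.
pose z : K -> M := \sum_p \sum_q (if q == p then Y p p *: (xf nu p p (a p p) - xf nu 0 0 (a 0 0))
  else Y p q *: xf nu p q (a p q)).
have zE : z = \sum_p \sum_q Y p q *: xf nu p q (a p q).
  have -> : z = \sum_p \sum_q Y p q *: xf nu p q (a p q) - \sum_p Y p p *: xf nu 0 0 (a 0 0).
    rewrite -sumrB; apply: eq_bigr => p _; rewrite (bigD1 p) //= [in RHS](bigD1 p) //= eqxx.
    rewrite scalerBr addrAC; congr (_ + _ - _); apply: eq_bigr => q /negPf qp.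
    by rewrite qp.
  by move: trY; rewrite -[X in _ - X]scaler_suml /mxtrace => ->; rewrite scale0r subr0.
exists z; split=> [S HS|s]; last first.
  by rewrite zE fct_sumE; apply: eq_bigr => p _; rewrite fct_sumE.
have SS := lc_subspace HS.
apply: (subspace_sum SS) => p _; apply: (subspace_sum SS) => q _.
have [qp|qp] := eqVneq q p.
  apply: (subspaceZ SS); rewrite aD.
  apply: (xf_diag D (nun_neq1 m) (nun_neqm1 m) (nun_neqm2 m) (I_1 m) (I_2 m) HS).
  by have := la 0 0; rewrite subrr.
apply: (subspaceZ SS); have [qn|qn] := eqVneq q (p + nu).
  rewrite qn; apply: (xf_long D (nun_neq0 m) (nun_neq1 m) (nun_neqm1 m) (nun_neqm2 m)
    (I_1 m) (I_2 m) HS).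
  by have := la p q; rewrite {1}qn addrAC subrr add0r qn.
apply: (xf_lau D (nun_neq1 m) (nun_neqm1 m) (nun_neqm2 m) (I_1 m) (I_2 m) HS); last exact: la.
by rewrite /short subr_eq0 qp; znun qn.
Qed.

Definition in_all_loops (z : K -> M) := forall S, loop_closed nu S -> S z.

Lemma twist00 p q : twist nu p q 0 0 = 0 :> M.
Proof. by rewrite /twist !scale0r subr0. Qed.

Lemma loop_zero (Y : M) (c : I -> I -> K) (f : {poly K}) s :
  f.[s ^+ N] = 0 -> f.[s^-1 ^+ N] = 0 ->
  \sum_p \sum_q Y p q *:
      twist nu p q (c p q * s ^+ (N + val q - val p) * f.[s ^+ N])
                   (c p q * s^-1 ^+ (N + val q - val p) * f.[s^-1 ^+ N]) = 0.
Proof.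
move=> -> ->; rewrite big1 // => p _; rewrite big1 // => q _.
by rewrite !mulr0 twist00 scaler0.
Qed.

(** Since [f] vanishes at [s0^-N], the second half of each [twist] disappears at [s0], and the
    matrix units are reached one by one. *)
Lemma sl_reach (s0 : K) (f : {poly K}) (X : M) : s0 != 0 ->
  f.[s0 ^+ N] = 1 -> f.[s0^-1 ^+ N] = 0 -> \tr X = 0 ->
  exists z : K -> M, [/\ in_all_loops z, z s0 = X &
    forall s, f.[s ^+ N] = 0 -> f.[s^-1 ^+ N] = 0 -> z s = 0].
Proof.
move=> s00 f1 f0 trX.
have [|z [Sz zE]] := loop_through (c := fun p q => s0^-1 ^+ (N + val q - val p)) f trX.
  by move=> p; rewrite !addnK.
exists z; split=> // [|s fs fs']; last by rewrite zE loop_zero.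
rewrite zE [RHS]matrix_sum_delta; apply: eq_bigr => p _; apply: eq_bigr => q _.
rewrite f1 f0 mulr0 mulr1 -exprMn mulVf // expr1n /twist scale1r scale0r subr0.
by [].
Qed.

Lemma trace_antisym (kap : I -> I -> K) (X : M) : (forall p, kap p p = 1) ->
  (forall p q, X p q = - kap p q * X (q + nu) (p + nu)) -> \tr X = 0.
Proof.
move=> k1 XA; have H : \tr X = - \tr X.
  rewrite {1}/mxtrace (reindex_inj (addIr nu)) /= -sumrN; apply: eq_bigr => p _.
  by rewrite [X p p]XA k1 mulN1r opprK.
by apply/eqP; move/eqP: H; rewrite -subr_eq0 opprK -mulr2n -mulr_natr mulf_eq0 pnatr_eq0 orbF.
Qed.

End Loops.

Section Reach.
Variables (R : rcfType) (m : nat).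
Local Notation K := R[i].
Local Notation n := m.+3.
Local Notation I := 'I_(rk m).+2.
Local Notation N := (rk m).+2.
Local Notation M := 'M[K]_N.
Local Notation nu := (nun m).
Local Notation eps := (eps K).

Lemma sp_reach (z0 : K) (f : {poly K}) (X : M) : z0 ^+ N = - 1 ->
  f.[- 1] = 1 -> in_sp (n := n) X ->
  exists z : K -> M, [/\ in_all_loops z, diagp m z0 *m z z0 *m diagp m z0^-1 = X &
    forall s, f.[s ^+ N] = 0 -> f.[s^-1 ^+ N] = 0 -> z s = 0].
Proof.
move=> zN f1 /in_spP XA; pose kap (p q : I) : K := eps p * eps q.
have k1 p : kap p p = 1 by apply: eps_sqr.
have trX : \tr (2%:R^-1 *: X) = 0.
  by rewrite mxtraceZ (trace_antisym k1 XA) mulr0.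
(* The constant [- 1] provides the minus signs of [diagp_twist], and half of [X] is used because the
   sum over all positions yields twice the matrix. *)
have [//|z [Sz zE]] := loop_through (c := fun p q => - 1) f trX.
exists z; split=> // [|s fs fs']; last by rewrite zE loop_zero.
have S2 : \sum_p \sum_q X p q *: twist nu p q 1 (kap p q) = 2%:R *: X.
  apply: twist_sum => // p q; rewrite /kap ?eps_addnu ?mulrNN //.
  exact: mulrC.
rewrite -[RHS](scalerK (a := 2%:R)) ?pnatr_eq0 // -S2 zE mulmx_sumr mulmx_suml scaler_sumr.
apply: eq_bigr => p _; rewrite mulmx_sumr mulmx_suml scaler_sumr; apply: eq_bigr => q _.
have zNV : z0^-1 ^+ N = - 1 by rewrite exprVn zN invrN invr1.
rewrite zN zNV f1 !mulr1 !mulN1r -scalemxAr -scalemxAl.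
by rewrite diagp_twist // mxE scalerA.
Qed.

Lemma so_reach (f : {poly K}) (X : M) : f.[1] = 1 -> in_so (n := n) X ->
  exists z : K -> M, [/\ in_all_loops z, soQ R m *m z 1 *m soQV R m = X &
    forall s, f.[s ^+ N] = 0 -> f.[s^-1 ^+ N] = 0 -> z s = 0].
Proof.
move=> f1 Xso; pose Y := soQV R m *m X *m soQ R m.
have XY : X = soQ R m *m Y *m soQV R m.
  by rewrite /Y !mulmxA soQQV mul1mx -mulmxA soQQV mulmx1.
move: Xso; rewrite XY => /in_soP YA; pose kap (p q : I) : K := 1.
have {}YA p q : Y p q = - kap p q * Y (q + nu) (p + nu) by rewrite mulN1r.
have trY : \tr (2%:R^-1 *: Y) = 0.
  by rewrite mxtraceZ (@trace_antisym _ _ kap _ _ YA) ?mulr0.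
have [//|z [Sz zE]] := loop_through (c := fun p q => 1) f trY.
exists z; split=> // [|s fs fs']; last by rewrite zE loop_zero.
congr (_ *m _ *m _).
have S2 : \sum_p \sum_q Y p q *: twist nu p q 1 (kap p q) = 2%:R *: Y.
  exact: twist_sum.
rewrite -[RHS](scalerK (a := 2%:R)) ?pnatr_eq0 // -S2 zE scaler_sumr.
apply: eq_bigr => p _; rewrite scaler_sumr; apply: eq_bigr => q _.
by rewrite invr1 !expr1n f1 !mulr1 mxE scalerA.
Qed.

End Reach.

Section Algebras.
Variables (R : rcfType) (m : nat).
Local Notation K := R[i].
Local Notation n := m.+3.
Local Notation I := 'I_(rk m).+2.
Local Notation N := (rk m).+2.
Local Notation M := 'M[K]_N.
Local Notation nu := (nun m).
Local Notation eps := (eps K).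

Record lie_closed (S : M -> Prop) : Prop := LieClosed {
  lieS_subspace : subspace S;
  lieS_br : forall x y, S x -> S y -> S (mxbr x y) }.

Lemma form_closed (B : M) : lie_closed (fun X => X^T *m B + B *m X = 0).
Proof.
split; first split.
- by rewrite trmx0 mul0mx mulmx0 addr0.
- move=> X Y HX HY; rewrite linearD /= mulmxDl mulmxDr addrACA HX HY.
  exact: addr0.
- by move=> c X HX; rewrite linearZ /= -scalemxAl -scalemxAr -scalerDr HX scaler0.
move=> X Y /eqP; rewrite addr_eq0 => /eqP HX /eqP; rewrite addr_eq0 => /eqP HY.
rewrite /mxbr linearB /= !trmx_mul mulmxBl mulmxBr -!mulmxA HX HY !mulmxN !mulmxA HX HY.
by rewrite !mulNmx !opprK -!mulmxA addrC subrKA subrr.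
Qed.

Lemma in_sl_closed : lie_closed (in_sl (n := n)).
Proof.
split; last by move=> X Y _ _; apply: mxtrace_mxbr.
split; first exact: mxtrace0.
  by move=> X Y; rewrite /in_sl mxtraceD => -> ->; rewrite addr0.
by move=> c X; rewrite /in_sl mxtraceZ => ->; rewrite mulr0.
Qed.

Lemma in_sp_closed : lie_closed (in_sp (n := n)).
Proof. exact: form_closed. Qed.

Lemma in_so_closed : lie_closed (in_so (n := n)).
Proof.
have so1 (X : M) : in_so (n := n) X <-> X^T *m 1%:M + 1%:M *m X = 0.
  rewrite mulmx1 mul1mx; split=> [->|/eqP]; first exact: addNr.
  by rewrite addr_eq0 => /eqP.
have [[H0 HD HZ] Hbr] := form_closed 1%:M.
split=> [|X Y /so1 HX /so1 HY]; last by apply/so1/Hbr.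
split=> [|X Y /so1 HX /so1 HY|c X /so1 HX]; apply/so1.
- exact: H0.
- exact: HD.
- exact: HZ.
Qed.

Lemma twist_antisym (kap : I -> I -> K) (p q : I) :
  (forall p q, kap (p + nu) (q + nu) = kap p q) ->
  (forall p q, kap p q = kap q p) -> (forall p q, kap p q * kap p q = 1) ->
  forall i j, (twist nu p q 1 (kap p q)) i j =
    - kap i j * (twist nu p q 1 (kap p q)) (j + nu) (i + nu).
Proof.
have D := nunD m; move=> kN kS k1 i j; rewrite /twist !mxE !mul1r.
rewrite !(inj_eq (addIr nu)) !(eq_addnu D).
rewrite (andbC (j == p + nu)) (andbC (j == q)).
have [/andP[/eqP-> /eqP->]|_] := boolP ((i == p) && (j == q)).
  case: (_ && _); rewrite /= ?mulr1n ?mulr0n ?mulr0 ?mulr1 ?mul1r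
    ?sub0r ?subr0 mulNr ?mulrN ?opprK ?k1 //.
  by rewrite mulrBr k1 mulr1 opprB.
case: andP => [[/eqP-> /eqP->]|_]; last by rewrite /= mulr0 subrr mulr0.
by rewrite kN kS /= !mulr1 mulr0 sub0r subr0 mulr1.
Qed.

Lemma sl_gen (s : K) p : in_sl (n := n) (gen nu s p).
Proof.
have D := nunD m; have I1 := I_1 m.
rewrite /in_sl /mxtrace big1 // => i _; rewrite /gen /twist !mxE.
have -> : (i == p) && (i == p + 1) = false.
  by apply/andP => -[/eqP-> /eqP H]; case/negP: I1; apply/eqP; zlin H.
have -> : (i == p + 1 + nu) && (i == p + nu) = false.
  by apply/andP => -[/eqP-> /eqP H]; case/negP: I1; apply/eqP; zlin H.
by rewrite !mulr0 subr0.
Qed.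

Lemma sp_gen (z : K) p : z ^+ N = - 1 ->
  in_sp (n := n) (diagp m z *m gen nu z p *m diagp m z^-1).
Proof.
move=> zN; have zVN : z^-1 ^+ N = - 1 by rewrite exprVn zN invrN invr1.
have key c l : l = (N + val (p + 1)%R - val p)%N ->
    z = c * - z ^+ l -> z^-1 = c * - z^-1 ^+ l ->
    in_sp (n := n) (diagp m z *m gen nu z p *m diagp m z^-1).
  move=> lE E1 E2.
  have -> : gen nu z p = c *: twist nu p (p + 1) (- z ^+ l) (- z^-1 ^+ l).
    by rewrite -twist_scale -E1 -E2.
  rewrite -scalemxAr -scalemxAl lE diagp_twist //.
  apply: (subspaceZ (lieS_subspace in_sp_closed)).
  apply/in_spP; apply: (@twist_antisym (fun p q => eps p * eps q)) => i j.
  - by rewrite !eps_addnu mulrNN.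
  - exact: mulrC.
  - by rewrite mulrACA !eps_sqr mulr1.
have pv : val (p + 1) = ((val p).+1 %% N)%N.
  by rewrite -[(val p).+1]addn1.
have [pN|pN] := ltnP (val p).+1 N.
  apply: (key 1 N.+1); last 2 first.
  - by rewrite mul1r (exprS z) zN mulrN1 opprK.
  - by rewrite mul1r (exprS z^-1) zVN mulrN1 opprK.
  by rewrite pv (modn_small pN); move: (val p) => x; clear; lia.
(* For the last index, [p + 1] wraps to 0 and the exponent drops from [N + 1] to 1; the lost factor
   [z^N] becomes the sign. *)
apply: (key (- 1) 1%N); last 2 first.
- by rewrite mulrNN mul1r.
- by rewrite mulrNN mul1r.
have {}pN : (val p).+1 = N by apply/eqP; rewrite eqn_leq pN andbT; apply: ltn_ord.
by rewrite pv pN modnn addn0; have := subSnn (val p); rewrite {1}pN.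
Qed.

Lemma so_gen p : in_so (n := n) (soQ R m *m gen nu 1 p *m soQV R m).
Proof.
apply/in_soP => i j; rewrite /gen invr1.
have := @twist_antisym (fun _ _ => 1) p (p + 1) _ _ _ i j.
by rewrite mulN1r; apply=> // *; rewrite mulr1.
Qed.

End Algebras.

Section CyclicMorphism.
Variables (K : numFieldType) (T T' : lmodType K) (br : T -> T -> T) (br' : T' -> T' -> T').
Variables (I : comNzRingType) (nu : I) (a : I -> K) (u h : I -> T) (phi : T -> T').
Hypotheses (phiZ : forall c x, phi (c *: x) = c *: phi x)
  (phibr : forall x y, phi (br x y) = br' (phi x) (phi y)).

Lemma cyclic_morph : cyclic_rel br nu a u h ->
  cyclic_rel br' nu a (fun p => phi (u p)) (fun p => phi (h p)).
Proof.
have phi0 : phi 0 = 0 by rewrite -(scale0r 0) phiZ scale0r.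
move=> Rel; split=> [p q pq qp pn|p|p q|p|p]; rewrite -!phibr.
- by rewrite (cyc_comm Rel).
- by rewrite (cyc_nu Rel) -scaleN1r phiZ scaleN1r.
- by rewrite (cyc_h Rel).
- by rewrite (cyc_serre_r Rel).
- by rewrite (cyc_serre_l Rel).
Qed.

End CyclicMorphism.

(** * Evaluation at finitely many points *)

Section Evaluation.
Variables (R : rcfType) (m : nat) (ts : seq R[i]) (c d : bool).
Local Notation K := R[i].
Local Notation n := m.+3.
Local Notation I := 'I_(rk m).+2.
Local Notation N := (rk m).+2.
Local Notation M := 'M[K]_N.
Local Notation nu := (nun m).
Local Notation a := (size ts).
Local Notation L := (Melt R n a c d).
Local Notation Mbr := (@Mbr R n a c d).
Local Notation J := 'I_(kM a c d).
Local Notation W := (K -> M).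

Hypotheses (ts0 : 0 \notin ts) (ts_uniq : uniq ts)
  (tsV : forall t t', t \in ts -> t' \in ts -> t * t' != 1).

(** The value of [s^N] at the evaluation point of block [j]; the fixed points -1 and 1 of inversion
    carry [sp] and [so]. *)
Definition node (j : J) : K :=
  if (j < a)%N then ts`_j else if (j < a + c)%N then - 1 else 1.
Definition pt (j : J) : K :=
  if (j < a)%N then N.-root ts`_j else if (j < a + c)%N then N.-root (- 1) else 1.
Definition conjl (j : J) : M :=
  if (j < a)%N then 1%:M else if (j < a + c)%N then diagp m (pt j) else soQ R m.
Definition conjr (j : J) : M :=
  if (j < a)%N then 1%:M else if (j < a + c)%N then diagp m (pt j)^-1 else soQV R m.
Definition block_alg (j : J) (X : M) : Prop :=
  if (j < a)%N then in_sl (n := n) X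
  else if (j < a + c)%N then in_sp (n := n) X
  else in_so (n := n) X.

Lemma node_neq0 j : node j != 0.
Proof.
rewrite /node; case: ifP => [ja|_]; last by case: ifP; rewrite ?oppr_eq0 oner_eq0.
by apply: contraNneq ts0 => <-; apply: mem_nth.
Qed.

Lemma pt_exp j : pt j ^+ N = node j.
Proof.
rewrite /pt /node; case: ifP => _; first by rewrite rootCK.
by case: ifP => _; rewrite ?rootCK ?expr1n.
Qed.

Lemma pt_neq0 j : pt j != 0.
Proof. by have := node_neq0 j; rewrite -pt_exp expf_eq0. Qed.

Lemma conjrl j : conjr j *m conjl j = 1%:M.
Proof.
rewrite /conjr /conjl; case: ifP => _; first by rewrite mulmx1.
case: ifP => _; last exact: soQVQ.
by rewrite -{2}[pt j]invrK diagpV // invr_eq0 pt_neq0.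
Qed.

Lemma comp_closed j : lie_closed (block_alg j).
Proof.
rewrite /block_alg; case: (j < a)%N; first exact: in_sl_closed.
by case: (j < a + c)%N; [apply: in_sp_closed | apply: in_so_closed].
Qed.

Lemma comp_gen j p : block_alg j (conjl j *m gen nu (pt j) p *m conjr j).
Proof.
have H := pt_exp j; move: H; rewrite /block_alg /conjl /conjr /node.
case: ifP => ja; first by move=> _; rewrite mul1mx mulmx1; apply: sl_gen.
case: ifP => jc zN; first exact: sp_gen.
have -> : pt j = 1 by rewrite /pt ja jc.
exact: so_gen.
Qed.

Lemma ts_neq1 (t x : K) : t \in ts -> x * x = 1 -> (t == x) = false.
Proof.
by move=> tts x1; apply: contraNF (tsV tts tts) => /eqP->; rewrite x1.
Qed.

Lemma node_inj : injective node.
Proof.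
have Nf : ((- 1 : K) == 1) = false by apply/negP; rewrite eq_sym -subr_eq0 opprK -mulr2n pnatr_eq0.
have NN : (- 1 : K) * - 1 = 1 by rewrite mulrNN mulr1.
move=> j k; rewrite /node; have lj : (j < a + c + d)%N := ltn_ord j.
have lk : (k < a + c + d)%N := ltn_ord k.
have lc := leq_b1 c; have ld := leq_b1 d.
have tP (i : J) : (i < a)%N -> ts`_i \in ts by apply: mem_nth.
case: (ltnP j a) => ja; case: (ltnP k a) => ka.
- by move/eqP; rewrite nth_uniq // => /eqP/val_inj.
- by case: ifP => kc /eqP; rewrite ts_neq1 ?tP ?mulr1.
- by case: ifP => kc /esym/eqP; rewrite ts_neq1 ?tP ?mulr1.
case: (ltnP j (a + c)) => jc; case: (ltnP k (a + c)) => kc /eqP;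
  rewrite ?Nf ?[1 == _]eq_sym ?Nf // => _; apply/val_inj => /=.
  by move: ja ka jc kc lc; clear; move: (nat_of_ord j) (nat_of_ord k) (nat_of_bool c); lia.
move: lj lk jc kc ld; clear; move: (nat_of_ord j) (nat_of_ord k) (nat_of_bool d); lia.
Qed.

Lemma node_sqr (j : J) : (a <= j)%N -> node j * node j = 1.
Proof.
by rewrite /node leqNgt => /negPf->; case: ifP => _; rewrite ?mulrNN mulr1.
Qed.

Lemma node_mulV (j k : J) : node j * node k = 1 -> j = k /\ (a <= j)%N.
Proof.
have sym (i l : J) : (a <= l)%N -> node i * node l = 1 -> i = l.
  move=> /node_sqr la il; apply: node_inj; apply: (mulIf (node_neq0 l)).
  by rewrite il la.
have [ja|ja] := leqP a j.
  by rewrite mulrC => /(sym _ _ ja) ->.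
have [ka jk|ka] := leqP a k.
  by have jE := sym _ _ ka jk; rewrite -jE leqNgt ja in ka.
rewrite /node ja ka => /eqP; rewrite (negPf (tsV _ _)) //; exact: mem_nth.
Qed.

Definition ev (z : W) : L := [ffun j => conjl j *m z (pt j) *m conjr j].

Lemma ev_ext z w : (forall s, s != 0 -> z s = w s) -> ev z = ev w.
Proof. by move=> zw; apply/ffunP => j; rewrite !ffunE zw ?pt_neq0. Qed.

Lemma evD z w : ev (z + w) = ev z + ev w.
Proof. by apply/ffunP => j; rewrite !ffunE -mulmxDl -mulmxDr. Qed.

Lemma evZ t z : ev (t *: z) = t *: ev z.
Proof. by apply/ffunP => j; rewrite !ffunE scalemxAl scalemxAr. Qed.

Lemma ev0 : ev 0 = 0.
Proof. by rewrite -(scale0r 0) evZ !scale0r. Qed.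

Lemma ev_sum (T : finType) (F : T -> W) : ev (\sum_t F t) = \sum_t ev (F t).
Proof. exact: (big_morph ev evD ev0). Qed.

Lemma ev_br z w : ev (fun_br (@mxbr K N) z w) = Mbr (ev z) (ev w).
Proof.
apply/ffunP => j; rewrite !ffunE /fun_br /mxbr mulmxBr mulmxBl.
have H (x y : M) : conjl j *m x *m conjr j *m (conjl j *m y *m conjr j) =
    conjl j *m (x *m y) *m conjr j.
  by rewrite !mulmxA -[conjl j *m x *m _ *m _]mulmxA conjrl mulmx1.
by rewrite -!H.
Qed.

Lemma Mbr_lie : lie_bracket Mbr.
Proof.
have B := mxbr_lie K N; split=> [x y z|t x y|x y|x y z]; apply/ffunP => j; rewrite !ffunE.
- exact: (brDl B).
- exact: (brZl B).
- exact: (brC B).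
- exact: (brJ B).
Qed.

Lemma inM_subspace : subspace (@inM R n a c d).
Proof.
split=> [j|x y Hx Hy j|t x Hx j]; rewrite ffunE.
- exact: (subspace0 (lieS_subspace (comp_closed j))).
- exact: (subspaceD (lieS_subspace (comp_closed j)) (Hx j) (Hy j)).
- exact: (subspaceZ (lieS_subspace (comp_closed j)) t (Hx j)).
Qed.

Lemma inM_br x y : @inM R n a c d x -> @inM R n a c d y -> inM (Mbr x y).
Proof. by move=> Hx Hy j; rewrite ffunE; apply: (lieS_br (comp_closed j) (Hx j) (Hy j)). Qed.

(** Interpolation in the variable [s^N]: the blocks are independent because no node equals another
    node or the inverse of another node. *)
Lemma reach j X : block_alg j X -> exists z : W, in_all_loops z /\
  ev z = [ffun k => if k == j then X else 0].
Proof.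
move=> XA.
pose others := [seq k <- enum J | k != j].
(* The inverse of the node itself is included for an [sl] block only; for the nodes -1 and 1 it is
   the node again, where [f] must be 1. *)
pose bad := map node others ++ map (fun k => (node k)^-1) others
  ++ (if (j < a)%N then [:: (node j)^-1] else [::]).
have jbad : node j \notin bad.
  rewrite !mem_cat !negb_or; apply/and3P; split.
  - by apply/mapP => -[k]; rewrite mem_filter => /andP[kj _] /node_inj jk; rewrite jk eqxx in kj.
  - apply/mapP => -[k]; rewrite mem_filter => /andP[kj _] jk.
    have /node_mulV[jkE _] : node j * node k = 1 by rewrite jk mulVf ?node_neq0.
    by rewrite jkE eqxx in kj.
  - case: ifP => // ja; rewrite inE; apply/eqP => jk.
    have /node_mulV[_] : node j * node j = 1 by rewrite {1}jk mulVf ?node_neq0.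
    by rewrite leqNgt ja.
have [f f1 f0] := interpolation_point jbad.
have f_off k : k != j -> f.[pt k ^+ N] = 0 /\ f.[(pt k)^-1 ^+ N] = 0.
  move=> kj; rewrite exprVn pt_exp; split; apply: f0; rewrite !mem_cat.
    by apply/orP; left; apply: map_f; rewrite mem_filter kj mem_enum.
  apply/orP; right; apply/orP; left.
  by apply/mapP; exists k => //; rewrite mem_filter kj mem_enum.
have [z [Sz zj z0]] : exists z : W, [/\ in_all_loops z, conjl j *m z (pt j) *m conjr j = X &
    forall s, f.[s ^+ N] = 0 -> f.[s^-1 ^+ N] = 0 -> z s = 0].
  have := pt_exp j; have p0 := pt_neq0 j; move: XA f1; rewrite /block_alg /conjl /conjr /node.
  case: ifP => ja XA f1; [|case: ifP => jc in XA f1 *] => pN.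
  - have [||//|z [z1 z2 z3]] := sl_reach (s0 := pt j) (f := f) (X := X) p0.
    + by rewrite pN.
    + by rewrite exprVn pt_exp; apply: f0; rewrite !mem_cat ja inE eqxx !orbT.
    by exists z; split=> //; rewrite mul1mx mulmx1.
  - by apply: (sp_reach pN).
  - have -> : pt j = 1 by rewrite /pt ja jc.
    exact: so_reach.
exists z; split=> //; apply/ffunP => k; rewrite !ffunE; case: eqVneq => [->//|kj].
by have [H1 H2] := f_off k kj; rewrite z0 // mulmx0 mul0mx.
Qed.

Lemma ev_onto x : inM x -> exists z : W, in_all_loops z /\ ev z = x.
Proof.
move=> Mx; have /choice[z Hz] j := reach (Mx j).
exists (\sum_j z j); split=> [S HS|].
  by apply: (subspace_sum (lc_subspace HS)) => j _; apply: (Hz j).1.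
rewrite ev_sum; apply/ffunP => k; rewrite sum_ffunE (bigD1 k) //= (Hz k).2 ffunE eqxx.
by rewrite big1 ?addr0 // => j /negPf jk; rewrite (Hz j).2 ffunE eq_sym jk.
Qed.

Definition gen_M (p : I) : L := ev (fun s => gen nu s p).
Definition gen_hM (p : I) : L := ev (fun s => gen_h nu s p).

Lemma gen_M_cyclic : cyclic_rel Mbr nu (wcoef K nu) gen_M gen_hM.
Proof.
apply: (cyclic_morph evZ ev_br); apply: fun_cyclic => s.
exact: (gen_cyclic (nunD m) (nun_neq0 m) (nun_neq1 m) (nun_neqm1 m) (I_1 m) (I_2 m)).
Qed.

Lemma inM_gen p : inM (gen_M p).
Proof. by move=> j; rewrite ffunE; apply: comp_gen. Qed.

Lemma inM_gen_h p : inM (gen_hM p).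
Proof.
rewrite -[gen_hM p]opprK -(cyc_nu gen_M_cyclic); apply: (subspaceN inM_subspace).
by apply: inM_br; apply: inM_gen.
Qed.

Lemma ev_surj_hom : gim_surj_hom (fun i : 'I_n => gen_M (idx i))
  (fun i => - gen_M (idx i + nu)) (fun i => gen_hM (idx i)).
Proof.
split=> [i|].
  split; first exact: inM_gen.
  by split; [apply: (subspaceN inM_subspace); apply: inM_gen | apply: inM_gen_h].
split; first exact: (cyclic_gim Mbr_lie gen_M_cyclic).
move=> S Sg SD SZ Sbr x /ev_onto[z [Sz <-]].
apply: (Sz (fun z => S (ev z))); split.
- split=> [|y w|t y]; last by rewrite evZ; apply: SZ.
    by rewrite ev0 -(scale0r (gen_M (idx (ord0 : 'I_n)))); apply: SZ; apply: (Sg ord0).1.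
  by rewrite evD; apply: SD.
- by move=> y w Sy Sw; rewrite ev_br; apply: Sbr.
- by move=> y w Sy /ev_ext <-.
- move=> p; rewrite -[ev _]/(gen_M p); have [[i ->]|[i ->]] := idx_cases p.
    by have [] := Sg i.
  by rewrite -[gen_M _]opprK -scaleN1r; apply: SZ; have [_ []] := Sg i.
Qed.

End Evaluation.

(** * Modules *)

Section Transport.
Variables (R : rcfType) (n a : nat) (c d : bool) (dV : nat).
Local Notation K := R[i].
Local Notation L := (Melt R n a c d).
Local Notation Mbr := (@Mbr R n a c d).
Local Notation inM := (@inM R n a c d).
Variables (e f h : 'I_n -> L) (rho : L -> 'M[K]_dV).
Hypotheses (M0 : inM 0) (MZ : forall (t : K) x, inM x -> inM (t *: x))
  (Mb : forall x y, inM x -> inM y -> inM (Mbr x y))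
  (MD : forall x y, inM x -> inM y -> inM (x + y)).
Hypotheses (Hefh : gim_surj_hom e f h) (Hrho : M_rep rho).

(** As [rho] is controlled on [inM] only, membership is carried along with each relation. *)
Lemma rep_module : gim_module (fun i => rho (e i)) (fun i => rho (f i)) (fun i => rho (h i)).
Proof.
have [Mefh [[R1 [R1' [R2 R3]]] _]] := Hefh; have [rD [rZ rb]] := Hrho.
have Me i : inM (e i) by have [] := Mefh i.
have Mf i : inM (f i) by have [_ []] := Mefh i.
have Mh i : inM (h i) by have [_ []] := Mefh i.
have r0 : rho 0 = 0 by rewrite -(scale0r (0 : L)) rZ // scale0r.
have rN x : inM x -> rho (- x) = - rho x by move=> Mx; rewrite -scaleN1r rZ // scaleN1r.
have ri x k : inM x -> rho (x *~ k) = rho x *~ k.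
  by move=> Mx; rewrite -(scaler_int k x) -(scaler_int k (rho x)) rZ.
have rad k x y : inM x -> inM y -> inM (adpow Mbr k x y) /\
    rho (adpow Mbr k x y) = adpow (@mxbr K dV) k (rho x) (rho y).
  move=> Mx My; elim: k => [|k [Mk Ek]]; first by split.
  by split; [exact: Mb Mx Mk | rewrite [LHS](rb _ _ Mx Mk) Ek].
split; [|split; [|split]] => [i j|i|i j ij mij|i j ij mij].
- have [E1 E2] := R1 i j; rewrite -(rb _ _ (Mh i) (Me j)) -(rb _ _ (Mh i) (Mf j)) E1 E2.
  have Mfj : inM (f j *~ Mn i j) by rewrite -(scaler_int _ (f j)); apply: MZ (Mf j).
  by split; [exact: ri (Me j) | rewrite [LHS](rN _ Mfj); congr (- _); exact: ri (Mf j)].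
- by rewrite -(rb _ _ (Me i) (Mf i)) R1'.
- have [E1 [E2 [E3 E4]]] := R2 i j ij mij.
  rewrite -(rb _ _ (Me i) (Mf j)) -(rb _ _ (Mf i) (Me j)) E1 E2.
  by rewrite -(rad _ _ _ (Me i) (Me j)).2 -(rad _ _ _ (Mf i) (Mf j)).2 E3 E4 r0.
- have [E1 [E2 [E3 E4]]] := R3 i j ij mij.
  rewrite -(rb _ _ (Me i) (Me j)) -(rb _ _ (Mf i) (Mf j)) E1 E2.
  by rewrite -(rad _ _ _ (Me i) (Mf j)).2 -(rad _ _ _ (Mf i) (Me j)).2 E3 E4 r0.
Qed.

Lemma rep_irreducible : M_rep_irreducible rho ->
  gim_irreducible (fun i => rho (e i)) (fun i => rho (f i)) (fun i => rho (h i)).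
Proof.
have [Mefh [_ gen]] := Hefh; have [rD [rZ rb]] := Hrho.
move=> [d0 irr]; split=> // U stU; apply: irr => _ [x [Mx ->]].
pose S x := inM x /\ stablemx U (rho x).
suff [] : S x by [].
apply: (gen S) Mx => {x} [i|x y [Mx Sx] [My Sy]|t x [Mx Sx]|x y [Mx Sx] [My Sy]].
- have [Me [Mf Mh]] := Mefh i.
  by split; [|split]; (split; first by assumption); apply: stU; exists i; auto.
- split; first exact: MD Mx My.
  by rewrite (rD _ _ Mx My) stablemxD.
- split; first exact: MZ Mx.
  by rewrite (rZ _ _ Mx) -scalemxAr scalemx_sub.
- split; first exact: Mb Mx My.
  by rewrite (rb _ _ Mx My) stablemxD ?stablemxN ?stablemxM.
Qed.

End Transport.

Section Nodes.
Variable K : numFieldType.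

(* [t * t' != 1] because a twisted loop at [s] determines its value at [1/s]. *)
Definition nodes (ts : seq K) := [/\ 0 \notin ts, uniq ts &
  forall t t', t \in ts -> t' \in ts -> t * t' != 1].

Lemma nodes_size a : exists2 ts, nodes ts & size ts = a.
Proof.
(* The numbers 2, 3, 4, ... are distinct, and no product of two of them is 1. *)
exists [seq (j + 2)%:R | j <- iota 0 a]; last by rewrite size_map size_iota.
split.
- by apply/mapP => -[j _] /eqP; rewrite eq_sym pnatr_eq0 addn2.
- by rewrite map_inj_uniq ?iota_uniq // => i j /eqP; rewrite eqr_nat eqn_add2r => /eqP.
move=> _ _ /mapP[i _ ->] /mapP[j _ ->].
by rewrite -natrM (eqr_nat _ _ 1) !addn2.
Qed.

(** From each pair of inverse roots one is kept; the roots 1 and -1 are left to the [so] and [sp]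
    blocks. *)
Lemma nodes_cover (rs : seq K) : exists2 ts, nodes ts &
  forall t, t \in rs -> t != 0 -> [\/ t * t = 1, t \in ts | t^-1 \in ts].
Proof.
elim: rs => [|t rs [ts [ts0 tsu tsV] Hts]]; first by exists [::].
have [H|] := boolP [|| t == 0, t * t == 1, t \in ts | t^-1 \in ts]; last first.
  rewrite !negb_or => /and4P[t0 t1 tts tVts].
  exists (t :: ts).
    split; first by rewrite inE eq_sym negb_or t0.
      by rewrite /= tts.
    have tV x : x \in ts -> t * x != 1.
      move=> xts; apply: contraNneq tVts => tx.
      by rewrite -[t^-1]mulr1 -tx mulKf.
    move=> x y; rewrite !inE => /orP[/eqP->|xts] /orP[/eqP->|yts] //; last exact: tsV.
      exact: tV.
    by rewrite mulrC; apply: tV.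
  move=> x; rewrite !inE => /orP[/eqP->|/Hts H x0]; first by constructor 2; rewrite eqxx.
  by case: (H x0) => xE; [constructor 1|constructor 2|constructor 3]; rewrite // xE orbT.
exists ts => // x; rewrite inE => /orP[/eqP-> x0|]; last exact: Hts.
case/or4P: H => [H|H|H|H];
  [by rewrite H in x0|constructor 1; exact/eqP|by constructor 2|by constructor 3].
Qed.

End Nodes.

Lemma node_cover (R : rcfType) (ts : seq R[i]) (t : R[i]) :
  [\/ t * t = 1, t \in ts | t^-1 \in ts] ->
  exists j : 'I_(kM (size ts) true true), t = node j \/ t = (node j)^-1.
Proof.
have mem x : x \in ts -> exists j : 'I_(kM (size ts) true true), x = node j.
  move=> xts; have lt : (index x ts < kM (size ts) true true)%N.
    by rewrite /kM (leq_trans (n := size ts)) ?index_mem // -addnA leq_addr.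
  by exists (Ordinal lt); rewrite /node /= index_mem xts nth_index.
case=> [/eqP|/mem[j ->]|/mem[j tE]]; last 2 first.
- by exists j; left.
- by exists j; right; rewrite -tE invrK.
rewrite -expr2 sqrf_eq1 => /orP[] /eqP->.
  have lt : ((size ts).+1 < kM (size ts) true true)%N by rewrite /kM !addn1.
  by exists (Ordinal lt); left; rewrite /node /= ltnNge leqnSn addn1 ltnn.
have lt : (size ts < kM (size ts) true true)%N by rewrite /kM !addn1.
by exists (Ordinal lt); left; rewrite /node /= ltnn addn1 ltnSn.
Qed.

(** * Factoring an irreducible module through the evaluation *)

Section FromGimModule.
Variables (R : rcfType) (m dV : nat).
Local Notation K := R[i].
Local Notation n := m.+3.
Local Notation I := 'I_(rk m).+2.
Local Notation N := (rk m).+2.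
Local Notation M := 'M[K]_N.
Local Notation nu := (nun m).
Variables (E F H : 'I_n -> 'M[K]_dV).
Hypotheses (Gmod : gim_module E F H) (Girr : gim_irreducible E F H).
Local Notation U := (gim_u E F).
Local Notation Ud := (gim_h H).
Local Notation brT := (@brT K (rk m) dV).
Local Notation uT := (uT nu U).
Local Notation hT := (hT nu Ud).
Local Notation P := (lie_gen brT uT hT).

Let RU : cyclic_rel (@mxbr K dV) nu (wcoef K nu) U Ud.
Proof. exact: (gim_cyclic (mxbr_lie K dV) Gmod). Qed.

Let RT : cyclic_rel brT nu (wcoef K nu) uT hT.
Proof.
exact: (uT_cyclic (nunD m) (nun_neq0 m) (nun_neq1 m) (nun_neqm1 m) (I_1 m) (I_2 m) RU).
Qed.

Let LT : lie_bracket brT := brT_lie K (rk m) dV.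

Let PS : subspace P. Proof. exact: lie_gen_subspace. Qed.

Let Pbr x y : P x -> P y -> P (brT x y).
Proof. exact: (lie_gen_br LT RT (I_1 m) (I_2 m) (I_3 m) (I_4 m)). Qed.

Let Pu p : P (uT p). Proof. exact: lie_gen_u. Qed.

Lemma gim_u_irreducible : irreducible_ops (fun A => exists p, A = U p).
Proof.
have [d0 irr] := Girr; split=> // V stV; apply: irr.
have stE i : stablemx V (E i) by apply: stV; exists (idx i); rewrite /gim_u glue_l.
have stF i : stablemx V (F i).
  by rewrite -[F i]opprK stablemxN; apply: stV; exists (idx i + nu); rewrite /gim_u glue_r.
have [_ [EF _]] := Gmod.
move=> _ [i [->|[->|->]]] //.
by rewrite -EF stablemxD ?stablemxN ?stablemxM.
Qed.

Let irr := gim_u_irreducible.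

Lemma gim_module_nodes : exists2 ts : seq K, nodes ts &
  forall w, P w -> ev ts true true w.1 = 0 -> w.2 = 0.
Proof.
have [g g0 Hg] := vanishing_kernel (nunD m) (nun_neq0 m) (nun_neq1 m) (nun_neqm1 m)
  (nun_neq2 m) (nun_neqm2 m) (I_1 m) (I_2 m) (I_3 m) (I_4 m) RU irr.
have [rs gE] := closed_field_poly_normal g.
have [ts tsN Hts] := nodes_cover rs; exists ts => // w Pw ew0.
have [ts0 tsu tsV] := tsN.
pose ss := [seq pt m j | j <- enum 'I_(kM (size ts) true true)].
have ssP (j : 'I_(kM (size ts) true true)) : pt m j \in ss by apply: map_f; rewrite mem_enum.
apply: (Hg ss) => // [t t0 gt|_ /mapP[j _ ->]].
  have trs : t \in rs.
    by move: gt; rewrite gE rootZ ?lead_coef_eq0 // root_prod_XsubC.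
  have [j tj] := node_cover (Hts t trs t0).
  exists (pt m j); split=> //; first exact: pt_neq0.
  by case: tj => ->; [left | right]; rewrite ?exprVn pt_exp.
have /ffunP/(_ j) := ew0; rewrite !ffunE => E1.
have rl := conjrl m ts0 j.
have := congr1 (fun X : M => conjr m j *m X *m conjl m j) E1.
by rewrite mulmx0 mul0mx !mulmxA rl mul1mx -mulmxA rl mulmx1.
Qed.

(** [rho x] is the operator of any element of [P] whose loop evaluates to [x]; [gim_module_nodes]
    makes it independent of the choice. *)
Lemma gim_module_factors : exists (a : nat) (c d : bool), (0 < a + c + d)%N /\
  exists e f h : 'I_n -> Melt R n a c d, gim_surj_hom e f h /\
    exists rho : Melt R n a c d -> 'M[K]_dV, M_rep rho /\ M_rep_irreducible rho /\
      forall i, rho (e i) = E i /\ rho (f i) = F i /\ rho (h i) = H i.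
Proof.
have [ts [ts0 tsu tsV] ker] := gim_module_nodes.
pose L := Melt R n (size ts) true true.
(* Both fixed points are always included: [rho] is not asked to be faithful, so a block may act by
   0. *)
exists (size ts), true, true; split; first by rewrite !addn1.
have surj := ev_surj_hom m true true ts0 tsu tsV.
exists (fun i => gen_M ts true true (idx i)), (fun i => - gen_M ts true true (idx i + nu)),
  (fun i => gen_hM ts true true (idx i)); split=> //.
have [Mefh [[_ [efh _]] gen]] := surj.
have iS := inM_subspace m ts true true.
(* Outside [inM] the value is arbitrary and set to 0, so that [choice] yields a total function. *)
have graph (x : L) : exists y, inM x ->
    exists w, [/\ P w, ev ts true true w.1 = x & w.2 = y].
  have [Mx|nMx] := pselect (inM x); last by exists 0.
  have [z [Sz zx]] := ev_onto ts0 tsu tsV Mx.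
  have [w [Pw wz]] : lifts nu U Ud z.
    apply: Sz; exact: (lifts_closed (nunD m) (nun_neq0 m) (nun_neq1 m) (nun_neqm1 m)
      (I_1 m) (I_2 m) (I_3 m) (I_4 m) RU).
  exists w.2 => _; exists w; split=> //; rewrite -zx.
  by apply: ev_ext.
have {graph} [rho Hrho] := choice graph.
have rhoE w x : P w -> ev ts true true w.1 = x -> inM x -> rho x = w.2.
  move=> Pw wx /Hrho[w' [Pw' ww' <-]]; apply/eqP; rewrite -subr_eq0; apply/eqP.
  apply: (ker (w' - w)); first exact: (subspaceB PS).
  rewrite -[(w' - w).1]/(w'.1 - w.1) -scaleN1r evD evZ ww' wx scaleN1r.
  exact: subrr.
have rhoM : M_rep rho.
  split=> [x y Mx My|]; last split=> [t x Mx|x y Mx My].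
  - have [w [Pw wx <-]] := Hrho x Mx; have [w' [Pw' wy <-]] := Hrho y My.
    apply: (rhoE (w + w')); [exact: (subspaceD PS)| |exact: (subspaceD iS Mx My)].
    by rewrite -[(w + w').1]/(w.1 + w'.1) evD wx wy.
  - have [w [Pw wx <-]] := Hrho x Mx.
    apply: (rhoE (t *: w)); [exact: (subspaceZ PS)| |exact: (subspaceZ iS t Mx)].
    by rewrite -[(t *: w).1]/(t *: w.1) evZ wx.
  - have [w [Pw wx <-]] := Hrho x Mx; have [w' [Pw' wy <-]] := Hrho y My.
    apply: (rhoE (brT w w')); [exact: Pbr| |exact: inM_br].
    by rewrite -[(brT w w').1]/(fun_br (@mxbr K N) w.1 w'.1) ev_br ?wx ?wy.
have rE i : rho (gen_M ts true true (idx i)) = E i.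
  rewrite (rhoE (uT (idx i))) //; first exact: glue_l.
  by have [] := Mefh i.
have rF i : rho (- gen_M ts true true (idx i + nu)) = F i.
  rewrite (rhoE (- uT (idx i + nu))).
  - by rewrite -[LHS]/(- U (idx i + nu)) /gim_u glue_r opprK.
  - exact: (subspaceN PS).
  - rewrite -[(- uT _).1]/(- (uT (idx i + nu)).1) -scaleN1r evZ scaleN1r.
    by [].
  - by have [_ []] := Mefh i.
have rH i : rho (gen_hM ts true true (idx i)) = H i.
  have [_ [EF _]] := Gmod; have [Me [Mf _]] := Mefh i.
  by rewrite -efh rhoM.2.2 // rE rF EF.
exists rho; split=> //.
split=> //.
have [d0 irr'] := Girr; split=> // V stV; apply: irr' => _ [i [->|[->|->]]].
- by apply: stV; exists (gen_M ts true true (idx i)); split=> //; have [] := Mefh i.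
- by apply: stV; exists (- gen_M ts true true (idx i + nu)); split=> //; have [_ []] := Mefh i.
- by apply: stV; exists (gen_hM ts true true (idx i)); split=> //; have [_ []] := Mefh i.
Qed.

End FromGimModule.

Theorem theorem3p3 (R : rcfType) (n : nat) (hn : (3 <= n)%N) :
  (* (1) *)
  (forall (a : nat) (c d : bool), (0 < a + c + d)%N ->
     exists e f h : 'I_n -> Melt R n a c d,
       gim_surj_hom e f h /\
       forall (dV : nat) (rho : Melt R n a c d -> 'M[R[i]]_dV),
         M_rep rho -> M_rep_irreducible rho ->
         gim_module (fun i => rho (e i)) (fun i => rho (f i))
                    (fun i => rho (h i)) /\
         gim_irreducible (fun i => rho (e i)) (fun i => rho (f i))
                         (fun i => rho (h i))) /\
  (* (2) *)
  (forall (dV : nat) (E F H : 'I_n -> 'M[R[i]]_dV),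
     gim_module E F H -> gim_irreducible E F H ->
     exists (a : nat) (c d : bool), (0 < a + c + d)%N /\
       exists e f h : 'I_n -> Melt R n a c d,
         gim_surj_hom e f h /\
         exists rho : Melt R n a c d -> 'M[R[i]]_dV,
           M_rep rho /\ M_rep_irreducible rho /\
           forall i, rho (e i) = E i /\ rho (f i) = F i /\ rho (h i) = H i).
Proof.
case: n hn => [|[|[|m]]] // _; split=> [a c d _|dV E F H Gmod Girr]; last first.
  exact: gim_module_factors.
have [ts [ts0 tsu tsV] <-] := nodes_size R[i] a.
have surj := ev_surj_hom m c d ts0 tsu tsV.
have [M0 MD MZ] := inM_subspace m ts c d.
have Mb := @inM_br R m ts c d.
exists (fun i => gen_M ts c d (idx i)), (fun i => - gen_M ts c d (idx i + nun m)),
  (fun i => gen_hM ts c d (idx i)); split=> // dV rho rhoM irr; split.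
  exact: (rep_module M0 MZ Mb surj rhoM).
exact: (rep_irreducible MZ Mb MD surj rhoM irr).
Qed.
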